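(* The simplicial subset $f\text{-}\mathcal{B}ialg$ of $\mathcal P re\mathcal B ialg$ consisting of those simplices $\{A_i,\varphi_\sigma\}$ such that $\varphi_\sigma$ satisfies the simplification relations of $f$-bialgebras for every $\sigma$ with $\dim\sigma=0$, and the simplification relations of morphisms of $f$-bialgebras for every $\sigma$ with $\dim\sigma=1$, is a weak Kan complex (every inner horn in it can be filled).
   Context: $R$ is a fixed ring (say $\mathbb Z$). **Multi-indices.** A multi-index is a finite nonempty sequence $k=(k_1,\dots,k_a)$ of integers $\ge 1$; $|k|=\sum k_i$, $n(k)=a$, $v(k)=|k|-n(k)$, $1_a=(1,\dots,1)$ ($a$ entries). For a pair $k,l$ write $a=n(k)$, $b=n(l)$. $k$ is vertical if $k=1_a$, almost vertical if its entries are $1$'s and $2$'s with at least one $2$. $\mathrm{Vert}(k)=\{1,\dots,|k|\}\setminus\{k_1,k_1+k_2,\dots,|k|\}$. If $|k^0|=n(k^1)$, $k^1\sharp k^0$ is the multi-index of length $n(k^0)$ obtained by grouping the entries of $k^1$ in consecutive blocks of lengths $k^0_1,k^0_2,\dots$ and summing each block. $\heartsuit^{k^1}_{k^0}=\sum_{h=1}^{n(k^1)}(k^1_h-1)\,\mathrm{Card}(\mathrm{Vert}(k^0)\cap[h,\infty))$. **$\mathcal P re\mathcal B ialg$.** For a graded $R$-module $A$, $(A^b)^a=(A^{\otimes b})^{\otimes a}$. The graded linear category $(R,ud)\text{-}mod$ has graded $R$-modules as objects, and $\hom(A,B)=\prod_{k,l}\hom_R((A^{b})^{|k|},(B^{|l|})^{a})[-(v(k)+v(l))]$,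 i.e. $\deg\varphi^k_l=|\varphi^k_l|-v(k)-v(l)$ where $|\varphi^k_l|$ is the degree as a map. Composition: $(\psi\circ\varphi)^k_l=\sum(-1)^{s}\psi^{k^0}_{l^0}\circ\varphi^{k^1}_{l^1}$ over all $k=k^1\sharp k^0$, $l=l^0\sharp l^1$, where with $x^i=v(k^i)$, $y^i=v(l^i)$: $s=\heartsuit^{k^1}_{k^0}+\heartsuit^{l^0}_{l^1}+y^0(x^1+y^1)+(x^0+y^0)\deg\varphi^{k^1}_{l^1}$. Identity: $id_{(A^b)^a}$ for $k=1_a,l=1_b$, and $0$ otherwise. $\mathcal P re\mathcal B ialg=N_{dg}(\mathcal{C}h_{(R,ud)\text{-}mod})$ is the dg nerve of its dg category of chain complexes. An $n$-simplex consists of $(A_i,\alpha_i)$, $0\le i\le n$, with $\alpha_i\in\hom(A_i,A_i)$ of degree $-1$, $\alpha_i\circ\alpha_i=0$ (write $\varphi_{[i]}=\alpha_i$), and, for each $\sigma=[\sigma_0<\dots<\sigma_m]\subset[n]$ with $m=\dim\sigma\ge1$, $\varphi_\sigma\in\hom(A_{\sigma_m},A_{\sigma_0})$ of degree $m-1$ with $\partial(\varphi_\sigma)=\sum_{i=1}^{m-1}(-1)^i(\varphi_{\partial_i\sigma}-\varphi_{[\sigma_0,..,\sigma_i]}\circ\varphi_{[\sigma_i,..,\sigma_m]})$, where $\partial(\varphi)=\alpha\circ\varphi-(-1)^{\deg\varphi}\varphi\circ\alpha$ and $\partial_i\sigma$ omits $\sigma_i$. **Notation $\simeq$.** $P\simeq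 P_1\otimes\dots\otimes P_r$ means equality after identifying $(A^b)^{a_1+\dots+a_r}$ with $\bigotimes(A^b)^{a_i}$, or, when $b=b_1+\dots+b_r$ is split, $(A^b)^a$ with $\bigotimes(A^{b_i})^a$ by first exchanging the roles of $a$ and $b$ (rows and columns of the grid); all permutations of factors, including those moving a deleted middle block to the end, use the Koszul sign. **Simplification relations of $f$-bialgebras** for $(A,\alpha)$: (T) for $a,b\ge1$, $\alpha^{1_a}_{1_b}$ is the tensor product differential induced by $\alpha^1_1$; (V) if $k=1_a$ and $l=(1,..,1,l_j,1,..,1)$, $l_j\ge2$, then $\alpha^k_l\simeq id_{(A^{j-1})^a}\otimes\alpha^k_{l_j}\otimes id_{(A^{b-j})^a}$; if $l=1_b$ and $k=(1,..,1,k_i,1,..,1)$, $k_i\ge 2$, then $\alpha^k_l\simeq id_{(A^b)^{i-1}}\otimes\alpha^{k_i}_l\otimes id_{(A^b)^{a-i}}$; if one of $k,l$ is vertical and the other has at least two entries $\ge2$, $\alpha^k_l=0$; (D) if $l$ is almost vertical, $k_i=1$ and $\hat k$ is $k$ with $k_i$ removed, $\alpha^k_l\simeq\alpha^{\hat k}_l\otimes\tilde\alpha^1_{l}$ with $\tilde\alpha^1_l=\tilde\alpha^1_{l_1}\otimes\dots\otimes\tilde\alpha^1_{l_b}$, $\tilde\alpha^1_1=id_A$, $\tilde\alpha^1_2=\alpha^1_2$; if $k$ is almost vertical, $l_i=1$ and $\hat l$ is $l$ with $l_i$ removed, $\alpha^k_l\simeq\alpha^k_{\hat l}\otimes\tilde\alpha^k_1$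 with $\tilde\alpha^k_1=\tilde\alpha^{k_1}_1\otimes\dots\otimes\tilde\alpha^{k_a}_1$, $\tilde\alpha^1_1=id_A$, $\tilde\alpha^2_1=\alpha^2_1$. **Simplification relations of morphisms** for $\varphi$: (W) $\varphi^k_l\simeq\varphi^{k_1}_l\otimes\dots\otimes\varphi^{k_a}_l$ if $l$ is vertical, and $\varphi^k_l\simeq\varphi^k_{l_1}\otimes\dots\otimes\varphi^k_{l_b}$ if $k$ is vertical. *)

(* Defs.v *)
From HB Require Import structures.
From mathcomp Require Import all_boot all_order all_algebra.
From mathcomp Require Import boolp.

Set Implicit Arguments.
Unset Strict Implicit.
Unset Printing Implicit Defensive.

Import GRing.Theory.

Local Open Scope ring_scope.
Local Open Scope quotient_scope.

Definition is_mindex (s : seq nat) : bool := (s != [::]) && all (leq 1) s.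

(* For k : mindex, n(k) is size k and |k| is sumn k. *)
Record mindex : Type := MIndex { mival :> seq nat; _ : is_mindex mival }.

HB.instance Definition _ := [isSub for mival].
HB.instance Definition _ := [Choice of mindex by <:].

(* The multi-index with entries s, with junk value (1) when s is not a
   multi-index. *)
Definition mi (s : seq nat) : mindex := insubd (@MIndex [:: 1%N] isT) s.

(* The subtraction is never truncated on multi-indices. *)
Definition mv (k : mindex) : nat := (sumn k - size k)%N.

Definition vertical (k : mindex) : bool := all (pred1 1%N) k.

Definition almost_vertical (k : mindex) : bool :=
  all [pred x | (x == 1%N) || (x == 2%N)] k && (2%N \in mival k).

(* scanl addn 0 k lists the partial sums k_1, k_1 + k_2, .., |k|. *)
Definition Vert (k : mindex) : seq nat :=
  [seq x <- iota 1 (sumn k) | x \notin scanl addn 0%N k].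

Definition sharp (k1 k0 : mindex) : seq nat :=
  [seq sumn s | s <- reshape k0 k1].

(* The exponent written with a heart, superscript k1 and subscript k0; its
   index h is i + 1. *)
Definition heart (k1 k0 : mindex) : nat :=
  (\sum_(i < size k1) (nth 0 k1 i).-1 * count (leq i.+1) (Vert k0))%N.

Fixpoint compositions (n : nat) : seq (seq nat) :=
  if n is n'.+1 then
    flatten [seq if c is x :: c' then [:: 1%N :: c; x.+1 :: c'] else [:: [:: 1%N]]
            | c <- compositions n']
  else [:: [::]].

Definition mindices (n : nat) : seq mindex := undup (pmap insub (compositions n)).

Lemma mem_compositions n s :
  (s \in compositions n) = all (leq 1) s && (sumn s == n).
Proof.
elim: n s => [|n IHn] s.
  rewrite /= inE; case: s => [|x s] //=; rewrite addn_eq0.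
  by case: x => //= x; rewrite andbF.
rewrite /=; apply/flattenP/andP => [[t /mapP[c c_n ->]]|[s_pos /eqP s_n]].
  move: c_n; rewrite IHn => /andP[c_pos /eqP c_n].
  case: c c_pos c_n => [_ <-|x c]; first by rewrite inE => /eqP->.
  move=> /= /andP[x_gt0 c_pos] c_n.
  by rewrite !inE => /orP[] /eqP-> /=; rewrite ?x_gt0 c_pos -c_n.
case: s s_pos s_n => [|[|x] s] //= s_pos; rewrite addSn => -[s_n].
case: x s_n => [|x] s_n.
  exists (if s is y :: s' then [:: 1%N :: s; y.+1 :: s'] else [:: [:: 1%N]]).
    by apply/mapP; exists s => //; rewrite IHn s_pos -s_n add0n eqxx.
  by case: s {s_pos s_n} => [|y s]; rewrite !inE eqxx.
exists [:: [:: 1%N, x.+1 & s]; x.+2 :: s]; last by rewrite !inE eqxx orbT.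
by apply/mapP; exists (x.+1 :: s) => //; rewrite IHn /= s_pos s_n eqxx.
Qed.

Lemma mem_mindices n (k : mindex) : (k \in mindices n) = (sumn k == n).
Proof.
rewrite mem_undup mem_pmap_sub mem_compositions /=.
by case: k => k /= /andP[_ ->].
Qed.

(* All (p, q) such that p sharp q is defined, i.e. |q| = n(p), and equal to k;
   sharp preserves |_| in its first argument, whence |p| = |k|. *)
Definition splittings (k : mindex) : seq (mindex * mindex) :=
  [seq pq <- [seq (p, q) | p : mindex <- mindices (sumn k),
                           q : mindex <- mindices (size p)]
  | sharp pq.1 pq.2 == k].

Definition gmod (R : comPzRingType) : Type := int -> lmodType R.

Definition isign {R : comPzRingType} (d : int) : R := (-1) ^+ `|d|%N.

Section TensorPowers.
Context {R : comPzRingType}.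
Implicit Types A B : gmod R.

Definition comp_choice A : int -> choiceType := fun d => A d.

Definition helt A : Type := {d : int & comp_choice A d}.

HB.instance Definition _ A := Choice.on (helt A).

Definition Hom_elt A (d : int) (x : A d) : helt A :=
  existT (fun d => comp_choice A d) d x.

Definition word A := seq (helt A).

HB.instance Definition _ A := Choice.on (word A).

Definition wdeg A (w : word A) : int := \sum_(x <- w) tag x.

Definition formal A := seq (R * word A).

HB.instance Definition _ A := Choice.on (formal A).

(* The congruence on formal linear combinations generated by the axioms of
   R-modules and by multilinearity in each letter. *)
Inductive tensor_rel A : formal A -> formal A -> Prop :=
| TRefl x : tensor_rel x x
| TSym x y : tensor_rel x y -> tensor_rel y x
| TTrans x y z : tensor_rel x y -> tensor_rel y z -> tensor_rel x z
| TCat x x' y y' :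
    tensor_rel x x' -> tensor_rel y y' -> tensor_rel (x ++ y) (x' ++ y')
| TComm x y : tensor_rel (x ++ y) (y ++ x)
| TZero w : tensor_rel [:: (0, w)] [::]
| TAdd a b w : tensor_rel [:: (a + b, w)] [:: (a, w); (b, w)]
| TLin a b (u v : word A) d (x y : A d) :
    tensor_rel [:: (a, u ++ Hom_elt (b *: x + y) :: v)]
               [:: (a * b, u ++ Hom_elt x :: v); (a, u ++ Hom_elt y :: v)].

Definition tensor_eq A : rel (formal A) := fun x y => `[< tensor_rel x y >].

Lemma tensor_eq_equiv A : equiv_class_of (@tensor_eq A).
Proof.
split=> [x|x y|y x z]; first exact/asboolP/TRefl.
  by apply/asboolP/asboolP; apply: TSym.
by move=> /asboolP xy /asboolP yz; apply/asboolP; apply: TTrans xy yz.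
Qed.

Canonical tensor_equiv A := EquivRelPack (@tensor_eq_equiv A).

(* The direct sum over n of the tensor powers of A. The n-th tensor power is
   the span of the words of length n; the class of the word x_1 .. x_n is the
   tensor x_1 (x) .. (x) x_n. *)
Definition tensor A : Type := {eq_quot @tensor_equiv A}.

HB.instance Definition _ A := Choice.on (tensor A).

Definition tclass A (x : formal A) : tensor A := \pi_({eq_quot @tensor_equiv A}) x.

Lemma tclassP A (x y : formal A) : tclass x = tclass y <-> tensor_rel x y.
Proof. by split=> [/eqmodP/asboolP|xy]; last exact/eqmodP/asboolP. Qed.

Lemma tclass_repr A (x : tensor A) : tclass (repr x) = x.
Proof. exact: reprK. Qed.

Definition fscale A (a : R) (x : formal A) : formal A :=
  [seq (a * p.1, p.2) | p <- x].

Lemma fscale_rel A a (x y : formal A) :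
  tensor_rel x y -> tensor_rel (fscale a x) (fscale a y).
Proof.
elim=> {x y} [x|x y _ IH|x y z _ IHx _ IHy|x x' y y' _ IHx _ IHy|x y|w|b c w|b c u v d x y].
- exact: TRefl.
- exact: TSym.
- exact: TTrans IHx IHy.
- by rewrite /fscale !map_cat; apply: TCat.
- by rewrite /fscale !map_cat; apply: TComm.
- by rewrite /fscale /= mulr0; apply: TZero.
- by rewrite /fscale /= mulrDr; apply: TAdd.
- by rewrite /fscale /= mulrA; apply: TLin.
Qed.

Definition tadd A (x y : tensor A) := tclass (repr x ++ repr y).
Definition tscale A (a : R) (x : tensor A) := tclass (fscale a (repr x)).
Definition tzero A : tensor A := tclass [::].

Lemma repr_tclass A (x : formal A) : tensor_rel (repr (tclass x)) x.
Proof. by apply/tclassP; rewrite tclass_repr. Qed.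

Lemma tadd_class A (x y : formal A) : tadd (tclass x) (tclass y) = tclass (x ++ y).
Proof. by apply/tclassP/TCat; apply: repr_tclass. Qed.

Lemma tscale_class A a (x : formal A) : tscale a (tclass x) = tclass (fscale a x).
Proof. by apply/tclassP/fscale_rel/repr_tclass. Qed.

Lemma taddA A : associative (@tadd A).
Proof.
move=> x y z; rewrite -(tclass_repr x) -(tclass_repr y) -(tclass_repr z).
by rewrite !tadd_class catA.
Qed.

Lemma taddC A : commutative (@tadd A).
Proof. by move=> x y; apply/tclassP/TComm. Qed.

Lemma tadd0 A : left_id (tzero A) (@tadd A).
Proof. by move=> x; rewrite -(tclass_repr x) tadd_class. Qed.

Lemma tscaleDl A (x : tensor A) a b :
  tscale (a + b) x = tadd (tscale a x) (tscale b x).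
Proof.
rewrite -(tclass_repr x) !tscale_class tadd_class; apply/tclassP.
elim: (repr x) => [|[c w] s IHs]; first exact: TRefl.
rewrite /= -cat1s -(cat1s (b * c, w)) -[X in tensor_rel _ X]cat1s catA.
rewrite mulrDl; apply: (TTrans (TCat (TAdd _ _ _) IHs)).
rewrite -[_ :: _ :: _]/([:: (a * c, w)] ++ [:: (b * c, w)]) -!catA.
apply: TCat; first exact: TRefl.
by rewrite !catA; apply: TCat; [apply: TComm|apply: TRefl].
Qed.

Lemma tscale0 A (x : tensor A) : tscale 0 x = tzero A.
Proof.
rewrite -(tclass_repr x) tscale_class; apply/tclassP.
elim: (repr x) => [|[c w] s IHs] /=; first exact: TRefl.
by rewrite mul0r -cat1s; apply: (TCat (TZero w) IHs).
Qed.

Lemma tscaleA A a b (x : tensor A) : tscale a (tscale b x) = tscale (a * b) x.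
Proof.
rewrite -(tclass_repr x) !tscale_class; congr tclass; rewrite /fscale -map_comp.
by apply: eq_map => p /=; rewrite mulrA.
Qed.

Lemma tscale1 A : left_id 1 (@tscale A).
Proof.
move=> x; rewrite -(tclass_repr x) tscale_class; congr tclass; rewrite /fscale.
by rewrite -[RHS]map_id; apply: eq_map => -[c w] /=; rewrite mul1r.
Qed.

Lemma tscaleDr A : right_distributive (@tscale A) (@tadd A).
Proof.
move=> a x y; rewrite -(tclass_repr x) -(tclass_repr y).
by rewrite !(tadd_class, tscale_class) /fscale map_cat.
Qed.

Lemma taddN A : left_inverse (tzero A) (tscale (-1)) (@tadd A).
Proof.
by move=> x; rewrite -[X in tadd _ X]tscale1 -tscaleDl addNr tscale0.
Qed.

HB.instance Definition _ A :=
  GRing.isZmodule.Build (tensor A) (@taddA A) (@taddC A) (@tadd0 A) (@taddN A).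

HB.instance Definition _ A :=
  GRing.Zmodule_isLmodule.Build R (tensor A)
    (@tscaleA A) (@tscale1 A) (@tscaleDr A) (@tscaleDl A).

Definition tpure A (w : word A) : tensor A := tclass [:: (1, w)].

(* The linear extension of a function on words; it is meaningful when F is
   multilinear, see textend_pure and textend_linear. *)
Definition textend A (V : lmodType R) (F : word A -> V) (x : tensor A) : V :=
  \sum_(p <- repr x) p.1 *: F p.2.

Definition multilinear A (V : lmodType R) (F : word A -> V) : Prop :=
  forall (u v : word A) d b (x y : A d),
    F (u ++ Hom_elt (b *: x + y) :: v)
    = b *: F (u ++ Hom_elt x :: v) + F (u ++ Hom_elt y :: v).

Lemma textend_class A (V : lmodType R) (F : word A -> V) (x : formal A) :
  multilinear F -> textend F (tclass x) = \sum_(p <- x) p.1 *: F p.2.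
Proof.
move=> F_lin; suff eval_rel (y z : formal A) : tensor_rel y z ->
    \sum_(p <- y) p.1 *: F p.2 = \sum_(p <- z) p.1 *: F p.2.
  exact/eval_rel/repr_tclass.
elim=> {x y z} [//|//|x y z _ -> _ ->|x x' y y' _ IHx _ IHy|x y|w|b c w|b c u v d x y] //.
- by rewrite !big_cat /= IHx IHy.
- by rewrite !big_cat /= addrC.
- by rewrite big_cons !big_nil scale0r addr0.
- by rewrite !big_cons !big_nil !addr0 scalerDl.
- by rewrite !big_cons !big_nil !addr0 /= F_lin scalerDr scalerA.
Qed.

Lemma textend_pure A (V : lmodType R) (F : word A -> V) w :
  multilinear F -> textend F (tpure w) = F w.
Proof. by move=> F_lin; rewrite textend_class // big_seq1 scale1r. Qed.

Lemma textend_linear A (V : lmodType R) (F : word A -> V) :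
  multilinear F -> linear (textend F).
Proof.
move=> F_lin a x y; rewrite -(tclass_repr x) -(tclass_repr y).
have -> : a *: tclass (repr x) + tclass (repr y)
          = tclass (fscale a (repr x) ++ repr y).
  by rewrite -tadd_class -tscale_class.
rewrite !textend_class // big_cat big_map scaler_sumr /=; congr (_ + _).
by apply: eq_bigr => p _; rewrite scalerA.
Qed.

Definition tmul A (x y : tensor A) : tensor A :=
  textend (fun u => textend (fun v => tpure (u ++ v)) y) x.

(* The identity of T^n, extended by 0 to the other tensor powers *)
Definition tid A (n : nat) : tensor A -> tensor A :=
  textend (fun w => if size w == n then tpure w else 0).

(* The word whose j-th letter is the s_j-th letter of w *)
Definition wperm A (s : seq nat) (w : word A) : word A :=
  [seq nth (Hom_elt (0 : A 0)) w i | i <- s].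

Definition ldeg A (w : word A) (i : nat) : int :=
  tag (nth (Hom_elt (0 : A 0)) w i).

(* The parity of the Koszul sign of w |-> wperm s w: the sum of the products of
   the degrees of the pairs of letters that are exchanged *)
Definition koszul A (s : seq nat) (w : word A) : int :=
  \sum_(q < size s) \sum_(p < q | (nth 0 s q < nth 0 s p)%N)
     ldeg w (nth 0%N s p) * ldeg w (nth 0%N s q).

(* The action on T^n of the permutation s of 0, .., n - 1, with Koszul sign,
   extended by 0 to the other tensor powers *)
Definition tperm A (s : seq nat) : tensor A -> tensor A :=
  textend (fun w =>
    if size w == size s then isign (koszul s w) *: tpure (wperm s w) else 0).

Lemma tpure_multilinear A : multilinear (@tpure A).
Proof.
move=> u v d b x y.
have -> : b *: tpure (u ++ Hom_elt x :: v) + tpure (u ++ Hom_elt y :: v)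
    = tclass [:: (b, u ++ Hom_elt x :: v); (1, u ++ Hom_elt y :: v)].
  by rewrite -[b *: _]/(tscale _ _) -[_ + _]/(tadd _ _) tscale_class tadd_class
     /= mulr1.
by apply/tclassP; rewrite -[in X in tensor_rel _ X](mul1r b); apply: TLin.
Qed.

Lemma tid_multilinear A n :
  multilinear (fun w : word A => if size w == n then tpure w else 0).
Proof.
move=> u v d b x y; rewrite !size_cat /=.
by case: eqP => _; rewrite ?tpure_multilinear // scaler0 addr0.
Qed.

Lemma tmul_multilinear_r A (u : word A) : multilinear (fun v => tpure (u ++ v)).
Proof. by move=> u' v' d b x y; rewrite !catA tpure_multilinear. Qed.

Lemma tmul_multilinear_l A (y : tensor A) :
  multilinear (fun u => textend (fun v => tpure (u ++ v)) y).
Proof.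
move=> u v d b x x'; rewrite /textend scaler_sumr -big_split /=.
apply: eq_bigr => p _; rewrite -!catA /= tpure_multilinear scalerDr.
by rewrite !scalerA mulrC.
Qed.

Lemma tmul_pure A (u v : word A) : tmul (tpure u) (tpure v) = tpure (u ++ v).
Proof.
rewrite /tmul textend_pure; last exact: tmul_multilinear_l.
exact/textend_pure/tmul_multilinear_r.
Qed.

Lemma ldeg_Hom_elt A (u v : word A) d (x y : A d) :
  ldeg (u ++ Hom_elt x :: v) =1 ldeg (u ++ Hom_elt y :: v).
Proof. by move=> i; rewrite /ldeg !nth_cat; case: ltnP => // _; case: (i - _)%N. Qed.

Lemma tperm_multilinear A (s : seq nat) : perm_eq s (iota 0 (size s)) ->
  multilinear (fun w : word A =>
    if size w == size s then isign (koszul s w) *: tpure (wperm s w) else 0).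
Proof.
move=> s_perm u v d b x y; rewrite !size_cat /=.
case: eqP => [uv_s|_]; last by rewrite scaler0 addr0.
have kE (z z' : A d) :
    koszul s (u ++ Hom_elt z :: v) = koszul s (u ++ Hom_elt z' :: v).
  by apply: eq_bigr => q _; apply: eq_bigr => p _; congr (_ * _);
    apply: ldeg_Hom_elt.
have us : size u \in s.
  by rewrite (perm_mem s_perm) mem_iota -uv_s addnS ltnS leq_addr.
have : uniq s by rewrite (perm_uniq s_perm) iota_uniq.
rewrite (kE x (b *: x + y)) (kE y (b *: x + y)).
case/splitPr: us => s1 s2; rewrite cat_uniq /= negb_or.
move=> /and3P[_ /andP[us1 _] /andP[us2 _]].
pose z := b *: x + y.
have wE (z' : A d) r : size u \notin r ->
    wperm r (u ++ Hom_elt z' :: v) = wperm r (u ++ Hom_elt z :: v).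
  move=> ur; apply/eq_in_map => i ir; rewrite !nth_cat; case: ltngtP => // ui.
    by rewrite -[(i - _)%N]prednK ?subn_gt0.
  by rewrite -ui ir in ur.
have wcat (z' : A d) : wperm (s1 ++ size u :: s2) (u ++ Hom_elt z' :: v)
    = wperm s1 (u ++ Hom_elt z :: v) ++ Hom_elt z'
      :: wperm s2 (u ++ Hom_elt z :: v).
  by rewrite /wperm map_cat /= nth_cat ltnn subnn /= -/(wperm _ _) wE // -/(wperm _ _) wE.
rewrite !wcat tpure_multilinear scalerDr !scalerA; congr (_ *: _ + _).
by rewrite mulrC.
Qed.

End TensorPowers.

Section UDModules.
Context {R : comPzRingType}.
Implicit Types A B C : gmod R.

(* The degree D part of the q-th tensor power of A *)
Definition thomog A (q : nat) (D : int) (y : tensor A) : Prop :=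
  exists2 z : formal A,
    all (fun p => (size p.2 == q) && (wdeg p.2 == D)) z & y = tclass z.

(* A linear map of degree d from the p-th tensor power of A to the q-th tensor
   power of B, encoded by its extension by 0 to the other tensor powers of A. *)
Definition graded_map A B (p q : nat) (d : int) (f : tensor A -> tensor B) : Prop :=
  [/\ linear f,
      forall w, size w != p -> f (tpure w) = 0
    & forall w, size w = p -> thomog q (wdeg w + d) (f (tpure w))].

(* The tensor power (A^b)^a is the (a * b)-th tensor power of A: its words are
   the concatenations of a rows of length b. *)
Definition ud_hom A B : Type := mindex -> mindex -> tensor A -> tensor B.

Definition ud_degree A B (d : int) (phi : ud_hom A B) : Prop :=
  forall k l : mindex,
    graded_map (sumn k * size l) (size k * sumn l)
      (d + (mv k)%:Z + (mv l)%:Z) (phi k l).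

Definition ud_zero A B : ud_hom A B := fun _ _ _ => 0.

Definition ud_id A : ud_hom A A := fun k l =>
  if vertical k && vertical l then @tid R A (size k * size l) else fun _ => 0.

Definition comp_sign (k0 l0 k1 l1 : mindex) (d : int) : int :=
  (heart k1 k0 + heart l0 l1 + mv l0 * (mv k1 + mv l1))%N%:Z
  + (mv k0 + mv l0)%N%:Z * d.

(* The composite of psi with a morphism phi of degree d. *)
Definition ud_comp A B C (d : int) (psi : ud_hom B C) (phi : ud_hom A B) :
    ud_hom A C := fun k l x =>
  \sum_(kk <- splittings k) \sum_(ll <- splittings l)
    let: (k1, k0) := kk in let: (l0, l1) := ll in
    isign (comp_sign k0 l0 k1 l1 d) *: psi k0 l0 (phi k1 l1 x).

(* A map from the fsize-th tensor power, of degree fdeg *)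
Record factor A B : Type :=
  Factor { fsize : nat; fdeg : int; ffun_of :> tensor A -> tensor B }.

(* The value of f_1 (x) .. (x) f_r on u_1 (x) .. (x) u_r, with sign given by
   (f (x) g)(x (x) y) = (-1)^(|g||x|) f(x) (x) g(y) *)
Fixpoint tensor_at A B (fs : seq (factor A B)) (us : seq (word A)) : tensor B :=
  match fs, us with
  | f :: fs', u :: us' =>
      isign (wdeg u * \sum_(g <- fs') fdeg g)
        *: tmul (f (tpure u)) (tensor_at fs' us')
  | _, _ => tpure [::]
  end.

Definition is_tensor A B (P : tensor A -> tensor B) (fs : seq (factor A B)) : Prop :=
  forall us : seq (word A),
    [seq size u | u <- us] = [seq fsize f | f <- fs] ->
    P (tpure (flatten us)) = tensor_at fs us.

(* The exchange of rows and columns (A^c)^r -> (A^r)^c *)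
Definition transp {A} (r c : nat) : tensor A -> tensor A :=
  tperm [seq (i * c + j)%N | j <- iota 0 c, i <- iota 0 r].

(* phi^k_l with the roles of rows and columns exchanged, i.e. viewed as a map
   from (A^|k|)^b to (B^a)^|l| *)
Definition flip A B (phi : ud_hom A B) : ud_hom A B := fun k l x =>
  transp (size k) (sumn l) (phi k l (transp (size l) (sumn k) x)).

(* For words u, v, w of length p, q, r, the map sending u (x) v (x) w to
   u (x) w (x) v up to the Koszul sign *)
Definition block_swap {A} (p q r : nat) : tensor A -> tensor A :=
  tperm (iota 0 p ++ iota (p + q) r ++ iota p q).

Definition id_factor A (n : nat) : factor A A := Factor n 0 (@tid R A n).

(* The components of a morphism phi of degree d, as factors of a tensor product
   along rows, respectively along columns *)
Definition row_factor A B (d : int) (phi : ud_hom A B) (k l : mindex) : factor A B :=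
  Factor (sumn k * size l) (d + (mv k)%:Z + (mv l)%:Z) (phi k l).

Definition col_factor A B (d : int) (phi : ud_hom A B) (k l : mindex) : factor A B :=
  Factor (sumn k * size l) (d + (mv k)%:Z + (mv l)%:Z) (flip phi k l).

Section FBialgebra.
Variables (A : gmod R) (alpha : ud_hom A A).

(* On vertical multi-indices alpha is the tensor product differential induced by
   alpha^1_1, which has degree -1. *)
Definition rel_differential : Prop :=
  forall k l : mindex, vertical k -> vertical l ->
  forall w : word A, size w = (size k * size l)%N ->
  alpha k l (tpure w) =
    \sum_(i < size w) isign (wdeg (take i w)) *:
      tmul (tpure (take i w))
        (tmul (alpha (mi [:: 1%N]) (mi [:: 1%N]) (tpure (take 1 (drop i w))))
              (tpure (drop i.+1 w))).

(* In the next two relations p or q may be 0; the corresponding factor is then the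
   identity of A^0 = R. *)
Definition rel_vertical_k : Prop :=
  forall (k l : mindex) (p j q : nat),
  vertical k -> mival l = nseq p 1%N ++ j :: nseq q 1%N -> (2 <= j)%N ->
  is_tensor (flip alpha k l)
    [:: id_factor A (size k * p); col_factor (-1) alpha k (mi [:: j]);
        id_factor A (size k * q)].

Definition rel_vertical_l : Prop :=
  forall (k l : mindex) (p i q : nat),
  vertical l -> mival k = nseq p 1%N ++ i :: nseq q 1%N -> (2 <= i)%N ->
  is_tensor (alpha k l)
    [:: id_factor A (size l * p); row_factor (-1) alpha (mi [:: i]) l;
        id_factor A (size l * q)].

Definition rel_vanishing : Prop :=
  forall k l : mindex,
  (vertical k && (2 <= count (leq 2) l)%N)
    || (vertical l && (2 <= count (leq 2) k)%N) ->
  forall x, alpha k l x = 0.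

(* The factors of the maps alpha~^1_l and alpha~^k_1, for l and k almost
   vertical; all have degree 0. *)
Definition tilde_row (j : nat) : factor A A :=
  if j == 1%N then id_factor A 1
  else row_factor (-1) alpha (mi [:: 1%N]) (mi [:: j]).

Definition tilde_col (i : nat) : factor A A :=
  if i == 1%N then id_factor A 1
  else row_factor (-1) alpha (mi [:: i]) (mi [:: 1%N]).

(* The relations obtained by deleting an entry 1 of k, resp. of l: the block of
   this entry is moved to the end in the source and in the target. Nothing is
   required when the deletion would leave an empty sequence. *)
Definition rel_delete_k : Prop :=
  forall (k k' l : mindex) (s t : seq nat),
  almost_vertical l -> mival k = s ++ 1%N :: t -> mival k' = s ++ t ->
  let b := size l in let m := sumn l in
  is_tensor
    (fun x => block_swap (m * size s) m (m * size t)
       (alpha k l (block_swap (b * sumn s) (b * sumn t) b x)))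
    (row_factor (-1) alpha k' l :: [seq tilde_row j | j <- mival l]).

Definition rel_delete_l : Prop :=
  forall (k l l' : mindex) (s t : seq nat),
  almost_vertical k -> mival l = s ++ 1%N :: t -> mival l' = s ++ t ->
  let a := size k in let m := sumn k in
  is_tensor
    (fun x => block_swap (a * sumn s) a (a * sumn t)
       (flip alpha k l (block_swap (m * size s) (m * size t) m x)))
    (col_factor (-1) alpha k l' :: [seq tilde_col i | i <- mival k]).

Definition fbialgebra_relations : Prop :=
  rel_differential /\ (rel_vertical_k /\ rel_vertical_l /\ rel_vanishing)
  /\ (rel_delete_k /\ rel_delete_l).

End FBialgebra.

Definition morphism_relations A B (phi : ud_hom A B) : Prop :=
  forall k l : mindex,
    (vertical l ->
       is_tensor (phi k l) [seq row_factor 0 phi (mi [:: i]) l | i <- mival k])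
    /\ (vertical k ->
       is_tensor (flip phi k l) [seq col_factor 0 phi k (mi [:: j]) | j <- mival l]).

End UDModules.

Definition monotone (m n : nat) (f : 'I_m.+1 -> 'I_n.+1) : bool :=
  [forall i : 'I_m.+1, forall j : 'I_m.+1, (i <= j)%N ==> (f i <= f j)%N].

Record mono (m n : nat) : Type :=
  Mono { mono_fun :> 'I_m.+1 -> 'I_n.+1; monoP : monotone mono_fun }.

Lemma mono_eq m n (f g : mono m n) : f =1 g -> f = g.
Proof.
case: f g => [f f_mono] [g g_mono] /= /funext fg.
by case: g / fg in g_mono *; rewrite (bool_irrelevance f_mono g_mono).
Qed.

Lemma monotoneP m n (f : 'I_m.+1 -> 'I_n.+1) :
  reflect {homo f : i j / (i <= j)%N} (monotone f).
Proof.
apply: (iffP forallP) => [f_mono i j|f_mono i].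
  by have /forallP/(_ j)/implyP := f_mono i.
by apply/forallP => j; apply/implyP/f_mono.
Qed.

Lemma mono_id_proof n : @monotone n n id.
Proof. exact/monotoneP. Qed.

Definition mono_id n : mono n n := Mono (mono_id_proof n).

Lemma mono_comp_proof m n p (g : mono n p) (f : mono m n) : monotone (g \o f).
Proof.
apply/monotoneP => i j ij /=.
exact/(monotoneP _ (monoP g))/(monotoneP _ (monoP f)).
Qed.

Definition mono_comp m n p (g : mono n p) (f : mono m n) : mono m p :=
  Mono (mono_comp_proof g f).

Record sset : Type := SSet {
  simplex :> nat -> Type;
  pull : forall m n, mono m n -> simplex n -> simplex m;
  pull_id : forall n (x : simplex n), pull (mono_id n) x = x;
  pull_comp : forall m n p (g : mono n p) (f : mono m n) (x : simplex p),
    pull (mono_comp g f) x = pull f (pull g x) }.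

Definition simplicial_subset (X : sset) (P : forall n, X n -> Prop) : Prop :=
  forall m n (f : mono m n) (x : X n), P n x -> P m (pull f x).

Section SubSSet.
Variables (X : sset) (P : forall n, X n -> Prop) (HP : simplicial_subset P).

Definition sub_simplex (n : nat) : Type := {x : X n | P x}.

Definition sub_pull m n (f : mono m n) (x : sub_simplex n) : sub_simplex m :=
  exist (@P m) (pull f (sval x)) (HP f (svalP x)).

Lemma sub_simplex_eq n (x y : sub_simplex n) : sval x = sval y -> x = y.
Proof. by case: x y => [x Px] [y Py] /= xy; apply: eq_exist. Qed.

Lemma sub_pull_id n (x : sub_simplex n) : sub_pull (mono_id n) x = x.
Proof. exact/sub_simplex_eq/pull_id. Qed.

Lemma sub_pull_comp m n p (g : mono n p) (f : mono m n) (x : sub_simplex p) :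
  sub_pull (mono_comp g f) x = sub_pull f (sub_pull g x).
Proof. exact/sub_simplex_eq/pull_comp. Qed.

Definition sub_sset : sset := SSet sub_pull_id sub_pull_comp.

End SubSSet.

Section StandardSimplex.
Variable n : nat.

Definition std_pull m p (f : mono m p) (x : mono p n) : mono m n := mono_comp x f.

Lemma std_pull_id m (x : mono m n) : std_pull (mono_id m) x = x.
Proof. exact: mono_eq. Qed.

Lemma std_pull_comp m p q (g : mono p q) (f : mono m p) (x : mono q n) :
  std_pull (mono_comp g f) x = std_pull f (std_pull g x).
Proof. exact: mono_eq. Qed.

Definition std_simplex : sset :=
  @SSet (fun m => mono m n) std_pull std_pull_id std_pull_comp.

(* The simplices of the k-th horn: those that miss a vertex other than k *)
Definition in_horn (k : 'I_n.+1) m (x : std_simplex m) : Prop :=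
  exists2 j : 'I_n.+1, j != k & forall i, x i != j.

Lemma horn_subset k : simplicial_subset (in_horn k).
Proof. by move=> m p f x [j jk xj]; exists j => // i; apply: xj. Qed.

Definition horn (k : 'I_n.+1) : sset := sub_sset (@horn_subset k).

End StandardSimplex.

Record sset_map (X Y : sset) : Type := SSetMap {
  sset_fun :> forall n, X n -> Y n;
  sset_natural : forall m n (f : mono m n) (x : X n),
    sset_fun (pull f x) = pull f (sset_fun x) }.

Definition weak_kan (X : sset) : Prop :=
  forall (n : nat) (k : 'I_n.+1), (0 < k < n)%N ->
  forall h : sset_map (horn k) X,
  exists g : sset_map (std_simplex n) X,
  forall m (x : horn k m), g m (sval x) = h m x.

(* The simplices of [n] of dimension size s + 1 with first vertex i, last
   vertex j and list of other vertices s *)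
Definition chain n (i : 'I_n.+1) (s : seq 'I_n.+1) (j : 'I_n.+1) : bool :=
  path (fun x y : 'I_n.+1 => (x < y)%N) i (rcons s j).

Definition dep_if (T : Type) (b : bool) (F : b -> T) (z : T) : T :=
  (if b as b' return (b' -> T) -> T then fun F => F isT else fun _ => z) F.

Lemma dep_if_true T (b : bool) (F : b -> T) z (h : b) : dep_if F z = F h.
Proof. by case: b F h => // F h; rewrite (bool_irrelevance h isT). Qed.

Lemma dep_if_false T (b : bool) (F : b -> T) z : ~~ b -> dep_if F z = z.
Proof. by case: b F. Qed.

Section DgNerve.
Variable R : comPzRingType.

(* The data of a simplex of the dg nerve, without any condition: graded modules
   A_i, maps alpha_i, and maps phi_sigma for dim sigma >= 1 *)
Record diagram (n : nat) : Type := Diagram {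
  dobj : 'I_n.+1 -> gmod R;
  ddiff : forall i, ud_hom (dobj i) (dobj i);
  dmap : forall i j s, chain i s j -> ud_hom (dobj j) (dobj i) }.

Arguments ddiff {n} X i : rename.
Arguments dmap {n} X {i j s} _ : rename.
Arguments Diagram {n} dobj ddiff dmap.

(* phi_sigma for sigma given by i, s and j, with junk value 0 if these do not
   define a simplex *)
Definition dmap_at n (X : diagram n) (i : 'I_n.+1) (s : seq 'I_n.+1)
    (j : 'I_n.+1) : ud_hom (dobj X j) (dobj X i) :=
  dep_if (fun h : chain i s j => dmap X h) (@ud_zero R (dobj X j) (dobj X i)).

Arguments dmap_at {n} X i s j : rename.

Definition dident n (A : 'I_n.+1 -> gmod R) (i j : 'I_n.+1) : ud_hom (A j) (A i) :=
  match i =P j with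
  | ReflectT e => match e in _ = j' return ud_hom (A j') (A i) with
                  | erefl => @ud_id R (A i)
                  end
  | ReflectF _ => @ud_zero R (A j) (A i)
  end.

Arguments dident {n} A i j : rename.

(* The simplicial operators of the dg nerve: phi_sigma is pulled back to
   phi_(f sigma) if f is injective on sigma, and otherwise to the identity if
   dim sigma = 1 and to 0 if dim sigma > 1. *)
Definition diagram_pull m n (f : mono m n) (X : diagram n) : diagram m :=
  Diagram (fun i => dobj X (f i)) (fun i => ddiff X (f i))
    (fun i j s _ =>
       dep_if (fun h : chain (f i) (map f s) (f j) => dmap X h)
         (if s is [::] then dident (dobj X) (f i) (f j)
          else @ud_zero R (dobj X (f j)) (dobj X (f i)))).

Lemma diagram_eq n (A : 'I_n.+1 -> gmod R) alpha
    (phi psi : forall i j s, chain i s j -> ud_hom (A j) (A i)) :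
  (forall i j s (c : chain i s j), phi i j s c = psi i j s c) ->
  Diagram A alpha phi = Diagram A alpha psi.
Proof.
move=> phi_psi; congr Diagram.
apply: functional_extensionality_dep => i.
apply: functional_extensionality_dep => j.
apply: functional_extensionality_dep => s.
by apply: functional_extensionality_dep => c.
Qed.

Lemma dmap_eq n (A : 'I_n.+1 -> gmod R)
    (phi : forall i j s, chain i s j -> ud_hom (A j) (A i)) i j s s'
    (c : chain i s j) (c' : chain i s' j) :
  s = s' -> phi i j s c = phi i j s' c'.
Proof. by move=> ss'; case: s' / ss' in c' *; rewrite (bool_irrelevance c c'). Qed.

Lemma diagram_pull_id n (X : diagram n) : diagram_pull (mono_id n) X = X.
Proof.
case: X => A alpha phi; apply: diagram_eq => i j s c /=.
have c' : chain i (map id s) j by rewrite map_id.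
by rewrite (dep_if_true _ _ c'); apply/dmap_eq/map_id.
Qed.

Lemma chain_mono m n (f : mono m n) i s j :
  chain (f i) (map f s) (f j) -> chain i s j.
Proof.
rewrite /chain -map_rcons path_map; apply: sub_path => x y /=.
by apply: contraLR; rewrite -!leqNgt; apply/monotoneP/monoP.
Qed.

Lemma dident_comp m n (f : mono m n) (A : 'I_n.+1 -> gmod R) i j :
  i = j -> dident (fun i => A (f i)) i j = dident A (f i) (f j).
Proof.
move=> ij; rewrite /dident -{j}ij.
case: eqP => // e; rewrite (eq_irrelevance e erefl) /=.
by case: eqP => // e'; rewrite (eq_irrelevance e' erefl).
Qed.

Lemma diagram_pull_comp m n p (g : mono n p) (f : mono m n) (X : diagram p) :
  diagram_pull (mono_comp g f) X = diagram_pull f (diagram_pull g X).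
Proof.
case: X => A alpha phi; apply: diagram_eq => i j s c /=.
have gfsE : chain (g (f i)) (map (g \o f) s) (g (f j))
            = chain (g (f i)) (map g (map f s)) (g (f j)).
  by rewrite map_comp.
have [fs|nfs] := orP (orbN (chain (f i) (map f s) (f j))); last first.
  have ngfs : ~~ chain (g (f i)) (map (g \o f) s) (g (f j)).
    by rewrite gfsE; apply: contra nfs; apply: chain_mono.
  refine (etrans (dep_if_false _ _ ngfs) (etrans _ (esym (dep_if_false _ _ nfs)))).
  case: s c nfs {gfsE ngfs} => // /andP[ij _] /= nfs.
  rewrite (dident_comp g) //; apply/val_inj/eqP; rewrite /= eqn_leq.
  rewrite (monotoneP _ (monoP f)) ?(ltnW ij) //= leqNgt.
  by apply: contra nfs => fij; rewrite /chain /= fij.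
refine (etrans _ (esym (dep_if_true _ _ fs))).
have [gfs|ngfs] := orP (orbN (chain (g (f i)) (map g (map f s)) (g (f j)))).
  have gfs' := gfs; rewrite -gfsE in gfs'.
  apply: etrans (dep_if_true _ _ gfs') (etrans _ (esym (dep_if_true _ _ gfs))).
  exact/dmap_eq/map_comp.
have ngfs' := ngfs; rewrite -gfsE in ngfs'.
apply: etrans (dep_if_false _ _ ngfs') (etrans _ (esym (dep_if_false _ _ ngfs))).
by case: s {c fs gfsE ngfs ngfs'}.
Qed.

Definition diagrams : sset := SSet diagram_pull_id diagram_pull_comp.

(* ud_comp is given the degree of its right factor: that of phi_sigma is
   dim sigma - 1 = size s, and that of alpha_i is -1. The summand p deals with
   the inner vertex sigma_(p + 1), which is the p-th entry of s. *)
Definition dg_nerve_equation n (X : diagram n) (i j : 'I_n.+1) (s : seq 'I_n.+1) :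
    Prop :=
  forall k l x,
  ud_comp (size s) (ddiff X i) (dmap_at X i s j) k l x
    - isign (size s) *: ud_comp (-1) (dmap_at X i s j) (ddiff X j) k l x
  = \sum_(p < size s) isign p.+1 *:
      (dmap_at X i (take p s ++ drop p.+1 s) j k l x
       - ud_comp (size (drop p.+1 s))
           (dmap_at X i (take p s) (nth i s p))
           (dmap_at X (nth i s p) (drop p.+1 s) j) k l x).

(* The simplices of the dg nerve of the dg category of chain complexes of
   (R, ud)-modules *)
Definition PreBialg n (X : diagrams n) : Prop :=
  [/\ forall i, ud_degree (-1) (ddiff X i),
      forall i j s, chain i s j -> ud_degree (size s) (dmap_at X i s j),
      forall i k l x, ud_comp (-1) (ddiff X i) (ddiff X i) k l x = 0
    & forall i j s, chain i s j -> dg_nerve_equation X i j s].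

Definition fBialg n (X : diagrams n) : Prop :=
  [/\ PreBialg X,
      forall i, fbialgebra_relations (ddiff X i)
    & forall i j, chain i [::] j -> morphism_relations (dmap_at X i [::] j)].

End DgNerve.

(* Main.v *)
From HB Require Import structures.
From mathcomp Require Import all_boot all_order all_algebra.
From mathcomp Require Import boolp functions zify ring.
Require Import Defs.

(* A horn of shape (n, k) misses only the top simplex and its k-th face. As in any dg
   nerve, it is filled by giving the top simplex the map 0 and solving its equation for
   the map of the k-th face; the equation of that face then follows because the
   right-hand sides of the equations form a cocycle, by the Leibniz rule and the
   associativity of the composition. The relations of f-bialgebras only concern the
   vertices, which all lie in the horn, and those of morphisms only concern the edges;
   an edge is missing only if n = 2, and then its map is the composite of the two
   others. So all that is specific to f-bialgebras is that the relations of morphisms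
   hold for identities and are stable under composition: the sign of the composition,
   which involves the hearts, is precisely the Koszul sign that arises when tensor
   products of maps are composed. *)

Set Implicit Arguments.
Unset Strict Implicit.
Unset Printing Implicit Defensive.

Import GRing.Theory.

Local Open Scope ring_scope.

(** * Signs and multi-indices *)

Section Signs.
Context {R : comPzRingType}.

(** Associativity of the composition rests on a cocycle identity for the heart exponent, proved on
    plain lists by peeling off one outer block at a time and used once for the upper and once for
    the lower indices. Dependent types shape the construction of the filler: each simplex of the
    horn carries its own objects, which agree with those at its vertices only propositionally, and
    the map of one chain of vertices can be read off from many simplices. All maps are therefore
    transported to the objects found at the vertices and stored with their end points; naturality
    makes the choice of the simplex irrelevant. Degeneracies enter twice: the nerve equation must
    hold for the values that they prescribe, and the given horn must be shown to take these values.
    The equation of the top simplex can be solved over any ring because the missing map occurs in it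
    with a sign as coefficient. All composites in that equation are known because [k] is inner:
    front parts miss the last vertex and back parts the first, so both lie in the horn. *)

Lemma isign_absz (n : int) : isign n = (-1) ^+ odd `|n|%N :> R.
Proof. by rewrite /isign signr_odd. Qed.

Lemma isignD (m n : int) : isign (m + n) = isign m * isign n :> R.
Proof. by rewrite !isign_absz -signr_addb; congr (_ ^+ _); congr nat_of_bool; lia. Qed.

Lemma isign_sqr (n : int) : isign n * isign n = 1 :> R.
Proof. by rewrite isign_absz -signr_addb addbb. Qed.

Lemma isign_congr (m n c : int) : m = n + c * 2 -> isign m = isign n :> R.
Proof. by move=> ->; rewrite !isign_absz; congr (_ ^+ _); congr nat_of_bool; lia. Qed.

Lemma isignS (n : nat) : isign n.+1 = - isign n :> R.
Proof. by rewrite /isign !absz_nat exprS mulN1r. Qed.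

End Signs.

Local Open Scope nat_scope.

(* lia distinguishes [seq nat] from [seq] over the eqType nat. *)
Ltac slia :=
  intros; repeat match goal with
  | H : context [@size (Equality.sort ?T) ?p] |- _ =>
      change (@size (Equality.sort T) p) with (@size nat p) in H
  | |- context [@size (Equality.sort ?T) ?p] =>
      change (@size (Equality.sort T) p) with (@size nat p)
  end; lia.

(** * Grouping and heart exponents on lists of natural numbers *)

Fixpoint sharps (p q : seq nat) : seq nat :=
  if q is x :: q' then sumn (take x p) :: sharps (drop x p) q' else [::].

(** Like [sharps] and [hearts], a version for arbitrary lists, because the inductions pass through
    the empty list, which is not a multi-index. *)
Definition verts (q : seq nat) : seq nat :=
  [seq x <- iota 1 (sumn q) | x \notin scanl addn 0 q].

Definition hearts (p q : seq nat) : nat :=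
  \sum_(i < size p) (nth 0 p i).-1 * count (leq i.+1) (verts q).

(** On positive lists this is v(s) = |s| - n(s), in a form that recurses along the list. *)
Fixpoint excess (s : seq nat) : nat :=
  if s is x :: s' then x.-1 + excess s' else 0.

(* The heart of s when all its entries form a single block: hearts s [:: size s] *)
Fixpoint heart1 (s : seq nat) : nat :=
  if s is x :: s' then x.-1 * size s' + heart1 s' else 0.

Notation positive := (all (leq 1)).

Lemma sharps_cat p1 p2 q1 q2 : size p1 = sumn q1 ->
  sharps (p1 ++ p2) (q1 ++ q2) = sharps p1 q1 ++ sharps p2 q2.
Proof.
elim: q1 p1 => [|x q1 IH] p1 /=; first by case: p1.
move=> sz; rewrite -{1 2}(cat_take_drop x p1) -catA.
have szx : size (take x p1) = x by rewrite size_take; case: ltnP => //; slia.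
rewrite take_size_cat // drop_size_cat // IH // size_drop; slia.
Qed.

Lemma size_sharps p q : size (sharps p q) = size q.
Proof. by elim: q p => //= x q IH p; rewrite IH. Qed.

Lemma sumn_sharps p q : size p = sumn q -> sumn (sharps p q) = sumn p.
Proof.
elim: q p => [|x q IH] p /=; first by case: p.
move=> sz; rewrite IH ?size_drop; last by slia.
by rewrite -sumn_cat cat_take_drop.
Qed.

Lemma sumn_positive p : positive p -> p != [::] -> 0 < sumn p.
Proof. by case: p => //= x p /andP[]; slia. Qed.

Lemma positive_take n p : positive p -> positive (take n p).
Proof. by rewrite -{1}(cat_take_drop n p) all_cat => /andP[]. Qed.

Lemma positive_drop n p : positive p -> positive (drop n p).
Proof. by rewrite -{1}(cat_take_drop n p) all_cat => /andP[]. Qed.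

Lemma positive_sharps p q : positive p -> positive q -> size p = sumn q ->
  positive (sharps p q).
Proof.
elim: q p => [|x q IH] p //= p_pos /andP[x_gt0 q_pos] sz.
rewrite IH ?positive_drop ?size_drop //; last by slia.
rewrite andbT sumn_positive ?positive_take //.
by move: sz; rewrite -size_eq0 -lt0n size_take; case: ifP => /= _; slia.
Qed.

Lemma sharpsA p q t : size q = sumn t -> size p = sumn q ->
  sharps p (sharps q t) = sharps (sharps p q) t.
Proof.
elim: t q p => [|x t IH] q p //= szq szp.
have [szq1 szq2] : size (take x q) = x /\ size (drop x q) = sumn t.
  by rewrite size_take size_drop; case: ltnP => //; slia.
have sumq := congr1 sumn (cat_take_drop x q); rewrite sumn_cat in sumq.
have szp1 : size (take (sumn (take x q)) p) = sumn (take x q).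
  by rewrite size_take szp; case: ltnP => //; slia.
rewrite IH ?size_drop ?szq2 //; try slia.
set n := sumn (take x q) in szp1 *.
have -> : sharps p q = sharps (take n p ++ drop n p) (take x q ++ drop x q).
  by rewrite !cat_take_drop.
rewrite sharps_cat //.
rewrite take_size_cat ?size_sharps // drop_size_cat ?size_sharps //.
by rewrite sumn_sharps.
Qed.

Lemma scanl_addn x q : scanl addn x q = map (addn x) (scanl addn 0 q).
Proof.
elim: q x => //= y q IH x; rewrite IH (IH (0 + y)) -map_comp.
by congr (_ :: _); apply: eq_map => z /=; slia.
Qed.

(** The partial sums of [x :: q] are [x] and those of [q] shifted by [x], so the first block loses
    only its last position. *)
Lemma verts_cons x q : 0 < x -> positive q ->
  verts (x :: q) = iota 1 x.-1 ++ map (addn x) (verts q).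
Proof.
move=> x_gt0 q_pos; rewrite /verts /= add0n scanl_addn iotaD filter_cat.
have pos_scan z : z \in scanl addn 0 q -> 0 < z.
  elim: q q_pos z => //= y q IH /andP[y_gt0 q_pos] z.
  by rewrite inE scanl_addn => /orP[/eqP->|/mapP[w _ ->]]; slia.
congr (_ ++ _).
  have -> : iota 1 x = iota 1 x.-1 ++ [:: x].
    by rewrite -[X in iota 1 X = _](prednK x_gt0) -[X in iota 1 X = _]addn1 iotaD add1n prednK.
  rewrite filter_cat /= inE eqxx /= cats0; apply/all_filterP/allP => z.
  rewrite mem_iota inE negb_or => z_x; apply/andP; split; first by slia.
  by apply/negP => /mapP[w /pos_scan]; slia.
rewrite addnC iotaDl filter_map; congr map; apply: eq_in_filter => z.
rewrite mem_iota /= inE negb_or mem_map; last exact: addnI.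
by move=> z_q; rewrite (_ : (x + z == x) = false) //; slia.
Qed.

Lemma size_verts q : positive q -> size (verts q) = excess q.
Proof.
elim: q => //= x q IH /andP[x_gt0 q_pos].
by rewrite verts_cons // size_cat size_iota size_map IH.
Qed.

Lemma count_iota h m n : count (leq h) (iota m n) = minn n (m + n - h).
Proof. by elim: n m => [|n IH] m /=; rewrite ?IH; slia. Qed.

(** An entry of the first block sees the vertical positions of its own block from its place on,
    which gives [heart1], and all those of the later blocks, of which there are [excess q]. *)
Lemma hearts_cons p1 p q : 0 < size p1 -> positive q ->
  hearts (p1 ++ p) (size p1 :: q) = heart1 p1 + excess p1 * excess q + hearts p q.
Proof.
move=> sz q_pos; rewrite /hearts size_cat big_split_ord /=; congr (_ + _); last first.
  apply: eq_bigr => i _; rewrite nth_cat (_ : _ < _ = false); last by slia.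
  rewrite addKn; congr (_ * _); rewrite verts_cons // count_cat count_iota count_map.
  rewrite (_ : minn _ _ = 0); last by slia.
  by apply: eq_count => z /=; slia.
transitivity (\sum_(i < size p1) ((nth 0 p1 i).-1 * ((size p1).-1 - i)
    + (nth 0 p1 i).-1 * excess q)).
  apply: eq_bigr => i _; have i_lt := ltn_ord i; rewrite nth_cat i_lt -mulnDr.
  congr (_ * _).
  rewrite verts_cons // count_cat count_iota count_map; congr (_ + _); first by slia.
  rewrite -size_verts // -[RHS](count_predT) -!sum1_count big_seq_cond.
  rewrite [RHS]big_seq_cond; apply: eq_bigl => z /=; rewrite andbT.
  by rewrite mem_filter mem_iota; case: (_ \notin _) => //=; slia.
rewrite big_split /= -big_distrl /=; congr (_ + _ * _).
  elim: p1 {sz} => [|x p1 IH] /=; first by rewrite big_ord0.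
  rewrite big_ord_recl /= subn0 -IH; congr (_ + _); apply: eq_bigr => i _.
  by rewrite /bump /=; congr (_ * _); slia.
by elim: p1 {sz} => [|x p1 IH]; rewrite /= ?big_ord0 // big_ord_recl IH.
Qed.

Lemma excess_cat p q : excess (p ++ q) = excess p + excess q.
Proof. by elim: p => //= x p ->; rewrite addnA. Qed.

Lemma excessE p : positive p -> sumn p = excess p + size p.
Proof. by elim: p => //= x p IH /andP[x_gt0 /IH->]; slia. Qed.

Lemma excess_sharps p q : positive p -> positive q -> size p = sumn q ->
  excess (sharps p q) = excess p + excess q.
Proof.
move=> p_pos q_pos sz; have := excessE (positive_sharps p_pos q_pos sz).
by rewrite sumn_sharps // size_sharps !excessE // sz excessE //; slia.
Qed.

Lemma size_split (T : Type) n m (p : seq T) : size p = n + m ->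
  exists p1 p2, [/\ p = p1 ++ p2, size p1 = n & size p2 = m].
Proof.
move=> sz; exists (take n p), (drop n p); rewrite cat_take_drop size_drop.
by rewrite size_takel; [split=> //; slia|slia].
Qed.

Lemma sharps_block p1 p2 q : sharps (p1 ++ p2) (size p1 :: q) = sumn p1 :: sharps p2 q.
Proof. by rewrite /= take_size_cat // drop_size_cat. Qed.

Lemma hearts_nil q : hearts [::] q = 0.
Proof. by rewrite /hearts big_ord0. Qed.

(** Each unit of excess in [p1] sees all the [excess q2] vertical positions of [q2]. This cross term
    is what will be compared with Koszul signs. *)
Lemma hearts_cat p1 p2 q1 q2 : size p1 = sumn q1 -> positive q1 -> positive q2 ->
  hearts (p1 ++ p2) (q1 ++ q2) = hearts p1 q1 + excess p1 * excess q2 + hearts p2 q2.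
Proof.
move=> sz q1_pos q2_pos; elim: q1 p1 q1_pos sz => [|x q1 IH] p1 /=.
  by move=> _; case: p1 => //= _; rewrite hearts_nil.
move=> /andP[x_gt0 q1_pos] /size_split[a [b [-> sza szb]]].
rewrite -catA -sza !hearts_cons ?sza ?all_cat ?q1_pos //.
by rewrite IH // !excess_cat; ring.
Qed.

Lemma heart1_cat p q : heart1 (p ++ q) = heart1 p + excess p * size q + heart1 q.
Proof. by elim: p => //= x p ->; rewrite size_cat; ring. Qed.

(** The case of a single outer block, [t = [:: size q]], of [hearts_cocycle]. *)
Lemma heart1_sharps p q : positive p -> positive q -> size p = sumn q ->
  heart1 p + heart1 q = heart1 (sharps p q) + hearts p q.
Proof.
elim: q p => [|x q IH] p.
  by case: p => //= _ _ _; rewrite hearts_nil.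
rewrite [all _ (_ :: _)]/= [sumn (_ :: _)]/=.
move=> p_pos /andP[x_gt0 q_pos] /size_split[a [b [pE sza szb]]].
move: p_pos; rewrite pE all_cat => /andP[a_pos b_pos].
have := IH _ b_pos q_pos szb.
rewrite -sza hearts_cons ?sza // -sza sharps_block /= sza heart1_cat size_sharps.
rewrite (excessE a_pos) sza szb (excessE q_pos).
have -> : (excess a + x).-1 = excess a + x.-1 by lia.
move: (excess a) (excess q) (size q) (heart1 a) (heart1 q) (hearts b q) => c d e f g h.
move: (heart1 b) (heart1 (sharps b q)) => m n E.
by transitivity (f + c * (d + e) + x.-1 * e + (m + g)); [ring|rewrite E; ring].
Qed.

(* The identity behind the associativity of the composition. The set Vert (sharps q t)
   consists of Vert q and of the partial sums of q indexed by Vert t; the latter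
   contribute [hearts p (sharps q t) - hearts p q] when they are counted entry by
   entry in p, and [hearts (sharps p q) t - hearts q t] block by block. *)
Lemma hearts_cocycle p q t : positive p -> positive q -> positive t ->
  size q = sumn t -> size p = sumn q ->
  hearts p (sharps q t) + hearts q t = hearts (sharps p q) t + hearts p q.
Proof.
elim: t q p => [|x t IH] q p.
  by case: q => //=; case: p => //= *; rewrite !hearts_nil.
rewrite [all _ (_ :: _)]/= [sumn (_ :: _)]/=.
move=> p_pos q_pos /andP[x_gt0 t_pos] /size_split[q1 [q2 [qE szq1 szq2]]].
move: q_pos; rewrite qE all_cat sumn_cat => /andP[q1_pos q2_pos].
move=> /size_split[p1 [p2 [pE szp1 szp2]]].
move: p_pos; rewrite pE all_cat => /andP[p1_pos p2_pos].
rewrite sharps_cat // -{1 2 3}szq1 sharps_block -{1}szp1 hearts_cons ?positive_sharps //; last first.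
  by rewrite szp1; apply: sumn_positive; rewrite // -size_eq0 -lt0n szq1.
rewrite hearts_cons ?szq1 // -szq1 -(size_sharps p1 q1).
rewrite hearts_cons ?size_sharps ?szq1 // hearts_cat // !excess_sharps //.
have := IH q2 p2 p2_pos q2_pos t_pos szq2 szp2.
have := heart1_sharps p1_pos q1_pos szp1.
move: (heart1 p1) (heart1 q1) (heart1 (sharps p1 q1)) (hearts p1 q1) => a1 a2 a3 a4 h1.
move: (hearts p2 (sharps q2 t)) (hearts q2 t) (hearts (sharps p2 q2) t) (hearts p2 q2) => b1 b2 b3 b4 h2.
move: (excess p1) (excess q1) (excess q2) (excess t) => c1 c2 c3 c4.
transitivity ((a1 + a2) + (b1 + b2) + c1 * c3 + c1 * c4 + c2 * c4); first by ring.
by rewrite h1 h2; ring.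
Qed.

(** * Multi-indices and their splittings *)

Lemma mindex_positive (k : mindex) : positive k.
Proof. by case: k => k /= /andP[]. Qed.

Lemma mindex_neq0 (k : mindex) : mival k != [::].
Proof. by case: k => k /= /andP[]. Qed.

Lemma size_mindex_gt0 (k : mindex) : 0 < size k.
Proof. by rewrite lt0n size_eq0 mindex_neq0. Qed.

Lemma mival_inj : injective mival.
Proof. exact: val_inj. Qed.

Lemma miK s : is_mindex s -> mival (mi s) = s.
Proof. by move=> s_mi; rewrite /mi -[mival _]/(val _) insubdK. Qed.

Lemma mivalK (k : mindex) : mi k = k.
Proof. by apply: mival_inj; rewrite miK //; case: k. Qed.

Lemma is_mindexP s : s != [::] -> positive s -> is_mindex s.
Proof. by rewrite /is_mindex => -> ->. Qed.

Lemma mi1 x : 0 < x -> mival (mi [:: x]) = [:: x].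
Proof. by move=> x_gt0; rewrite miK // /is_mindex /= x_gt0. Qed.

Lemma mi_cat (k l : mindex) : mival (mi (mival k ++ mival l)) = mival k ++ mival l.
Proof.
apply: miK; apply: is_mindexP; last by rewrite all_cat !mindex_positive.
by case: (mival k) (mindex_neq0 k).
Qed.

Lemma mvE (k : mindex) : mv k = excess k.
Proof. by rewrite /mv excessE ?mindex_positive // addnK. Qed.

Lemma sharpE (p q : mindex) : sharp p q = sharps p q.
Proof.
by rewrite /sharp; elim: (mival q) (mival p) => //= x s IH t; rewrite IH.
Qed.

Lemma heartE (p q : mindex) : heart p q = hearts p q.
Proof. by []. Qed.

Lemma vertical_nseq (k : mindex) : vertical k = (mival k == nseq (size k) 1).
Proof. by rewrite /vertical; apply/all_pred1P/eqP. Qed.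

Lemma vertical_sumn (k : mindex) : vertical k = (sumn k == size k).
Proof.
rewrite /vertical; have := mindex_positive k.
elim: (mival k) => //= x s IH /andP[x_gt0 s_pos]; rewrite (IH s_pos).
have := excessE s_pos; case: x x_gt0 => // -[|x] _ /=; slia.
Qed.

Lemma vertical_excess (k : mindex) : vertical k = (excess k == 0).
Proof. by rewrite vertical_sumn excessE ?mindex_positive //; slia. Qed.

Lemma verts_nseq n : verts (nseq n 1) = [::].
Proof.
by elim: n => // n IH; rewrite /nseq /= verts_cons ?IH //; elim: n {IH} => /=.
Qed.

Lemma hearts_nseq_r p n : hearts p (nseq n 1) = 0.
Proof. by rewrite /hearts verts_nseq big1 // => i _; rewrite muln0. Qed.

Lemma hearts_nseq_l q n : hearts (nseq n 1) q = 0.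
Proof.
by rewrite /hearts size_nseq big1 // => i _; rewrite nth_nseq ltn_ord.
Qed.

Lemma sharps_nseq_r p : sharps p (nseq (size p) 1) = p.
Proof. by elim: p => //= x p IH; rewrite take0 drop0 IH /= addn0. Qed.

Lemma sharps_nseq_l q : positive q -> sharps (nseq (sumn q) 1) q = q.
Proof.
elim: q => //= x q IH /andP[x_gt0 q_pos].
rewrite -[in RHS](IH q_pos) nseqD take_size_cat ?drop_size_cat ?size_nseq //.
by rewrite sumn_nseq mul1n.
Qed.

Lemma mem_splittings (k p q : mindex) :
  ((p, q) \in splittings k) = (sumn q == size p) && (sharps p q == k).
Proof.
rewrite mem_filter /= sharpE andbC.
have [pqk|] := altP (sharps p q =P mival k); last by rewrite !andbF.
rewrite !andbT; apply/allpairsPdep/eqP => [[p' [q' [+ + [-> ->]]]]|sz].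
  by rewrite !mem_mindices => _ /eqP.
exists p, q; rewrite !mem_mindices sz eqxx -pqk sumn_sharps ?eqxx //.
Qed.

Lemma splittings_uniq k : uniq (splittings k).
Proof.
apply: filter_uniq; apply: allpairs_uniq_dep.
- exact: undup_uniq.
- by move=> *; apply: undup_uniq.
- by move=> [p q] [p' q'] _ _ /= [-> ->].
Qed.

Lemma splittingsP (k p q : mindex) : (p, q) \in splittings k ->
  [/\ sumn q = size p, mival k = sharps p q, sumn p = sumn k, size q = size k
    & excess k = excess p + excess q].
Proof.
rewrite mem_splittings => /andP[/eqP sz /eqP kE]; rewrite -kE.
by rewrite sumn_sharps // size_sharps excess_sharps ?mindex_positive.
Qed.

Lemma is_mindex_sharps (p q : mindex) : sumn q = size p -> is_mindex (sharps p q).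
Proof.
move=> sz; apply: is_mindexP; last by rewrite positive_sharps ?mindex_positive.
by rewrite -size_eq0 size_sharps size_eq0 mindex_neq0.
Qed.

(** Both sides run over the triples whose iterated [sharps] is [k]. The intermediate multi-index is
    determined by the triple, so neither enumeration repeats a triple, and [sharpsA] shows that they
    have the same members. *)
Lemma splittings_assoc (V : nmodType) (F : mindex -> mindex -> mindex -> V) k :
  (\sum_(x <- splittings k) \sum_(y <- splittings x.2) F x.1 y.1 y.2
   = \sum_(x <- splittings k) \sum_(y <- splittings x.1) F y.1 y.2 x.2)%R.
Proof.
pose G (t : mindex * mindex * mindex) := F t.1.1 t.1.2 t.2.
transitivity (\sum_(t <- [seq (x.1, y.1, y.2) | x <- splittings k,
    y <- splittings x.2]) G t)%R; first by rewrite big_allpairs_dep.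
transitivity (\sum_(t <- [seq (y.1, y.2, x.2) | x <- splittings k,
    y <- splittings x.1]) G t)%R; last by rewrite big_allpairs_dep.
apply: perm_big; apply: uniq_perm.
- apply: allpairs_uniq_dep => [||[[a b] [c d]] [[a' b'] [c' d']]].
  + exact: splittings_uniq.
  + by move=> *; apply: splittings_uniq.
  + move=> /allpairsPdep[x [y [_ + [? ?]]]] /allpairsPdep[x' [y' [_ + [? ?]]]].
    subst x y x' y'; move=> /splittingsP[_ bE _ _ _] /splittingsP[_ bE' _ _ _].
    move=> [aa cc dd]; subst a' c' d'; rewrite -bE' in bE.
    by congr existT; congr pair; apply: mival_inj bE.
- apply: allpairs_uniq_dep => [||[[a b] [c d]] [[a' b'] [c' d']]].
  + exact: splittings_uniq.
  + by move=> *; apply: splittings_uniq.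
  + move=> /allpairsPdep[x [y [_ + [? ?]]]] /allpairsPdep[x' [y' [_ + [? ?]]]].
    subst x y x' y'; move=> /splittingsP[_ bE _ _ _] /splittingsP[_ bE' _ _ _].
    move=> [aa cc dd]; subst b' c' d'; rewrite -bE' in bE.
    by congr existT; congr pair; apply: mival_inj bE.
move=> [[p q] t]; apply/allpairsPdep/allpairsPdep.
  move=> [[p' r] [[q' t'] [/splittingsP[sz1 kE _ _ _] /splittingsP[sz2 rE sr sz3 _] [-> -> ->]]]].
  rewrite /= in sz1 kE sz2 rE sr sz3 *.
  have szqp : sumn q' = size p' by rewrite -sz1 rE sumn_sharps.
  pose u := mi (sharps p' q'); have uE : mival u = _ := miK (is_mindex_sharps szqp).
  exists (u, t'), (p', q'); split=> //.
    by rewrite mem_splittings uE size_sharps sz2 eqxx kE rE sharpsA ?eqxx.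
  by rewrite mem_splittings szqp uE !eqxx.
move=> [[r t'] [[p' q'] [/splittingsP[sz1 kE _ _ _] /splittingsP[sz2 rE sr sz3 _] [-> -> ->]]]].
rewrite /= in sz1 kE sz2 rE sr sz3 *.
have szqt : sumn t' = size q' by rewrite sz1 sz3.
pose u := mi (sharps q' t'); have uE : mival u = _ := miK (is_mindex_sharps szqt).
exists (p', u), (q', t'); split=> //.
  by rewrite mem_splittings uE sumn_sharps // sz2 eqxx kE rE sharpsA ?eqxx.
by rewrite mem_splittings szqt uE !eqxx.
Qed.

Lemma mem_splittings1 (i : nat) (p q : mindex) : 0 < i ->
  ((p, q) \in splittings (mi [:: i])) = (mival q == [:: size p]) && (sumn p == i).
Proof.
move=> i_gt0; rewrite mem_splittings mi1 //; apply/andP/andP => -[/eqP].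
  case: (mival q) => [|x [|y s]] //= sz.
    rewrite addn0 in sz; rewrite sz take_oversize ?drop_oversize //.
    by move=> /eqP[->].
  by move=> /eqP.
move=> -> /eqP <- /=; rewrite addn0 take_oversize //.
Qed.

(** The first component of a splitting of [i :: k] is cut behind the entries that are summed to [i];
    the head of the second component records where. This will make a composite of tensor products a
    tensor product of composites. *)
Lemma splittings_cons (V : nmodType) (F : mindex -> mindex -> V) (i : nat)
    (k : mindex) : 0 < i ->
  (\sum_(x <- splittings (mi (i :: k))) F x.1 x.2
   = \sum_(x <- splittings (mi [:: i])) \sum_(y <- splittings k)
       F (mi (mival x.1 ++ mival y.1)) (mi (mival x.2 ++ mival y.2)))%R.
Proof.
move=> i_gt0; pose G (x : mindex * mindex) := F x.1 x.2.
pose f (x y : mindex * mindex) :=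
  (mi (mival x.1 ++ mival y.1), mi (mival x.2 ++ mival y.2)).
have ikE : mival (mi (i :: k)) = i :: k.
  by rewrite miK // /is_mindex /= i_gt0 mindex_positive.
transitivity (\sum_(t <- [seq f x y | x <- splittings (mi [:: i]),
    y <- splittings k]) G t)%R; last by rewrite big_allpairs_dep.
apply: perm_big; apply: uniq_perm.
- exact: splittings_uniq.
- apply: allpairs_uniq_dep => [||[[p q] [r s]] [[p' q'] [r' s']]].
  + exact: splittings_uniq.
  + by move=> *; apply: splittings_uniq.
  move=> /allpairsPdep[x [y [+ _ [? ?]]]] /allpairsPdep[x' [y' [+ _ [? ?]]]].
  subst x y x' y'; rewrite !mem_splittings1 //.
  move=> /andP[/eqP qE _] /andP[/eqP qE' _] [].
  move=> /(congr1 mival) + /(congr1 mival); rewrite !mi_cat qE qE' /=.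
  move=> pr [szp ss]; move/eqP: pr; rewrite eqseq_cat // => /andP[/eqP pp /eqP rr].
  move: qE qE'; rewrite szp => <- qq.
  by rewrite (mival_inj pp) (mival_inj qq) (mival_inj rr) (mival_inj ss).
move=> [p q]; apply/idP/allpairsPdep; last first.
  move=> [[p1 q1] [[p2 q2] [+ /splittingsP[sz kE _ _ _] [-> ->]]]].
  rewrite mem_splittings1 //= => /andP[/eqP q1E /eqP p1E].
  rewrite mem_splittings !mi_cat q1E /= size_cat sz eqxx /=.
  by rewrite take_size_cat // drop_size_cat // ikE p1E kE.
move=> /splittingsP[sz kE _ szqk _]; rewrite ikE in kE.
case qE : (mival q) => [|x t]; first by rewrite qE in kE.
rewrite qE /= in sz kE; case: kE => [iE kE].
have [p1 [p2 [pE szp1 szp2]]] := size_split (esym sz).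
rewrite pE -szp1 take_size_cat // drop_size_cat // in iE kE.
have := mindex_positive q; rewrite qE /= => /andP[x_gt0 t_pos].
have := mindex_positive p; rewrite pE all_cat => /andP[p1_pos p2_pos].
have t_neq0 : t != [::].
  by apply: contra (mindex_neq0 k) => /eqP tE; rewrite kE tE.
have p1_mi : is_mindex p1 by rewrite is_mindexP // -size_eq0 szp1 -lt0n.
have t_mi : is_mindex t by rewrite is_mindexP.
have p2_mi : is_mindex p2.
  by rewrite is_mindexP // -size_eq0 szp2 -lt0n sumn_positive.
exists (mi p1, mi [:: x]), (mi p2, mi t).
rewrite mem_splittings1 // mem_splittings !miK //; last by rewrite /is_mindex /= x_gt0.
have -> : [:: x] = [:: size p1] by rewrite -szp1.
have -> : sumn t = size p2 by rewrite -szp2.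
rewrite -iE -kE !eqxx; split=> //; congr pair; apply: mival_inj => /=; rewrite mi_cat !miK //.
  by rewrite qE -szp1.
by rewrite /is_mindex /= szp1 x_gt0.
Qed.

Local Open Scope ring_scope.

(** * Graded maps between tensor powers *)

Section LinearMaps.
Context {R : comPzRingType} (U V : lmodType R) (f : U -> V).
Hypothesis f_lin : linear f.

Let f' : {linear U -> V} := HB.pack f (GRing.isLinear.Build R U V _ f f_lin).

Lemma lin0 : f 0 = 0. Proof. exact: (linear0 f'). Qed.
Lemma linB x y : f (x - y) = f x - f y. Proof. exact: (linearB f'). Qed.
Lemma linZ a x : f (a *: x) = a *: f x. Proof. exact: (linearZ_LR f'). Qed.
Lemma lin_sum I r (P : pred I) (E : I -> U) :
  f (\sum_(i <- r | P i) E i) = \sum_(i <- r | P i) f (E i).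
Proof. exact: (linear_sum f'). Qed.

End LinearMaps.

Lemma scaleC (R : comPzRingType) (V : lmodType R) (a b : R) (v : V) :
  a *: (b *: v) = b *: (a *: v).
Proof. by rewrite !scalerA mulrC. Qed.

Section Tensors.
Context {R : comPzRingType}.
Implicit Types A B C : gmod R.

Lemma linear_comp A B C (g : tensor B -> tensor C) (f : tensor A -> tensor B) :
  linear g -> linear f -> linear (fun x => g (f x)).
Proof. by move=> g_lin f_lin a x y; rewrite f_lin g_lin. Qed.

Lemma tclassE A (z : formal A) : tclass z = \sum_(p <- z) p.1 *: tpure p.2.
Proof.
elim: z => [|[a w] z IH]; first by rewrite big_nil.
rewrite big_cons -IH -cat1s -tadd_class; congr (_ + _).
by rewrite -[RHS]/(tscale a _) /tpure tscale_class /fscale /= mulr1.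
Qed.

Lemma tensor_expand A (x : tensor A) : x = \sum_(p <- repr x) p.1 *: tpure p.2.
Proof. by rewrite -tclassE tclass_repr. Qed.

Lemma linear_ext A (V : lmodType R) (f g : tensor A -> V) :
  linear f -> linear g -> (forall w, f (tpure w) = g (tpure w)) -> f =1 g.
Proof.
move=> f_lin g_lin fg x; rewrite (tensor_expand x) !lin_sum //.
by apply: eq_bigr => p _; rewrite !linZ // fg.
Qed.

Lemma tmul_linear_l A (y : tensor A) : linear (fun x => tmul x y).
Proof. exact/textend_linear/tmul_multilinear_l. Qed.

Lemma tmul_linear_r A (x : tensor A) : linear (tmul x).
Proof.
move=> a y z; rewrite /tmul /textend scaler_sumr -big_split; apply: eq_bigr => p _ /=.
have := textend_linear (tmul_multilinear_r p.2); rewrite /textend => ->.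
by rewrite scalerDr !scalerA mulrC.
Qed.

Lemma tmulZl A c (x y : tensor A) : tmul (c *: x) y = c *: tmul x y.
Proof. exact: (linZ (@tmul_linear_l A y)). Qed.

Lemma tmulZr A c (x y : tensor A) : tmul x (c *: y) = c *: tmul x y.
Proof. exact: (linZ (@tmul_linear_r A x)). Qed.

Lemma tmul0l A (y : tensor A) : tmul 0 y = 0.
Proof. exact: (lin0 (@tmul_linear_l A y)). Qed.

Lemma tmul0r A (y : tensor A) : tmul y 0 = 0.
Proof. exact: (lin0 (@tmul_linear_r A y)). Qed.

Lemma tmul_suml A I (r : seq I) (E : I -> tensor A) y :
  tmul (\sum_(i <- r) E i) y = \sum_(i <- r) tmul (E i) y.
Proof. exact: (lin_sum (@tmul_linear_l A y)). Qed.

Lemma tmul_sumr A I (r : seq I) (E : I -> tensor A) y :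
  tmul y (\sum_(i <- r) E i) = \sum_(i <- r) tmul y (E i).
Proof. exact: (lin_sum (@tmul_linear_r A y)). Qed.

Lemma tmulA A (x y z : tensor A) : tmul x (tmul y z) = tmul (tmul x y) z.
Proof.
apply: (linear_ext (f := fun x => tmul x (tmul y z))
  (g := fun x => tmul (tmul x y) z)) => [||u].
- exact: tmul_linear_l.
- by apply: (@linear_comp _ _ _ (fun x => tmul x z)); apply: tmul_linear_l.
apply: (linear_ext (f := fun y => tmul (tpure u) (tmul y z))
  (g := fun y => tmul (tmul (tpure u) y) z)) => [||v].
- by apply: linear_comp; [apply: tmul_linear_r|apply: tmul_linear_l].
- by apply: (@linear_comp _ _ _ (fun x => tmul x z));
    [apply: tmul_linear_l|apply: tmul_linear_r].
apply: (linear_ext (f := fun z => tmul (tpure u) (tmul (tpure v) z))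
  (g := tmul (tmul (tpure u) (tpure v)))) => [||w].
- by apply: linear_comp; apply: tmul_linear_r.
- exact: tmul_linear_r.
by rewrite !tmul_pure catA.
Qed.

Lemma tmul1 A (x : tensor A) : tmul x (tpure [::]) = x.
Proof.
apply: (linear_ext (f := fun x => tmul x (tpure [::])) (g := id)) => [||w] //.
  exact: tmul_linear_l.
by rewrite tmul_pure cats0.
Qed.

Lemma wdeg_cat A (u v : word A) : wdeg (u ++ v) = wdeg u + wdeg v.
Proof. exact: big_cat. Qed.

(** Homogeneity is an existential over representatives; this induction keeps them out of the later
    proofs. *)
Lemma thomog_ind A q D (P : tensor A -> Prop) :
  P 0 ->
  (forall a w y, size w = q -> wdeg w = D -> P y -> P (a *: tpure w + y)) ->
  forall y, thomog q D y -> P y.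
Proof.
move=> P0 PS y [z + ->]; rewrite tclassE.
elim: z => [|[a w] z IH]; first by rewrite big_nil.
rewrite big_cons => /= /andP[/andP[/eqP wq /eqP wD] z_hom].
by apply: PS => //; apply: IH.
Qed.

Lemma thomog_pure A (w : word A) : thomog (size w) (wdeg w) (tpure w).
Proof. by exists [:: (1, w)]; rewrite //= !eqxx. Qed.

Lemma thomog0 A q D : thomog q D (0 : tensor A).
Proof. by exists [::]. Qed.

Lemma thomogD A q D (x y : tensor A) : thomog q D x -> thomog q D y -> thomog q D (x + y).
Proof.
move=> [z z_hom ->] [z' z'_hom ->]; exists (z ++ z'); rewrite ?all_cat ?z_hom //.
exact: tadd_class.
Qed.

Lemma thomogZ A q D a (x : tensor A) : thomog q D x -> thomog q D (a *: x).
Proof.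
move=> [z z_hom ->]; exists (fscale a z); last exact: tscale_class.
by rewrite all_map.
Qed.

Lemma graded_linear A B p q d (f : tensor A -> tensor B) :
  graded_map p q d f -> linear f.
Proof. by case. Qed.

Lemma graded_homog A B p q d D (f : tensor A -> tensor B) x :
  graded_map p q d f -> thomog p D x -> thomog q (D + d) (f x).
Proof.
move=> [f_lin _ f_hom]; move: x; apply: thomog_ind => [|a w y wp wD fy].
  by rewrite lin0 //; apply: thomog0.
rewrite f_lin; apply: thomogD => //; apply: thomogZ.
by rewrite -wD; apply: f_hom.
Qed.

Lemma graded_comp A B C p q r d e (g : tensor B -> tensor C)
    (f : tensor A -> tensor B) :
  graded_map q r e g -> graded_map p q d f ->
  graded_map p r (d + e) (fun x => g (f x)).
Proof.
move=> g_gr f_gr; have g_lin := graded_linear g_gr; have f_lin := graded_linear f_gr.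
split; first exact: linear_comp.
  by move=> w wp; case: f_gr => _ -> // _; rewrite lin0.
move=> w wp; rewrite addrA; apply: (graded_homog g_gr).
by case: f_gr => _ _; apply.
Qed.

Lemma graded_zero A B p q d : graded_map p q d (fun _ : tensor A => 0 : tensor B).
Proof.
split=> [a x y|//|w _]; first by rewrite scaler0 addr0.
exact: thomog0.
Qed.

Lemma graded_lin A B p q d a (f g : tensor A -> tensor B) :
  graded_map p q d f -> graded_map p q d g ->
  graded_map p q d (fun x => a *: f x + g x).
Proof.
move=> [f_lin f0 f_hom] [g_lin g0 g_hom]; split.
- move=> b x y; rewrite f_lin g_lin !scalerDr !scalerA [a * b]mulrC.
  by rewrite addrACA.
- by move=> w wp; rewrite f0 // g0 // scaler0 addr0.
- by move=> w wp; apply: thomogD; [apply: thomogZ; apply: f_hom|apply: g_hom].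
Qed.

Lemma graded_scale A B p q d a (f : tensor A -> tensor B) :
  graded_map p q d f -> graded_map p q d (fun x => a *: f x).
Proof.
move=> f_gr; have := graded_lin a f_gr (graded_zero A B p q d).
by congr graded_map; apply/funext => x; rewrite addr0.
Qed.

Lemma graded_sum A B p q d (I : eqType) (r : seq I) (F : I -> tensor A -> tensor B) :
  (forall i, i \in r -> graded_map p q d (F i)) ->
  graded_map p q d (fun x => \sum_(i <- r) F i x).
Proof.
elim: r => [_|i r IH F_gr].
  under eq_fun do rewrite big_nil.
  exact: graded_zero.
under eq_fun do rewrite big_cons -[F i _]scale1r.
apply: graded_lin; first by apply: F_gr; rewrite mem_head.
by apply: IH => j jr; apply: F_gr; rewrite inE jr orbT.
Qed.

Lemma graded_ext A B p q d (f g : tensor A -> tensor B) :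
  graded_map p q d f -> graded_map p q d g ->
  (forall w, size w = p -> f (tpure w) = g (tpure w)) -> f =1 g.
Proof.
move=> [f_lin f0 _] [g_lin g0 _] fg; apply: linear_ext => // w.
by have [/fg|wp] := eqVneq (size w) p; last by rewrite f0 // g0.
Qed.

Lemma tid_pure A n (w : word A) :
  tid n (tpure w) = if size w == n then tpure w else 0.
Proof. exact/textend_pure/tid_multilinear. Qed.

Lemma tid_graded A n : graded_map n n 0 (@tid R A n).
Proof.
split; first exact/textend_linear/tid_multilinear.
  by move=> w; rewrite tid_pure => /negPf->.
by move=> w wn; rewrite tid_pure wn eqxx addr0 -wn; apply: thomog_pure.
Qed.

Lemma tid_comp A B p q d (f : tensor A -> tensor B) x :
  graded_map p q d f -> tid q (f x) = f x.
Proof.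
move=> f_gr; have f_lin := graded_linear f_gr.
apply: (graded_ext (f := fun x => tid q (f x)) _ f_gr).
  by have := graded_comp (@tid_graded B q) f_gr; rewrite addr0.
move=> w wp; have [_ _ /(_ w wp)] := f_gr.
move: (f (tpure w)); apply: thomog_ind => [|a v y vq _ IH].
  by rewrite (lin0 (graded_linear (tid_graded _ _))).
by rewrite (graded_linear (tid_graded _ _)) IH tid_pure vq eqxx.
Qed.

Lemma comp_tid A B p q d (f : tensor A -> tensor B) x :
  graded_map p q d f -> f (tid p x) = f x.
Proof.
move=> f_gr; apply: (graded_ext (f := fun x => f (tid p x)) _ f_gr).
  by have := graded_comp f_gr (@tid_graded A p); rewrite add0r.
by move=> w wp; rewrite tid_pure wp eqxx.
Qed.

(* d is the degree of g. *)
Definition tensor2 A B (P f g : tensor A -> tensor B) (a b : nat) (d : int) :=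
  forall u v : word A, size u = a -> size v = b ->
  P (tpure (u ++ v)) = isign (wdeg u * d) *: tmul (f (tpure u)) (g (tpure v)).

(** The inner map sends a word to a homogeneous tensor and not to a word, so the sign rule is needed
    for such arguments before tensor products of maps can be composed. *)
Lemma tensor2_homog A B (P f g : tensor A -> tensor B) a b d D E x y :
  linear P -> linear f -> linear g -> tensor2 P f g a b d ->
  thomog a D x -> thomog b E y ->
  P (tmul x y) = isign (D * d) *: tmul (f x) (g y).
Proof.
move=> P_lin f_lin g_lin Pfg xD yE; move: x xD; apply: thomog_ind => [|s u x ua uD IH].
  by rewrite tmul0l (lin0 P_lin) (lin0 f_lin) tmul0l scaler0.
rewrite tmul_linear_l P_lin IH f_lin tmul_linear_l scalerDr; congr (_ + _).
rewrite scaleC; congr (_ *: _); move: y yE {IH}; apply: thomog_ind => [|t v y vb _ IH].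
  by rewrite tmul0r (lin0 P_lin) (lin0 g_lin) tmul0r scaler0.
rewrite tmul_linear_r P_lin IH g_lin tmul_linear_r scalerDr scaleC tmul_pure.
by rewrite Pfg // uD.
Qed.

(** The interchange law: [g2] moves past [f1 (tpure u)], of degree [wdeg u + df1], whence the extra
    exponent [df1 * dg2]. *)
Lemma tensor2_comp A B C (Q f2 g2 : tensor B -> tensor C) (P f1 g1 : tensor A -> tensor B)
    a b a' b' a'' b'' df1 dg1 df2 dg2 :
  linear Q -> graded_map a' a'' df2 f2 -> graded_map b' b'' dg2 g2 ->
  graded_map a a' df1 f1 -> graded_map b b' dg1 g1 ->
  tensor2 Q f2 g2 a' b' dg2 -> tensor2 P f1 g1 a b dg1 ->
  forall u v : word A, size u = a -> size v = b ->
  Q (P (tpure (u ++ v))) = isign (wdeg u * (dg1 + dg2) + df1 * dg2) *: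
    tmul (f2 (f1 (tpure u))) (g2 (g1 (tpure v))).
Proof.
move=> Q_lin f2_gr g2_gr f1_gr g1_gr Qfg Pfg u v ua vb.
have [_ _ /(_ u ua) f1u] := f1_gr; have [_ _ /(_ v vb) g1v] := g1_gr.
rewrite Pfg // linZ // (tensor2_homog Q_lin _ _ Qfg f1u g1v).
- by rewrite scalerA -isignD; congr (isign _ *: _); ring.
- exact: graded_linear f2_gr.
- exact: graded_linear g2_gr.
Qed.

End Tensors.

(** * The category of (R, ud)-modules *)

(** With the pointwise module structure, the equations of the dg nerve become identities between
    morphisms, free of the arguments k, l and x. *)
HB.instance Definition _ (R : comPzRingType) (A B : gmod R) :=
  GRing.Lmodule.copy (ud_hom A B) (mindex -> mindex -> tensor A -> tensor B).

Section Category.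
Context {R : comPzRingType}.
Implicit Types A B C : gmod R.

Lemma ud_ext A B (phi psi : ud_hom A B) :
  (forall k l x, phi k l x = psi k l x) -> phi = psi.
Proof.
by move=> E; apply/funext => k; apply/funext => l; apply/funext => x; apply: E.
Qed.

Lemma ud_sumE A B I (r : seq I) (P : pred I) (F : I -> ud_hom A B) k l x :
  (\sum_(i <- r | P i) F i) k l x = \sum_(i <- r | P i) F i k l x.
Proof. by elim/big_rec2: _ => // i y1 y2 _ <-. Qed.

Lemma ud_compE A B C d (psi : ud_hom B C) (phi : ud_hom A B) k l x :
  ud_comp d psi phi k l x =
  \sum_(kk <- splittings k) \sum_(ll <- splittings l)
    isign (comp_sign kk.2 ll.1 kk.1 ll.2 d) *: psi kk.2 ll.1 (phi kk.1 ll.2 x).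
Proof. by apply: eq_bigr => -[k1 k0] _; apply: eq_bigr => -[l0 l1] _. Qed.

Lemma ud_comp_linear_l A B C d (phi : ud_hom A B) :
  linear (fun psi : ud_hom B C => ud_comp d psi phi).
Proof.
move=> a psi psi'; apply: ud_ext => k l x.
rewrite -[RHS]/(a *: ud_comp d psi phi k l x + ud_comp d psi' phi k l x).
rewrite !ud_compE scaler_sumr -big_split; apply: eq_bigr => kk _ /=.
rewrite scaler_sumr -big_split; apply: eq_bigr => ll _ /=.
by rewrite -[X in _ *: X]/(a *: psi _ _ _ + psi' _ _ _) scalerDr scaleC.
Qed.

(** Composition is linear in its left factor by pointwise computation, but linearity in the right
    factor requires the maps of the left one to be linear, which the type [ud_hom] does not
    impose. *)
Definition ud_linear A B (psi : ud_hom A B) := forall k l, linear (psi k l).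

Lemma ud_degree_linear A B d (psi : ud_hom A B) : ud_degree d psi -> ud_linear psi.
Proof. by move=> psi_d k l; apply: graded_linear (psi_d k l). Qed.

Lemma ud_comp_linear_r A B C d (psi : ud_hom B C) : ud_linear psi ->
  linear (fun phi : ud_hom A B => ud_comp d psi phi).
Proof.
move=> psi_lin a phi phi'; apply: ud_ext => k l x.
rewrite -[RHS]/(a *: ud_comp d psi phi k l x + ud_comp d psi phi' k l x).
rewrite !ud_compE scaler_sumr -big_split; apply: eq_bigr => kk _ /=.
rewrite scaler_sumr -big_split; apply: eq_bigr => ll _ /=.
by rewrite -[(a *: phi + phi') _ _ _]/(a *: phi _ _ _ + phi' _ _ _) psi_lin
  scalerDr scaleC.
Qed.

Lemma ud_degree0 A B d : ud_degree d (0 : ud_hom A B).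
Proof. by move=> k l; apply: graded_zero. Qed.

Lemma ud_degree_lin A B d a (phi psi : ud_hom A B) :
  ud_degree d phi -> ud_degree d psi -> ud_degree d (a *: phi + psi).
Proof. by move=> phi_d psi_d k l; apply: graded_lin. Qed.

Lemma ud_degreeZ A B d a (phi : ud_hom A B) :
  ud_degree d phi -> ud_degree d (a *: phi).
Proof. by move=> phi_d; rewrite -[_ *: _]addr0; apply: ud_degree_lin (@ud_degree0 _ _ _). Qed.

Lemma ud_degreeB A B d (phi psi : ud_hom A B) :
  ud_degree d phi -> ud_degree d psi -> ud_degree d (phi - psi).
Proof. by move=> phi_d psi_d; rewrite addrC -scaleN1r; apply: ud_degree_lin. Qed.

Lemma ud_degree_sum A B d I (r : seq I) (P : pred I) (F : I -> ud_hom A B) :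
  (forall i, P i -> ud_degree d (F i)) -> ud_degree d (\sum_(i <- r | P i) F i).
Proof.
move=> F_d; elim/big_rec: _ => [|i phi Pi phi_d]; first exact: ud_degree0.
by rewrite -[F i]scale1r; apply: ud_degree_lin => //; apply: F_d.
Qed.

Lemma ud_comp_degree A B C d e (psi : ud_hom B C) (phi : ud_hom A B) :
  ud_degree e psi -> ud_degree d phi -> ud_degree (e + d) (ud_comp d psi phi).
Proof.
move=> psi_e phi_d k l; rewrite (_ : ud_comp _ _ _ _ _ = fun x =>
    \sum_(kk <- splittings k) \sum_(ll <- splittings l)
    isign (comp_sign kk.2 ll.1 kk.1 ll.2 d) *: psi kk.2 ll.1 (phi kk.1 ll.2 x)); last first.
  by apply/funext => x; apply: ud_compE.
apply: graded_sum => -[k1 k0] /splittingsP[szk kE sk szk' ek] /=.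
apply: graded_sum => -[l0 l1] /splittingsP[szl lE sl szl' el] /=.
apply: graded_scale; have phi_gr := phi_d k1 l1; have psi_gr := psi_e k0 l0.
rewrite szk szl sl sk szk' szl' in phi_gr psi_gr *.
have := graded_comp psi_gr phi_gr; congr graded_map.
by rewrite !mvE ek el !PoszD; ring.
Qed.

(** Both bracketings expand into sums over triples of upper and of lower indices. The exponents are
    equal as integers once [hearts_cocycle] is applied to each kind of index; the right factor
    [ud_comp c phi chi] has degree [d + c]. *)
Lemma ud_compA A B C E c d (psi : ud_hom C E) (phi : ud_hom B C) (chi : ud_hom A B) :
  ud_linear psi ->
  ud_comp c (ud_comp d psi phi) chi = ud_comp (d + c) psi (ud_comp c phi chi).
Proof.
move=> psi_lin; apply: ud_ext => k l x.
(* The summand as it arises from the left bracketing: the suffixes 1, 01 and 00 belong to [chi],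
   [phi] and [psi]. *)
pose T (k1 k01 k00 l00 l01 l1 : mindex) :=
  isign ((hearts k1 (sharps k01 k00) + hearts k01 k00
    + hearts (sharps l00 l01) l1 + hearts l00 l01
    + (excess l00 + excess l01) * (excess k1 + excess l1)
    + excess l00 * (excess k01 + excess l01))%N%:Z
    + (excess k00 + excess k01 + excess l00 + excess l01)%N%:Z * c
    + (excess k00 + excess l00)%N%:Z * d) *: psi k00 l00 (phi k01 l01 (chi k1 l1 x)).
transitivity (\sum_(kk <- splittings k) \sum_(kk' <- splittings kk.2)
    \sum_(ll <- splittings l) \sum_(ll' <- splittings ll.1)
    T kk.1 kk'.1 kk'.2 ll'.1 ll'.2 ll.2).
  rewrite ud_compE; apply: eq_big_seq => -[k1 k0] /splittingsP[_ _ _ _ _] /=.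
  rewrite [RHS]exchange_big; apply: eq_big_seq => -[l0 l1] /splittingsP[_ _ _ _ _] /=.
  rewrite ud_compE scaler_sumr; apply: eq_big_seq.
  move=> -[k01 k00] /splittingsP[_ k0E _ _ k0e] /=.
  rewrite scaler_sumr; apply: eq_big_seq.
  move=> -[l00 l01] /splittingsP[_ l0E _ _ l0e] /=.
  rewrite scalerA -isignD; congr (isign _ *: _).
  rewrite /comp_sign !heartE k0E l0E !mvE k0e l0e.
  rewrite !PoszD !PoszM !PoszD; ring.
transitivity (\sum_(kk <- splittings k) \sum_(kk' <- splittings kk.1)
    \sum_(ll <- splittings l) \sum_(ll' <- splittings ll.2)
    T kk'.1 kk'.2 kk.2 ll.1 ll'.1 ll'.2); last first.
  rewrite ud_compE; apply: eq_big_seq => -[k1 k0] /splittingsP[k1z _ _ _ _] /=.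
  rewrite exchange_big; apply: eq_big_seq => -[l0 l1] /splittingsP[l1z _ _ _ _] /=.
  rewrite ud_compE (lin_sum (psi_lin _ _)) scaler_sumr; apply: eq_big_seq.
  move=> -[k01 k00] /splittingsP[k01z k1E _ k1sz k1e] /=.
  rewrite (lin_sum (psi_lin _ _)) scaler_sumr; apply: eq_big_seq.
  move=> -[l00 l01] /splittingsP[l01z l1E l1sm _ l1e] /=.
  rewrite (linZ (psi_lin _ _)) scalerA -isignD; congr (isign _ *: _).
  rewrite /comp_sign !heartE k1E l1E !mvE k1e l1e.
  (* In the right bracketing [chi], [phi], [psi] carry the upper indices [k01], [k00], [k0] and the
     lower indices [l01], [l00], [l0]. *)
  have coK := @hearts_cocycle k01 k00 k0 (mindex_positive _) (mindex_positive _)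
     (mindex_positive _) (etrans k1sz (esym k1z)) (esym k01z).
  have coL := @hearts_cocycle l0 l00 l01 (mindex_positive _) (mindex_positive _)
     (mindex_positive _) (esym l01z) (etrans (esym l1z) (esym l1sm)).
  move: coK coL; rewrite -!mvE; set h1 := hearts _ (sharps k00 k0).
  set h2 := hearts _ _; set h3 := hearts _ _; set h4 := hearts _ _.
  set h5 := hearts _ _; set h6 := hearts _ _; set h7 := hearts _ _; set h8 := hearts _ _.
  move=> coK coL.
  have coK' : h1%:Z = h3%:Z + h4%:Z - h2%:Z by lia.
  have coL' : h5%:Z = h7%:Z + h8%:Z - h6%:Z by lia.
  rewrite !PoszD !PoszM !PoszD; ring: coK' coL'.
rewrite (splittings_assoc (fun a b c => \sum_(ll <- splittings l)
  \sum_(ll' <- splittings ll.1) T a b c ll'.1 ll'.2 ll.2)).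
apply: eq_bigr => kk _; apply: eq_bigr => kk' _.
by rewrite (splittings_assoc (T kk'.1 kk'.2 kk.2)).
Qed.

(** * Units of the composition *)

Definition mone (n : nat) : mindex := mi (nseq n 1%N).

Lemma moneE n : (0 < n)%N -> mival (mone n) = nseq n 1%N.
Proof.
by case: n => // n _; apply: miK; apply: is_mindexP => //=; elim: n.
Qed.

Lemma mone_vertical n : vertical (mone n).
Proof.
case: n => [|n]; first by rewrite /vertical /mone /mi -[mival _]/(val _) val_insubd.
by rewrite vertical_nseq moneE // size_nseq.
Qed.

Lemma vertical_mone (k : mindex) : vertical k -> k = mone (size k).
Proof.
rewrite vertical_nseq => /eqP kE; apply: mival_inj.
by rewrite moneE ?size_mindex_gt0.
Qed.

Lemma splittings_vertical_r (k p q : mindex) : vertical q ->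
  ((p, q) \in splittings k) = ((p, q) == (k, mone (size k))).
Proof.
move=> q_v; apply/idP/eqP => [/splittingsP[sz kE _ szk _]|[-> ->]].
  move: (q_v); rewrite vertical_sumn => /eqP sq.
  move: (q_v); rewrite vertical_nseq => /eqP qE.
  rewrite (vertical_mone q_v) szk; congr pair; apply: mival_inj.
  by rewrite kE qE -sq sz sharps_nseq_r.
rewrite mem_splittings moneE ?size_mindex_gt0 // sumn_nseq mul1n eqxx.
by rewrite sharps_nseq_r eqxx.
Qed.

Lemma splittings_vertical_l (k p q : mindex) : vertical p ->
  ((p, q) \in splittings k) = ((p, q) == (mone (sumn k), k)).
Proof.
have sk : (0 < sumn k)%N by rewrite sumn_positive ?mindex_positive ?mindex_neq0.
move=> p_v; apply/idP/eqP => [/splittingsP[sz kE szk _ _]|[-> ->]].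
  move: (p_v); rewrite vertical_sumn => /eqP sp.
  move: (p_v); rewrite vertical_nseq => /eqP pE.
  rewrite (vertical_mone p_v) -szk sp; congr pair; apply: mival_inj.
  by rewrite kE pE -sz sharps_nseq_l ?mindex_positive.
rewrite mem_splittings moneE // size_nseq eqxx /=.
by rewrite sharps_nseq_l ?mindex_positive.
Qed.

Lemma big_splittings1 (V : nmodType) (F : mindex -> mindex -> V) (k p q : mindex) :
  (p, q) \in splittings k ->
  (forall p' q', (p', q') \in splittings k -> (p', q') != (p, q) -> F p' q' = 0) ->
  \sum_(x <- splittings k) F x.1 x.2 = F p q.
Proof.
move=> pq F0; rewrite (bigD1_seq (p, q)) ?splittings_uniq //= big_seq_cond.
by rewrite big1 ?addr0 // => -[p' q'] /andP[]; apply: F0.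
Qed.

Lemma big_splittings_r (V : nmodType) (F : mindex -> mindex -> V) (k : mindex) :
  (forall p q, ~~ vertical q -> F p q = 0) ->
  \sum_(x <- splittings k) F x.1 x.2 = F k (mone (size k)).
Proof.
move=> F0; apply: big_splittings1 => [|p q].
  by rewrite splittings_vertical_r // mone_vertical.
by have [/splittings_vertical_r-> ->//|/F0->] := boolP (vertical q).
Qed.

Lemma big_splittings_l (V : nmodType) (F : mindex -> mindex -> V) (k : mindex) :
  (forall p q, ~~ vertical p -> F p q = 0) ->
  \sum_(x <- splittings k) F x.1 x.2 = F (mone (sumn k)) k.
Proof.
move=> F0; apply: big_splittings1 => [|p q].
  by rewrite splittings_vertical_l // mone_vertical.
by have [/splittings_vertical_l-> ->//|/F0->] := boolP (vertical p).
Qed.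

Lemma splittings_vertical (V : nmodType) (F : mindex -> mindex -> V) (k : mindex) :
  vertical k -> \sum_(x <- splittings k) F x.1 x.2 = F k k.
Proof.
move=> k_v; have kE := vertical_mone k_v.
apply: big_splittings1 => [|p q].
  by rewrite splittings_vertical_r // -kE.
move=> pq; move: (pq) => /splittingsP[_ _ _ _ ke].
move: (k_v); rewrite vertical_excess ke addn_eq0 => /andP[_].
by rewrite -vertical_excess => q_v; move: pq; rewrite splittings_vertical_r // -kE => ->.
Qed.

Lemma hearts_vertical_l (p q : mindex) : vertical p -> hearts p q = 0%N.
Proof. by rewrite vertical_nseq => /eqP->; rewrite hearts_nseq_l. Qed.

Lemma hearts_vertical_r (p q : mindex) : vertical q -> hearts p q = 0%N.
Proof. by rewrite vertical_nseq => /eqP->; rewrite hearts_nseq_r. Qed.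

Lemma mv_vertical (k : mindex) : vertical k -> mv k = 0%N.
Proof. by rewrite mvE vertical_excess => /eqP. Qed.

Lemma size_mone n : (0 < n)%N -> size (mone n) = n.
Proof. by move=> /moneE->; rewrite size_nseq. Qed.

Lemma sumn_mindex_gt0 (k : mindex) : (0 < sumn k)%N.
Proof. by rewrite sumn_positive ?mindex_positive ?mindex_neq0. Qed.

Lemma ud_id_degree A : ud_degree 0 (@ud_id R A).
Proof.
move=> k l; rewrite /ud_id; case: andP => [[k_v l_v]|_]; last exact: graded_zero.
rewrite !mv_vertical //; move: k_v l_v; rewrite !vertical_sumn => /eqP-> /eqP->.
exact: tid_graded.
Qed.

(** The identity vanishes off vertical indices, which leaves one splitting of [k] and one of [l];
    hearts and v of vertical indices are 0, so no sign remains. *)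
Lemma ud_comp1l A B d (phi : ud_hom A B) :
  ud_degree d phi -> ud_comp d (@ud_id R B) phi = phi.
Proof.
move=> phi_d; apply: ud_ext => k l x; rewrite ud_compE.
rewrite (big_splittings_r (F := fun k1 k0 => \sum_(ll <- splittings l)
  isign (comp_sign k0 ll.1 k1 ll.2 d) *: @ud_id R B k0 ll.1 (phi k1 ll.2 x))); last first.
  move=> p q q_nv; rewrite big1 // => ll _; rewrite /ud_id (negPf q_nv).
  exact: scaler0.
rewrite (big_splittings_l (F := fun l0 l1 => isign (comp_sign _ l0 k l1 d) *:
  @ud_id R B _ l0 (phi k l1 x))); last first.
  by move=> p q p_nv; rewrite /ud_id (negPf p_nv) andbF scaler0.
rewrite /comp_sign !heartE hearts_vertical_r ?hearts_vertical_l ?mone_vertical //.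
rewrite (mv_vertical (mone_vertical (size k))) (mv_vertical (mone_vertical (sumn l))).
rewrite mul0n mul0r scale1r /ud_id !mone_vertical /=.
rewrite !size_mone ?size_mindex_gt0 ?sumn_mindex_gt0 //.
exact: tid_comp (phi_d k l).
Qed.

Lemma ud_comp1r A B d (phi : ud_hom A B) :
  ud_degree d phi -> ud_comp 0 phi (@ud_id R A) = phi.
Proof.
move=> phi_d; apply: ud_ext => k l x; rewrite ud_compE.
rewrite (big_splittings_l (F := fun k1 k0 => \sum_(ll <- splittings l)
  isign (comp_sign k0 ll.1 k1 ll.2 0) *: phi k0 ll.1 (@ud_id R A k1 ll.2 x))); last first.
  move=> p q q_nv; rewrite big1 // => ll _; rewrite /ud_id (negPf q_nv).
  by rewrite (lin0 (graded_linear (phi_d _ _))) scaler0.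
rewrite (big_splittings_r (F := fun l0 l1 => isign (comp_sign k l0 _ l1 0) *:
  phi k l0 (@ud_id R A _ l1 x))); last first.
  move=> p q q_nv; rewrite /ud_id (negPf q_nv) andbF.
  by rewrite (lin0 (graded_linear (phi_d _ _))) scaler0.
rewrite /comp_sign !heartE hearts_vertical_l ?hearts_vertical_r ?mone_vertical //.
rewrite (mv_vertical (mone_vertical (size l))) (mv_vertical (mone_vertical (sumn k))).
rewrite muln0 mulr0 scale1r /ud_id !mone_vertical /=.
rewrite !size_mone ?size_mindex_gt0 ?sumn_mindex_gt0 //.
exact: comp_tid (phi_d k l).
Qed.

End Category.

(** * The relations of morphisms *)

Lemma mindex_ind (P : mindex -> Prop) :
  (forall i, (0 < i)%N -> P (mi [:: i])) ->
  (forall i k, (0 < i)%N -> P k -> P (mi (i :: mival k))) ->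
  forall k, P k.
Proof.
move=> P1 PS k; rewrite -[k]mivalK.
have := mindex_neq0 k; have := mindex_positive k.
elim: (mival k) => // i [|j s] IH /= /andP[i_gt0 s_pos] _; first exact: P1.
have s_mi : is_mindex (j :: s) by apply: is_mindexP.
by rewrite -{1}(miK s_mi); apply: PS => //; apply: IH.
Qed.

(** Lengths of source words and degrees of maps are of this kind: they add up over the factors of a
    tensor product. *)
Definition additive_mi (V : nmodType) (N : mindex -> V) :=
  forall i k, (0 < i)%N -> N (mi (i :: mival k)) = N (mi [:: i]) + N k.

Lemma mi_consE i (k : mindex) : (0 < i)%N -> mival (mi (i :: mival k)) = i :: mival k.
Proof. by move=> i_gt0; rewrite miK // /is_mindex /= i_gt0 mindex_positive. Qed.

Lemma mi_catA i (p q : mindex) : (0 < i)%N ->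
  mi (mival (mi (i :: mival p)) ++ mival q) = mi (i :: mival (mi (mival p ++ mival q))).
Proof. by move=> i_gt0; apply: mival_inj; rewrite mi_cat !mi_consE // mi_cat. Qed.

Lemma additive_cat (V : nmodType) (N : mindex -> V) (p q : mindex) :
  additive_mi N -> N (mi (mival p ++ mival q)) = N p + N q.
Proof.
move=> N_add; elim/mindex_ind: p => [i i_gt0|i p i_gt0 IH].
  by rewrite mi1 // cat1s N_add.
by rewrite mi_catA // !N_add // IH addrA.
Qed.

Lemma additive_sum (V : nmodType) (N : mindex -> V) (k : mindex) :
  additive_mi N -> \sum_(i <- mival k) N (mi [:: i]) = N k.
Proof.
move=> N_add; elim/mindex_ind: k => [i i_gt0|i k i_gt0 IH].
  by rewrite mi1 // big_seq1.
by rewrite mi_consE // big_cons IH N_add.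
Qed.

(** * Families of maps that split as tensor products along a multi-index *)

Section TensorFamilies.
Context {R : comPzRingType}.
Implicit Types A B C : gmod R.

Section Tensorial.
Variables (A B : gmod R) (Phi : mindex -> tensor A -> tensor B).
Variables (N : mindex -> nat) (D : mindex -> int).
Hypotheses (N_add : additive_mi N) (D_add : additive_mi D).

(** A binary form of [is_tensor], which splits off one entry at a time and so can be composed by
    [tensor2_comp]. *)
Definition tensorial := forall i (k : mindex), (0 < i)%N ->
  tensor2 (Phi (mi (i :: mival k))) (Phi (mi [:: i])) (Phi k) (N (mi [:: i])) (N k) (D k).

Definition entry_factors (k : mindex) : seq (factor A B) :=
  [seq Factor (N (mi [:: i])) (D (mi [:: i])) (Phi (mi [:: i])) | i <- mival k].

Lemma cut_word (k : mindex) (v : word A) : size v = N k ->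
  exists2 us, [seq size u | u <- us] = [seq fsize f | f <- entry_factors k]
    & flatten us = v.
Proof.
move=> vk; pose sh := [seq fsize f | f <- entry_factors k].
have shk : sumn sh = size v.
  rewrite vk -(additive_sum k N_add) sumnE !big_map //.
exists (reshape sh v); last by rewrite reshapeKr // shk.
by rewrite -[LHS]/(shape _) reshapeKl // shk.
Qed.

(** A tensor product of many factors is an iterated binary one; additivity of [N] and [D] recovers
    the length and the degree of the tail from its factors. *)
Lemma tensorialP : (forall k, is_tensor (Phi k) (entry_factors k)) <-> tensorial.
Proof.
split=> [Phi_t i k i_gt0 u v ui vk|Phi_t].
  have [us us_k <-] := cut_word vk.
  have := Phi_t (mi (i :: mival k)) (u :: us); rewrite /entry_factors mi_consE //=.
  rewrite -/(entry_factors k) us_k ui => -> //; rewrite Phi_t //.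
  by rewrite big_map (additive_sum k D_add).
elim/mindex_ind => [i i_gt0|i k i_gt0 IH] us.
  rewrite /entry_factors mi1 //; case: us => [|u [|]] //= _.
  by rewrite cats0 big_nil mulr0 scale1r tmul1.
rewrite /entry_factors mi_consE //= -/(entry_factors k).
case: us => [|u us] //= [ui us_k]; rewrite big_map (additive_sum k D_add).
rewrite Phi_t // ?IH // size_flatten /shape us_k sumnE !big_map.
by rewrite -(additive_sum k N_add).
Qed.

(** By associativity of the tensor product the family also splits at any other place. This is needed
    since the first entry of a grouped multi-index comes from a block of several entries. *)
Lemma tensorial_cat (p q : mindex) : tensorial ->
  tensor2 (Phi (mi (mival p ++ mival q))) (Phi p) (Phi q) (N p) (N q) (D q).
Proof.
move=> Phi_t; elim/mindex_ind: p => [i i_gt0|i p i_gt0 IH].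
  by rewrite mi1 // cat1s; apply: Phi_t.
rewrite mi_catA // N_add // => u v u_ip vq.
rewrite -(cat_take_drop (N (mi [:: i])) u); move: u_ip => /size_split.
move=> [u1 [u2 [-> u1i u2p]]].
rewrite take_size_cat // drop_size_cat // -catA.
have u2v : size (u2 ++ v) = N (mi (mival p ++ mival q)).
  by rewrite size_cat u2p vq additive_cat.
rewrite (Phi_t _ _ i_gt0 u1 _ u1i u2v) (IH u2 v u2p vq) (Phi_t _ _ i_gt0 u1 u2 u1i u2p).
rewrite tmulZl tmulZr tmulA !scalerA -!isignD additive_cat // wdeg_cat.
by congr (isign _ *: _); ring.
Qed.

End Tensorial.

(** By [splittings_cons] the sum for [i :: k] is a double sum, and [tmul] is bilinear, so
    tensoriality may be checked on single summands. *)
Lemma tensorial_splittings A B (Psi : mindex -> tensor A -> tensor B)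
    (H : mindex -> mindex -> tensor A -> tensor B) (N : mindex -> nat) (D : mindex -> int) :
  (forall k x, Psi k x = \sum_(y <- splittings k) H y.1 y.2 x) ->
  (forall i k p q P Q, (0 < i)%N ->
     (p, q) \in splittings (mi [:: i]) -> (P, Q) \in splittings k ->
     tensor2 (H (mi (mival p ++ mival P)) (mi (mival q ++ mival Q))) (H p q) (H P Q)
       (N (mi [:: i])) (N k) (D k)) ->
  tensorial Psi N D.
Proof.
move=> PsiE H_t i k i_gt0 u v ui vk; rewrite !PsiE.
rewrite (splittings_cons (fun p q => H p q (tpure (u ++ v)))) //.
rewrite tmul_suml scaler_sumr; apply: eq_big_seq => -[p q] pq.
rewrite tmul_sumr scaler_sumr; apply: eq_big_seq => -[P Q] PQ.
exact: (H_t i k p q P Q i_gt0 pq PQ u v ui vk).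
Qed.

Lemma excess_additive : additive_mi (fun k => (excess k)%:Z).
Proof. by move=> i k i_gt0; rewrite mi_consE // mi1 //= PoszD addn0. Qed.

Lemma sumn_additive c : additive_mi (fun k => (sumn k * c)%N).
Proof.
by move=> i k i_gt0; rewrite mi_consE // mi1 //= addn0 mulnDl.
Qed.

Lemma size_additive c : additive_mi (fun k => (c * size k)%N).
Proof. by move=> i k i_gt0; rewrite mi_consE // mi1 //= muln1 mulnS. Qed.

(** Off vertical indices both sides vanish, and on them [excess k] is 0, so that no sign appears. *)
Lemma tensorial_id A (N : mindex -> nat) : additive_mi N ->
  tensorial (fun k => if vertical k then @tid R A (N k) else fun _ => 0) N
    (fun k => (excess k)%:Z).
Proof.
move=> N_add i k i_gt0 u v ui vk; rewrite /vertical mi_consE // mi1 //= andbT.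
move: i_gt0 ui; have [-> _ ui|_ _ _] := eqVneq i 1%N; last by rewrite tmul0l scaler0.
rewrite /= -[all _ k]/(vertical k); case: ifP => [|_]; last by rewrite tmul0r scaler0.
rewrite vertical_excess => /eqP->; rewrite mulr0 scale1r.
by rewrite !tid_pure size_cat -ui -vk N_add // -ui -vk !eqxx tmul_pure.
Qed.

(** * Permutations of tensor factors and the exchange of rows and columns *)

Definition inverse_perms (n : nat) (s t : seq nat) :=
  [/\ size s = n, size t = n,
      forall q, (q < n)%N -> (nth 0%N s q < n)%N /\ nth 0%N t (nth 0%N s q) = q
    & forall q, (q < n)%N -> (nth 0%N t q < n)%N /\ nth 0%N s (nth 0%N t q) = q].

Lemma inverse_perms_sym n s t : inverse_perms n s t -> inverse_perms n t s.
Proof. by case. Qed.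

Lemma inverse_perms_perm n s t : inverse_perms n s t -> perm_eq s (iota 0 (size s)).
Proof.
case=> sn tn st ts; rewrite sn perm_sym; apply: uniq_perm.
- exact: iota_uniq.
- apply/(uniqP 0%N) => p q; rewrite !inE sn => pn qn spq.
  by rewrite -(st p pn).2 spq (st q qn).2.
move=> x; rewrite mem_iota add0n /=; apply/idP/idP => [xn|/(nthP 0%N)[q]].
  by have [tx <-] := ts x xn; rewrite mem_nth // sn.
by rewrite sn => /st[? _] <-.
Qed.

Lemma tperm_pure A s (w : word A) : perm_eq s (iota 0 (size s)) ->
  tperm s (tpure w) =
  if size w == size s then isign (koszul s w) *: tpure (wperm s w) else 0.
Proof. by move=> s_perm; apply/textend_pure/tperm_multilinear. Qed.

Lemma size_wperm A s (w : word A) : size (wperm s w) = size s.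
Proof. exact: size_map. Qed.

Lemma wdeg_wperm A s (w : word A) : perm_eq s (iota 0 (size s)) -> size w = size s ->
  wdeg (wperm s w) = wdeg w.
Proof.
move=> s_perm ws; rewrite /wdeg big_map (perm_big _ s_perm) -ws.
by rewrite [RHS](big_nth (Hom_elt (0 : A 0))) /index_iota subn0.
Qed.

Lemma tperm_graded A s : perm_eq s (iota 0 (size s)) ->
  graded_map (size s) (size s) 0 (@tperm R A s).
Proof.
move=> s_perm; split; first exact/textend_linear/tperm_multilinear.
  by move=> w; rewrite tperm_pure // => /negPf->.
move=> w ws; rewrite tperm_pure // ws eqxx addr0; apply: thomogZ.
by rewrite -(wdeg_wperm s_perm ws) -(size_wperm s w); apply: thomog_pure.
Qed.

Lemma koszulE A (s : seq nat) (w : word A) :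
  koszul s w = \sum_(q < size s) \sum_(p < size s | (p < q)%N &&
      (nth 0 s q < nth 0 s p)%N)
    ldeg w (nth 0%N s p) * ldeg w (nth 0%N s q).
Proof.
apply: eq_bigr => q _.
rewrite (big_ord_widen_cond _ (fun p => (nth 0 s q < nth 0 s p)%N)
  (fun p => ldeg w (nth 0%N s p) * ldeg w (nth 0%N s q)) (ltnW (ltn_ord q))).
by apply: eq_bigl => p; rewrite andbC.
Qed.

(** An inversion p < q of [s] corresponds to the inversion s_q < s_p of its inverse, and the same
    two letters are exchanged. *)
Lemma koszul_inverse A n s t (w : word A) : inverse_perms n s t ->
  koszul t (wperm s w) = koszul s w.
Proof.
move=> st; rewrite !koszulE; case: st => sn -> st ts; rewrite sn.
pose fs (q : 'I_n) := Ordinal (st q (ltn_ord q)).1.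
pose ft (q : 'I_n) := Ordinal (ts q (ltn_ord q)).1.
have fsK : cancel fs ft by move=> q; apply: val_inj; exact: (st q (ltn_ord q)).2.
have ftK : cancel ft fs by move=> q; apply: val_inj; exact: (ts q (ltn_ord q)).2.
rewrite !pair_big_dep /=.
rewrite (reindex (fun x : 'I_n * 'I_n => (fs x.2, fs x.1))) /=; last first.
  by exists (fun x => (ft x.2, ft x.1)) => -[q p] _ /=; rewrite ?fsK ?ftK.
apply: eq_big => [[q p]|[q p] _] /=.
  by rewrite (st q (ltn_ord q)).2 (st p (ltn_ord p)).2 andbC.
rewrite (st q (ltn_ord q)).2 (st p (ltn_ord p)).2 mulrC.
by rewrite /ldeg /wperm !(nth_map 0%N) ?sn.
Qed.

(** The two Koszul signs agree, so their product is 1. The result is [tid n], not the identity,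
    because permutations are extended by 0 to the other tensor powers. *)
Lemma tperm_inverse A n s t (x : tensor A) : inverse_perms n s t ->
  tperm t (tperm s x) = tid n x.
Proof.
move=> st; have s_perm := inverse_perms_perm st.
have t_perm := inverse_perms_perm (inverse_perms_sym st).
have [sn tn Hst Hts] := st.
have s_gr := @tperm_graded A s s_perm; have t_gr := @tperm_graded A t t_perm.
rewrite sn tn in s_gr t_gr.
apply: (graded_ext (f := fun x => tperm t (tperm s x)) (g := @tid R A n)).
- have := graded_comp t_gr s_gr; exact.
- exact: tid_graded.
move=> w wn; rewrite tperm_pure // sn wn eqxx (linZ (graded_linear t_gr)).
rewrite tperm_pure // size_wperm tn sn eqxx scalerA (koszul_inverse _ st).
rewrite isign_sqr scale1r tid_pure wn eqxx; congr tpure.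
apply: (@eq_from_nth _ (Hom_elt (0 : A 0))); rewrite size_wperm tn // => q qn.
rewrite (nth_map 0%N) ?tn // (nth_map 0%N) ?sn; last by case: (Hts q qn).
by rewrite (Hts q qn).2.
Qed.

(** Expresses the enumeration by quotient and remainder, so that the inverse law of transpositions
    becomes Euclidean division. *)
Lemma allpairs_iota (T : Type) (f : nat -> nat -> T) m r c :
  [seq f j i | j <- iota m c, i <- iota 0 r]
  = mkseq (fun q => f (m + q %/ r)%N (q %% r)%N) (c * r).
Proof.
case: r => [|r]; first by rewrite muln0; elim: c m => //= c IH m; rewrite IH.
elim: c m => // c IH m; rewrite [iota m _]/= allpairs_cons IH /mkseq mulSn iotaD map_cat.
congr (_ ++ _).
  apply/eq_in_map => q; rewrite mem_iota add0n => /= qr.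
  by rewrite divn_small // modn_small // addn0.
rewrite [(0 + r.+1)%N]addnC iotaDl -map_comp; apply: eq_map => q /=.
by rewrite divnDl // divnn /= modnDl addnA addn1.
Qed.

Definition transp_perm (r c : nat) : seq nat :=
  [seq (i * c + j)%N | j <- iota 0 c, i <- iota 0 r].

Lemma transp_inverse r c : inverse_perms (r * c) (transp_perm r c) (transp_perm c r).
Proof.
suff half r' c' q : (q < r' * c')%N ->
    (nth 0%N (transp_perm r' c') q < r' * c')%N /\
    nth 0%N (transp_perm c' r') (nth 0%N (transp_perm r' c') q) = q.
  split; rewrite ?size_allpairs ?size_iota //; first by rewrite mulnC.
    exact: half.
  by rewrite mulnC; apply: half.
rewrite /transp_perm !allpairs_iota => q_lt.
have q_lt' : (q < c' * r')%N by rewrite mulnC.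
rewrite (nth_mkseq _ _ q_lt') !add0n.
have r_gt0 : (0 < r')%N by case: r' q_lt {q_lt'}.
have c_gt0 : (0 < c')%N by case: c' q_lt {q_lt'} => //; rewrite muln0.
have lt1 : (q %% r' < r')%N by rewrite ltn_mod.
have lt2 : (q %/ r' < c')%N by rewrite ltn_divLR.
have lt : (q %% r' * c' + q %/ r' < r' * c')%N.
  apply: (@leq_trans ((q %% r').+1 * c')); last by rewrite leq_mul2r lt1 orbT.
  by rewrite mulSn addnC ltn_add2r.
split=> //; rewrite nth_mkseq // add0n modnMDl (modn_small lt2).
by rewrite divnMDl // (divn_small lt2) addn0 -divn_eq.
Qed.

Lemma transpK A r c (x : tensor A) : transp c r (transp r c x) = tid (r * c) x.
Proof. exact/tperm_inverse/transp_inverse. Qed.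

Lemma transp_graded A r c : graded_map (r * c) (r * c) 0 (@transp R A r c).
Proof.
have := tperm_graded A (inverse_perms_perm (transp_inverse r c)).
by rewrite size_allpairs !size_iota mulnC.
Qed.

End TensorFamilies.

(** * Identities and composites satisfy the relations of morphisms *)

Section MorphismRelations.
Context {R : comPzRingType}.
Implicit Types A B C : gmod R.

(** The degree function is [excess k] because [l] is meant to be vertical and [phi] of degree 0. *)
Definition row_tensorial A B (phi : ud_hom A B) (l : mindex) :=
  tensorial (fun k => phi k l) (fun k => (sumn k * size l)%N) (fun k => (excess k)%:Z).

Definition col_tensorial A B (phi : ud_hom A B) (k : mindex) :=
  tensorial (flip phi k) (fun l => (sumn k * size l)%N) (fun l => (excess l)%:Z).

Lemma row_tensorialP A B (phi : ud_hom A B) (l : mindex) : vertical l ->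
  (forall k, is_tensor (phi k l) [seq row_factor 0 phi (mi [:: i]) l | i <- mival k])
  <-> row_tensorial phi l.
Proof.
move=> l_v; rewrite /row_tensorial -tensorialP; last exact: excess_additive.
  rewrite /entry_factors /row_factor; under eq_forall => k.
    under eq_map do rewrite mvE (mv_vertical l_v) add0r addr0.
    over.
  by [].
exact: sumn_additive.
Qed.

Lemma col_tensorialP A B (phi : ud_hom A B) (k : mindex) : vertical k ->
  (forall l, is_tensor (flip phi k l) [seq col_factor 0 phi k (mi [:: j]) | j <- mival l])
  <-> col_tensorial phi k.
Proof.
move=> k_v; rewrite /col_tensorial -tensorialP; last exact: excess_additive.
  rewrite /entry_factors /col_factor; under eq_forall => l.
    under eq_map do rewrite [mv (mi _)]mvE (mv_vertical k_v) !add0r.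
    over.
  by [].
exact: size_additive.
Qed.

Lemma morphism_relationsP A B (phi : ud_hom A B) : morphism_relations phi <->
  (forall l, vertical l -> row_tensorial phi l)
  /\ (forall k, vertical k -> col_tensorial phi k).
Proof.
split=> [phi_rel|[row col] k l].
  split=> [l l_v|k k_v].
    by apply/row_tensorialP => // k; have [/(_ l_v)] := phi_rel k l.
  by apply/col_tensorialP => // l; have [_ /(_ k_v)] := phi_rel k l.
split=> [l_v|k_v].
  by move: (k); apply/row_tensorialP => //; apply: row.
by move: (l); apply/col_tensorialP => //; apply: col.
Qed.

Lemma flip_graded A B d (phi : ud_hom A B) (k l : mindex) : ud_degree d phi ->
  graded_map (sumn k * size l) (size k * sumn l) (d + (mv k)%:Z + (mv l)%:Z)
    (flip phi k l).
Proof.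
move=> /(_ k l) phi_gr; have tr1 := @transp_graded R A (size l) (sumn k).
rewrite mulnC in tr1; have := graded_comp (transp_graded B _ _) (graded_comp phi_gr tr1).
by rewrite addr0 add0r.
Qed.

Lemma ud_id_flip A (k l : mindex) x : vertical k ->
  flip (@ud_id R A) k l x = (if vertical l then tid (sumn k * size l) else fun _ => 0) x.
Proof.
move=> k_v; rewrite /flip /ud_id k_v /=; case: ifP => l_v; last first.
  by rewrite (lin0 (graded_linear (transp_graded _ _ _))).
move: (k_v) (l_v); rewrite !vertical_sumn => /eqP sk /eqP sl.
rewrite sk sl mulnC (tid_comp (q := (size l * size k)%N) _ (transp_graded _ _ _)).
by rewrite transpK.
Qed.

(** Serves for degenerate edges, on which the simplicial operators take identities as values. *)
Lemma morphism_relations_id A : morphism_relations (@ud_id R A).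
Proof.
apply/morphism_relationsP; split=> [l l_v|k k_v] i m i_gt0 u v.
  have idE (k : mindex) : @ud_id R A k l
      = if vertical k then tid (sumn k * size l) else fun _ => 0.
    rewrite /ud_id l_v andbT; case: ifP => // k_v.
    by move: k_v; rewrite vertical_sumn => /eqP->.
  by rewrite !idE; apply: (@tensorial_id R A _ (sumn_additive (size l))).
rewrite !ud_id_flip //.
exact: (@tensorial_id R A _ (size_additive (sumn k))).
Qed.

(* The cross term excess p * excess Q of hearts_cat is the Koszul sign of moving the
   map indexed by p past the one indexed by Q. *)
Lemma row_tensorial_comp A B C (psi : ud_hom B C) (phi : ud_hom A B) (l : mindex) :
  vertical l -> ud_degree 0 psi -> ud_degree 0 phi ->
  row_tensorial psi l -> row_tensorial phi l -> row_tensorial (ud_comp 0 psi phi) l.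
Proof.
move=> l_v psi_0 phi_0 psi_t phi_t.
move: (l_v); rewrite vertical_sumn => /eqP sl.
pose H (p q : mindex) x := isign (hearts p q) *: psi q l (phi p l x).
apply: (tensorial_splittings (H := H)) => [k x|i k p q P Q i_gt0 pq PQ].
  rewrite ud_compE; apply: eq_bigr => kk _.
  rewrite (splittings_vertical (fun l0 l1 => isign (comp_sign kk.2 l0 kk.1 l1 0) *:
    psi kk.2 l0 (phi kk.1 l1 x)) l_v).
  rewrite /comp_sign !heartE (hearts_vertical_l l l_v) (mv_vertical l_v).
  by rewrite mul0n mulr0 !addr0 !addn0.
have [szq _ sp _ eP] := splittingsP pq.
have [szQ _ sP _ eQ] := splittingsP PQ.
move=> u v ui vk; rewrite /H mi_cat mi_cat -/(hearts _ _).
rewrite hearts_cat ?mindex_positive ?szq //.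
have gr (D E : gmod R) (chi : ud_hom D E) (r : mindex) : ud_degree 0 chi ->
    graded_map (sumn r * size l) (size r * size l) (excess r)%:Z (chi r l).
  move=> /(_ r l); rewrite sl (mv_vertical l_v) add0r addr0 mvE; exact.
have := @tensor2_comp R A B C _ _ _ _ _ _ _ _ _ _ _ _ _ _ _ _
  (graded_linear (gr _ _ _ (mi (mival q ++ mival Q)) psi_0))
  (gr _ _ _ q psi_0) (gr _ _ _ Q psi_0).
rewrite szq szQ => /(_ _ _ _ _ _ _ _ (gr _ _ _ p phi_0) (gr _ _ _ P phi_0)).
have psi_c := @tensorial_cat R B C (fun r => psi r l) _ _ (sumn_additive (size l))
  excess_additive q Q psi_t.
have phi_c := @tensorial_cat R A B (fun r => phi r l) _ _ (sumn_additive (size l))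
  excess_additive p P phi_t.
rewrite szq szQ in psi_c.
move=> /(_ _ psi_c phi_c u v); rewrite sp sP => /(_ ui vk) ->.
rewrite tmulZl tmulZr !scalerA -!isignD eQ; congr (_ *: _).
apply: (isign_congr (c := (excess p * excess Q)%N%:Z)).
by rewrite !PoszD PoszM; ring.
Qed.

(** The transpositions between [psi] and [phi] are inverse to each other. The product of excesses is
    the part y0 * y1 of the composition sign; for vertical [l], as in the row case, it is 0. *)
Lemma flip_comp A B C (psi : ud_hom B C) (phi : ud_hom A B) (k l : mindex) x :
  vertical k -> ud_degree 0 psi -> ud_degree 0 phi ->
  flip (ud_comp 0 psi phi) k l x =
  \sum_(y <- splittings l) isign (hearts y.1 y.2 + excess y.1 * excess y.2)%N *:
    flip psi k y.1 (flip phi k y.2 x).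
Proof.
move=> k_v psi_0 phi_0; rewrite {1}/flip ud_compE.
have tr_lin := graded_linear (transp_graded C (size k) (sumn l)).
rewrite (splittings_vertical (fun k1 k0 => \sum_(ll <- splittings l)
  isign (comp_sign k0 ll.1 k1 ll.2 0) *: psi k0 ll.1 (phi k1 ll.2 _)) k_v).
rewrite (lin_sum tr_lin); apply: eq_big_seq => -[l0 l1] /splittingsP[sz _ sl szl _] /=.
rewrite (linZ tr_lin) /comp_sign !heartE (hearts_vertical_l k k_v) !mvE.
have ek : excess k = 0%N by move: k_v; rewrite vertical_excess => /eqP.
have sk : sumn k = size k by move: k_v; rewrite vertical_sumn => /eqP.
rewrite ek.
by rewrite !add0n mulr0 addr0 /flip sk sl szl -sz transpK (tid_comp _ (phi_0 k l1)).
Qed.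

(** Here the maps of [psi] are indexed by [p], [P] and those of [phi] by [q], [Q]. The product of
    excesses adds the cross terms [excess p * excess Q] and [excess P * excess q]: the former
    cancels the one of [hearts_cat] modulo 2, and the latter is the Koszul sign of moving the map of
    [q] past that of [P]. *)
Lemma col_tensorial_comp A B C (psi : ud_hom B C) (phi : ud_hom A B) (k : mindex) :
  vertical k -> ud_degree 0 psi -> ud_degree 0 phi ->
  col_tensorial psi k -> col_tensorial phi k -> col_tensorial (ud_comp 0 psi phi) k.
Proof.
move=> k_v psi_0 phi_0 psi_t phi_t.
move: (k_v); rewrite vertical_sumn => /eqP sk.
pose H (p q : mindex) x :=
  isign (hearts p q + excess p * excess q)%N *: flip psi k p (flip phi k q x).
apply: (tensorial_splittings (H := H)) => [l x|i l p q P Q i_gt0 pq PQ].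
  by rewrite flip_comp.
have [szq _ _ sq eP] := splittingsP pq.
have [szQ _ _ sQ eQ] := splittingsP PQ.
move=> u v ui vk; rewrite /H mi_cat mi_cat !excess_cat.
rewrite hearts_cat ?mindex_positive ?szq //.
have gr (D E : gmod R) (chi : ud_hom D E) (r : mindex) : ud_degree 0 chi ->
    graded_map (sumn k * size r) (sumn k * sumn r) (excess r)%:Z (flip chi k r).
  by move=> /flip_graded -/(_ k r); rewrite -sk (mv_vertical k_v) !add0r mvE.
have := @tensor2_comp R A B C _ _ _ _ _ _ _ _ _ _ _ _ _ _ _ _
  (graded_linear (gr _ _ _ (mi (mival p ++ mival P)) psi_0))
  (gr _ _ _ p psi_0) (gr _ _ _ P psi_0).
rewrite -szq -szQ => /(_ _ _ _ _ _ _ _ (gr _ _ _ q phi_0) (gr _ _ _ Q phi_0)).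
have psi_c := @tensorial_cat R B C (flip psi k) _ _ (size_additive (sumn k))
  excess_additive p P psi_t.
have phi_c := @tensorial_cat R A B (flip phi k) _ _ (size_additive (sumn k))
  excess_additive q Q phi_t.
rewrite -szq -szQ in psi_c.
move=> /(_ _ psi_c phi_c u v); rewrite sq sQ => /(_ ui vk) ->.
rewrite tmulZl tmulZr !scalerA -!isignD eQ; congr (_ *: _).
apply: (isign_congr (c := (excess p * excess Q + excess P * excess q)%N%:Z)).
by rewrite !PoszD !PoszM !PoszD; ring.
Qed.

Lemma morphism_relations_comp A B C (psi : ud_hom B C) (phi : ud_hom A B) :
  ud_degree 0 psi -> ud_degree 0 phi ->
  morphism_relations psi -> morphism_relations phi ->
  morphism_relations (ud_comp 0 psi phi).
Proof.
move=> psi_0 phi_0 /morphism_relationsP[psi_r psi_c] /morphism_relationsP[phi_r phi_c].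
apply/morphism_relationsP; split=> [l l_v|k k_v].
  by apply: row_tensorial_comp; auto.
by apply: col_tensorial_comp; auto.
Qed.

End MorphismRelations.

(** * The dg nerve *)

Arguments ddiff {R n} X i : rename.
Arguments dmap {R n} X {i j s} _ : rename.
Arguments dmap_at {R n} X i s j : rename.
Arguments dident {R n} A i j : rename.

(** * Strictly and weakly increasing sequences of vertices *)

Section Chains.
Variable n : nat.
Implicit Types (i j x : 'I_n.+1) (s t u : seq 'I_n.+1).

Lemma chain_cat i t x u j : chain i (t ++ x :: u) j = chain i t x && chain x u j.
Proof.
by rewrite /chain rcons_cat rcons_cons cat_path [path _ i (rcons t x)]rcons_path /= andbA.
Qed.

Lemma ord_lt_trans : transitive (fun x y : 'I_n.+1 => (x < y)%N).
Proof. by move=> y x z; apply: ltn_trans. Qed.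

Lemma chain_delete i t x u j : chain i (t ++ x :: u) j -> chain i (t ++ u) j.
Proof.
rewrite /chain !rcons_cat; apply: subseq_path; first exact: ord_lt_trans.
by rewrite cat_subseq // subseq_cons.
Qed.

Lemma cut_nth i s p : (p < size s)%N ->
  s = take p s ++ nth i s p :: drop p.+1 s.
Proof. by move=> ps; rewrite -drop_nth // cat_take_drop. Qed.

Lemma chain_face i s j p : (p < size s)%N -> chain i s j ->
  [/\ chain i (take p s ++ drop p.+1 s) j, chain i (take p s) (nth i s p)
    & chain (nth i s p) (drop p.+1 s) j].
Proof.
move=> ps; rewrite {1}(cut_nth i ps) => c; have := c.
by rewrite chain_cat => /andP[-> ->]; split=> //; apply: chain_delete c.
Qed.

Lemma chain_repeat_l i s j : ~~ chain i (i :: s) j.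
Proof. by rewrite /chain /= ltnn. Qed.

Lemma chain_repeat_r i s j : ~~ chain i (rcons s j) j.
Proof. by rewrite -cats1 chain_cat /chain /= ltnn andbF. Qed.

Lemma chain_repeat i t x u j : ~~ chain i (t ++ x :: x :: u) j.
Proof. by rewrite chain_cat (negPf (chain_repeat_l _ _ _)) andbF. Qed.

(** Two neighbours in [i :: rcons s j] coincide. The cases tell whether this pair consists of both
    end points, involves the first or the last one, or is inner; the nerve equation holds for a
    different reason in each. *)
Lemma weak_chain_repeat i s j :
  path (fun x y : 'I_n.+1 => (x <= y)%N) i (rcons s j) -> ~~ chain i s j ->
  [\/ s = [::] /\ i = j, exists t, s = i :: t, exists t, s = rcons t j
    | exists t x u, s = t ++ x :: x :: u].
Proof.
have repeat (l : seq 'I_n.+1) (x : 'I_n.+1) : path (fun x y : 'I_n.+1 => (x <= y)%N) x l ->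
    ~~ path (fun x y : 'I_n.+1 => (x < y)%N) x l ->
    exists t y u, x :: l = t ++ y :: y :: u.
  elim: l x => //= y l IH x /andP[xy yl]; rewrite negb_and -leqNgt.
  have [yx _|xy' /=] := leqP y x.
    have -> : x = y by apply: val_inj; apply/eqP; rewrite eqn_leq xy.
    by exists [::], y, l.
  by move=> /(IH _ yl)[t [z [u ->]]]; exists (x :: t), z, u.
move=> /repeat + nc => /(_ nc)[[|y t] [x [u]]] /=.
  case=> ->; case: u => [|y u].
    by case: s {nc} => [[->]|z []] //; constructor 1.
  by case: s {nc} => //= z s [-> _]; constructor 2; exists s.
case=> _; case/lastP: u => [|u y'].
  rewrite -[[:: x; x]]/(rcons [:: x] x) -rcons_cat => /rcons_inj[-> ->].
  by constructor 3; exists t; rewrite cats1.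
rewrite -!rcons_cons -rcons_cat => /rcons_inj[-> _].
by constructor 4; exists t, x, u.
Qed.

End Chains.

(** * The nerve equation on degenerate simplices *)

Section DgNerveEquation.
Context {R : comPzRingType}.

(** The family [Phi] is arbitrary so that the equation can also be stated for [dmap_ext], which
    differs from [dmap_at] on an edge with equal end points. *)
Definition dg_equation n (A : 'I_n.+1 -> gmod R) (alpha : forall i, ud_hom (A i) (A i))
    (Phi : forall i (s : seq 'I_n.+1) j, ud_hom (A j) (A i)) i s j : Prop :=
  ud_comp (size s) (alpha i) (Phi i s j)
    - isign (size s) *: ud_comp (-1) (Phi i s j) (alpha j)
  = \sum_(p < size s) isign p.+1 *:
      (Phi i (take p s ++ drop p.+1 s) j
       - ud_comp (size (drop p.+1 s))
           (Phi i (take p s) (nth i s p)) (Phi (nth i s p) (drop p.+1 s) j)).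

Lemma dg_nerve_equationE n (X : diagram R n) i j s :
  dg_nerve_equation X i j s <->
  dg_equation (ddiff X) (fun i s j => dmap_at X i s j) i s j.
Proof.
split=> [E|E k l x].
  by apply: ud_ext => k l x; rewrite ud_sumE; apply: E.
have /(congr1 (fun phi : ud_hom _ _ => phi k l x)) := E.
by rewrite ud_sumE.
Qed.

Lemma dg_equation_eq n (A : 'I_n.+1 -> gmod R) (alpha : forall i, ud_hom (A i) (A i))
    (Phi Psi : forall i (s : seq 'I_n.+1) j, ud_hom (A j) (A i)) i s j :
  (forall i s j, chain i s j -> Phi i s j = Psi i s j) -> chain i s j ->
  dg_equation alpha Phi i s j -> dg_equation alpha Psi i s j.
Proof.
move=> PhiE c; rewrite /dg_equation -(PhiE _ _ _ c) => ->; apply: eq_bigr => p _.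
by have [c1 c2 c3] := chain_face (ltn_ord p) c; rewrite -!PhiE.
Qed.

(* phi_sigma for a weakly increasing sequence sigma of vertices, with the values that
   the degeneracies of the dg nerve prescribe when a vertex is repeated *)
Definition dmap_ext n (X : diagram R n) i (s : seq 'I_n.+1) j :
    ud_hom (dobj X j) (dobj X i) :=
  dep_if (fun c : chain i s j => dmap X c)
    (if s is [::] then dident (dobj X) i j else @ud_zero R _ _).

Arguments dmap_ext {n} X i s j : rename.

Lemma dmap_ext_chain n (X : diagram R n) i (s : seq 'I_n.+1) j :
  chain i s j -> dmap_ext X i s j = dmap_at X i s j.
Proof. by move=> c; rewrite /dmap_ext /dmap_at !(dep_if_true _ _ c). Qed.

Lemma dmap_ext_degenerate n (X : diagram R n) i (s : seq 'I_n.+1) j :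
  s != [::] -> ~~ chain i s j -> dmap_ext X i s j = 0.
Proof. by move=> s0 nc; rewrite /dmap_ext dep_if_false //; case: s s0 nc. Qed.

Lemma dmap_ext_repeat_l n (X : diagram R n) i (s : seq 'I_n.+1) j :
  dmap_ext X i (i :: s) j = 0.
Proof. by rewrite dmap_ext_degenerate ?chain_repeat_l. Qed.

Lemma dmap_ext_repeat_r n (X : diagram R n) i (s : seq 'I_n.+1) j :
  dmap_ext X i (rcons s j) j = 0.
Proof. by rewrite dmap_ext_degenerate ?chain_repeat_r //; case: s. Qed.

Lemma dmap_ext_repeat n (X : diagram R n) i (t : seq 'I_n.+1) x u j :
  dmap_ext X i (t ++ x :: x :: u) j = 0.
Proof. by rewrite dmap_ext_degenerate ?chain_repeat //; case: t. Qed.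

Lemma dident_refl n (A : 'I_n.+1 -> gmod R) i : dident A i i = @ud_id R (A i).
Proof. by rewrite /dident; case: eqP => // e; rewrite (eq_irrelevance e erefl). Qed.

Lemma dmap_ext_id n (X : diagram R n) i : dmap_ext X i [::] i = @ud_id R (dobj X i).
Proof. by rewrite /dmap_ext dep_if_false ?dident_refl // /chain /= ltnn. Qed.

Lemma dmap_at_pull m n (f : mono m n) (X : diagram R n) i s j : chain i s j ->
  dmap_at (diagram_pull f X) i s j = dmap_ext X (f i) (map f s) (f j).
Proof. by move=> c; rewrite /dmap_at (dep_if_true _ _ c) /= /dmap_ext; case: s c. Qed.

Lemma dg_equation_map m n (f : mono m n) (X : diagram R n) i s j :
  dg_equation (A := fun i => dobj X (f i)) (fun i => ddiff X (f i))
    (fun i s j => dmap_ext X (f i) (map f s) (f j)) i s j <->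
  dg_equation (ddiff X) (dmap_ext X) (f i) (map f s) (f j).
Proof.
rewrite /dg_equation size_map.
suff -> : \sum_(p < size s) isign p.+1 *:
      (dmap_ext X (f i) (map f (take p s ++ drop p.+1 s)) (f j)
       - ud_comp (size (drop p.+1 s))
           (dmap_ext X (f i) (map f (take p s)) (f (nth i s p)))
           (dmap_ext X (f (nth i s p)) (map f (drop p.+1 s)) (f j)))
  = \sum_(p < size s) isign p.+1 *:
      (dmap_ext X (f i) (take p (map f s) ++ drop p.+1 (map f s)) (f j)
       - ud_comp (size (drop p.+1 (map f s)))
           (dmap_ext X (f i) (take p (map f s)) (nth (f i) (map f s) p))
           (dmap_ext X (nth (f i) (map f s) p) (drop p.+1 (map f s)) (f j))) by [].
apply: eq_bigr => p _.
by rewrite map_cat !map_take !map_drop !size_drop size_map (nth_map i).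
Qed.

Lemma dg_equation_pull m n (f : mono m n) (X : diagram R n) i s j : chain i s j ->
  dg_equation (ddiff (diagram_pull f X)) (fun i s j => dmap_at (diagram_pull f X) i s j) i s j
  <-> dg_equation (ddiff X) (dmap_ext X) (f i) (map f s) (f j).
Proof.
move=> c; rewrite -dg_equation_map; split; apply: dg_equation_eq => // a t b tc.
  exact: dmap_at_pull.
by rewrite dmap_at_pull.
Qed.

Lemma ud_comp0l (A B C : gmod R) d (phi : ud_hom A B) :
  ud_comp d (0 : ud_hom B C) phi = 0.
Proof. exact: lin0 (ud_comp_linear_l d phi). Qed.

Lemma ud_comp0r (A B C : gmod R) d (psi : ud_hom B C) : ud_linear psi ->
  ud_comp d psi (0 : ud_hom A B) = 0.
Proof. by move=> psi_lin; apply: lin0 (ud_comp_linear_r d psi_lin). Qed.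

Section Degenerate.
Variables (n : nat) (X : diagram R n).
Hypothesis ddiff_degree : forall i, ud_degree (-1) (ddiff X i).
Hypothesis dmap_degree : forall i j s, chain i s j -> ud_degree (size s) (dmap_at X i s j).

Lemma dmap_ext_degree i s j : ud_degree (size s) (dmap_ext X i s j).
Proof.
have [c|nc] := boolP (chain i s j); first by rewrite dmap_ext_chain //; apply: dmap_degree.
case: s nc => [|x s] nc; last by rewrite dmap_ext_degenerate //; apply: ud_degree0.
rewrite /dmap_ext dep_if_false // /dident; case: eqP => [e|_]; last exact: ud_degree0.
by case: _ / e {nc}; apply: ud_id_degree.
Qed.

Lemma dmap_ext_linear i s j : ud_linear (dmap_ext X i s j).
Proof. exact: ud_degree_linear (dmap_ext_degree i s j). Qed.

(** For an edge from a vertex to itself, the identity commutes with the differential. At a repeated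
    end point, the face without it cancels against a composite with an identity. At a repeated inner
    vertex, deleting either copy gives the same face, with opposite signs. All other terms contain a
    repetition and vanish. *)
Lemma dg_equation_degenerate i s j :
  path (fun x y : 'I_n.+1 => (x <= y)%N) i (rcons s j) -> ~~ chain i s j ->
  dg_equation (ddiff X) (dmap_ext X) i s j.
Proof.
move=> w_c nc; rewrite /dg_equation.
have [s0|s_neq0] := eqVneq s [::].
  rewrite s0 big_ord0; case: (weak_chain_repeat w_c nc); rewrite s0.
  - move=> [_ <-]; rewrite dmap_ext_id (ud_comp1l (@ddiff_degree i)).
    by rewrite (ud_comp1r (@ddiff_degree i)) scale1r subrr.
  - by case.
  - by case=> -[].
  - by case=> -[|? ?] [x [u]].
rewrite [in LHS]dmap_ext_degenerate // ud_comp0l ud_comp0r; last first.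
  exact: ud_degree_linear (@ddiff_degree i).
rewrite scaler0 subrr; symmetry.
case: (weak_chain_repeat w_c nc) => [[s0]|[t sE]|[t sE]|[t [x [u sE]]]].
- by rewrite s0 in s_neq0.
- rewrite sE big_ord_recl /= drop0 dmap_ext_id (ud_comp1l (@dmap_ext_degree i t j)).
  rewrite subrr scaler0 add0r big1 // => p _.
  rewrite !dmap_ext_repeat_l.
  by rewrite ud_comp0l subrr scaler0.
- rewrite sE size_rcons big_ord_recr /= big1 ?add0r => [|p _].
    rewrite -cats1 take_size_cat // drop_oversize ?size_cat ?addn1 // cats0 nth_cat ltnn.
    rewrite subnn /= dmap_ext_id (ud_comp1r (@dmap_ext_degree i t j)).
    by rewrite subrr scaler0.
  have pt : (p.+1 <= size t)%N by [].
  rewrite drop_rcons // -rcons_cat !dmap_ext_repeat_r.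
  by rewrite ud_comp0r ?subrr ?scaler0 //; apply: dmap_ext_linear.
have st : (size t < size s)%N by rewrite sE size_cat /= addnS ltnS leq_addr.
have st' : ((size t).+1 < size s)%N by rewrite sE size_cat /= !addnS !ltnS leq_addr.
rewrite (bigD1 (Ordinal st)) // (bigD1 (Ordinal st')) /=; last first.
  by rewrite -val_eqE /= -{1}addn1 -[X in _ != X]addn0 eqn_add2l.
rewrite big1 ?addr0 => [|[p ps] /andP[]]; last first.
  rewrite -!val_eqE /= => pt pt'; have [p_lt|] := ltnP p (size t).
    have -> : drop p.+1 s = drop p.+1 t ++ x :: x :: u.
      rewrite sE drop_cat; case: ltnP => // tp.
      have -> : p.+1 = size t by apply/eqP; rewrite eqn_leq p_lt.
      by rewrite subnn drop_size.
    rewrite catA !dmap_ext_repeat ud_comp0r ?subrr ?scaler0 //.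
    exact: dmap_ext_linear.
  rewrite leq_eqVlt eq_sym (negPf pt) /= leq_eqVlt eq_sym (negPf pt') /= => p_gt.
  have -> : take p s = t ++ x :: x :: take (p - (size t).+2) u.
    set q := (p - (size t).+2)%N.
    have -> : p = (size t + q.+2)%N by rewrite !addnS -!addSn subnKC.
    by rewrite sE takeD take_size_cat // drop_size_cat.
  by rewrite -catA /= !dmap_ext_repeat ud_comp0l subrr scaler0.
have -> : take (size t) s = t by rewrite sE take_size_cat.
have -> : nth i s (size t) = x by rewrite sE nth_cat ltnn subnn.
have -> : nth i s (size t).+1 = x by rewrite sE nth_cat ltnNge leqnSn subSnn.
have sE' : s = rcons t x ++ x :: u by rewrite cat_rcons.
have -> : drop (size t).+1 s = x :: u by rewrite sE' drop_size_cat ?size_rcons.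
have -> : take (size t).+1 s = rcons t x by rewrite sE' take_size_cat ?size_rcons.
have -> : drop (size t).+2 s = u.
  by rewrite -[(size t).+2]add1n -drop_drop sE' drop_size_cat ?size_rcons //= drop0.
rewrite cat_rcons dmap_ext_repeat_l dmap_ext_repeat_r.
rewrite ud_comp0l ud_comp0r; last exact: dmap_ext_linear.
by rewrite !subr0 -scalerDl (isignS (size t).+1) subrr scale0r.
Qed.

End Degenerate.
End DgNerveEquation.

Arguments dmap_ext {R n} X i s j : rename.

Lemma chain_map_weak m n (f : mono m n) i s j : chain i s j ->
  path (fun x y : 'I_n.+1 => (x <= y)%N) (f i) (rcons (map f s) (f j)).
Proof.
rewrite -map_rcons path_map; apply: sub_path => x y xy.
exact/(monotoneP _ (monoP f))/ltnW.
Qed.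

Lemma PreBialg_pull (R : comPzRingType) : simplicial_subset (@PreBialg R).
Proof.
move=> m n f X [X_dd X_md X_aa X_eq]; split.
- by move=> i; apply: X_dd.
- move=> i j s c; rewrite (dmap_at_pull f X c) -(size_map f s).
  exact: (dmap_ext_degree X_md).
- by move=> i; apply: X_aa.
move=> i j s c; apply/dg_nerve_equationE/(dg_equation_pull f X c).
have [fc|nfc] := boolP (chain (f i) (map f s) (f j)).
  apply: (@dg_equation_eq _ _ _ _ (fun i s j => dmap_at X i s j)) => //.
    by move=> a t b tc; rewrite dmap_ext_chain.
  exact/dg_nerve_equationE/X_eq.
by apply: dg_equation_degenerate => //; apply: chain_map_weak.
Qed.

Lemma fBialg_pull (R : comPzRingType) : simplicial_subset (@fBialg R).
Proof.
move=> m n f X [X_pre X_rel X_mor]; split.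
- exact: PreBialg_pull.
- by move=> i; apply: X_rel.
move=> i j c; rewrite (dmap_at_pull f X c) /=.
have [fc|nfc] := boolP (chain (f i) [::] (f j)).
  by rewrite dmap_ext_chain //; apply: X_mor.
have /eqP fij : f i == f j.
  have := chain_map_weak f c; rewrite /= andbT leq_eqVlt => /orP[//|fc].
  by rewrite /chain /= fc in nfc.
rewrite -fij dmap_ext_id; exact: morphism_relations_id.
Qed.

(** * The Leibniz rule and the cocycle of right-hand sides *)

Section Leibniz.
Context {R : comPzRingType} (A B C : gmod R).
Variables (a : ud_hom A A) (b : ud_hom B B) (c : ud_hom C C).

Definition ud_diff (A B : gmod R) (a : ud_hom A A) (b : ud_hom B B) (d : int)
    (phi : ud_hom A B) : ud_hom A B :=
  ud_comp d b phi - isign d *: ud_comp (-1) phi a.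

Lemma ud_diff_linear (b_lin : ud_linear b) d : linear (ud_diff a b d).
Proof.
move=> r phi psi; rewrite /ud_diff (ud_comp_linear_r d b_lin) (ud_comp_linear_l (-1) a).
by rewrite !scalerDr [isign d *: (r *: _)]scaleC opprD addrACA -scalerN -scalerDr.
Qed.

(** By associativity the two terms in which [b] stands between [psi] and [phi] cancel. The right
    factor of the last composite has degree [d - 1]. *)
Lemma leibniz d e (psi : ud_hom B C) (phi : ud_hom A B) :
  ud_linear c -> ud_linear psi ->
  ud_diff a c (e + d) (ud_comp d psi phi)
  = ud_comp d (ud_diff b c e psi) phi + isign e *: ud_comp (d - 1) psi (ud_diff a b d phi).
Proof.
move=> c_lin psi_lin; rewrite /ud_diff.
rewrite (linB (ud_comp_linear_l d phi)) (linZ (ud_comp_linear_l d phi)).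
rewrite (linB (ud_comp_linear_r (d - 1) psi_lin)) (linZ (ud_comp_linear_r (d - 1) psi_lin)).
rewrite !ud_compA // [-1 + d]addrC scalerBr scalerA isignD.
by rewrite addrA subrK.
Qed.

End Leibniz.

(** Two inner vertices a < b are deleted in either order: once [p] is deleted, position [q] holds
    vertex q if q < p, and vertex q + 1 otherwise. *)
Lemma sum_triangle (V : nmodType) (F : nat -> nat -> V) m :
  \sum_(0 <= p < m) \sum_(0 <= q < m.-1) F p q
  = \sum_(0 <= b < m) \sum_(0 <= a < b) (F b a + F a b.-1).
Proof.
elim: m => [|[|m] IH]; first by rewrite !big_geq.
  by rewrite !big_nat1 big_geq // [RHS]big_geq.
rewrite big_nat_recr //= [RHS]big_nat_recr //= -IH big_split /= addrCA addrC.
congr (_ + _); rewrite -big_split /=; apply: eq_bigr => p _.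
by rewrite big_nat_recr.
Qed.

(** Position [q] in the part behind vertex p holds vertex p + q + 1. *)
Lemma sum_triangle_shift (V : nmodType) (F : nat -> nat -> V) m :
  \sum_(0 <= p < m) \sum_(0 <= q < m - p.+1) F p q
  = \sum_(0 <= b < m) \sum_(0 <= a < b) F a (b - a.+1)%N.
Proof.
elim: m => [|m IH]; first by rewrite !big_geq.
rewrite big_nat_recr //= subnn [X in _ + X]big_geq // addr0.
rewrite [RHS]big_nat_recr //= -IH -big_split /= [LHS]big_nat [RHS]big_nat.
by apply: eq_bigr => p /andP[_ pm]; rewrite subSn // big_nat_recr //.
Qed.

Section MissingFace.
Context {R : comPzRingType} (n : nat) (X : diagram R n).
Hypothesis ddiff_degree : forall i, ud_degree (-1) (ddiff X i).
Hypothesis dmap_degree : forall i j s, chain i s j -> ud_degree (size s) (dmap_at X i s j).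

Definition dg_term (i : 'I_n.+1) s j p : ud_hom (dobj X j) (dobj X i) :=
  dmap_at X i (take p s ++ drop p.+1 s) j
  - ud_comp (size (drop p.+1 s))
      (dmap_at X i (take p s) (nth i s p)) (dmap_at X (nth i s p) (drop p.+1 s) j).

Arguments dg_term : clear implicits.

Definition dg_rhs (i : 'I_n.+1) s j : ud_hom (dobj X j) (dobj X i) :=
  \sum_(p < size s) isign p.+1 *: dg_term i s j p.

Arguments dg_rhs : clear implicits.

Definition dmap_diff (i : 'I_n.+1) s j : ud_hom (dobj X j) (dobj X i) :=
  ud_diff (ddiff X j) (ddiff X i) (size s) (dmap_at X i s j).

Arguments dmap_diff : clear implicits.

Lemma dg_rhsE i s j : dg_rhs i s j = \sum_(0 <= p < size s) isign p.+1 *: dg_term i s j p.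
Proof. by rewrite big_mkord. Qed.

Lemma dg_term_cat (i : 'I_n.+1) u x w j : dg_term i (u ++ x :: w) j (size u) =
  dmap_at X i (u ++ w) j - ud_comp (size w) (dmap_at X i u x) (dmap_at X x w j).
Proof.
rewrite /dg_term take_size_cat // nth_cat ltnn subnn /=.
by rewrite -cat_rcons drop_size_cat ?size_rcons.
Qed.

Lemma cut_nth2 (T : Type) (s : seq T) a b : (a < b)%N -> (b < size s)%N ->
  exists u x v y w, [/\ s = u ++ x :: v ++ y :: w, a = size u & b = (size u + (size v).+1)%N].
Proof.
case: s => // z0 s; set t := z0 :: s => ab bs.
have as_ := ltn_trans ab bs.
exists (take a t), (nth z0 t a), (take (b - a.+1) (drop a.+1 t)), (nth z0 t b), (drop b.+1 t).
have szt : size (take a t) = a by rewrite size_takel // ltnW.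
have szv : size (take (b - a.+1) (drop a.+1 t)) = (b - a.+1)%N.
  by rewrite size_takel // size_drop leq_sub2r // ltnW.
split; rewrite ?szt ?szv //; last by rewrite addnS -addSn subnKC.
have -> : nth z0 t b :: drop b.+1 t = drop (b - a.+1) (drop a.+1 t).
  by rewrite drop_drop subnK // -drop_nth.
by rewrite cat_take_drop -drop_nth // cat_take_drop.
Qed.

(* By the Leibniz rule, this says that the right-hand side of the equation for sigma is
   annihilated by the differential as soon as the equations of the faces of sigma hold.
   The terms are collected by pairs a < b of inner vertices, and cancel for each pair. *)
Lemma dg_rhs_cocycle i s j : chain i s j ->
  \sum_(p < size s) isign p.+1 *:
    (dg_rhs i (take p s ++ drop p.+1 s) j
     - (ud_comp (size (drop p.+1 s)) (dg_rhs i (take p s) (nth i s p))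
          (dmap_at X (nth i s p) (drop p.+1 s) j)
        + isign p *: ud_comp ((size (drop p.+1 s))%:Z - 1) (dmap_at X i (take p s) (nth i s p))
            (dg_rhs (nth i s p) (drop p.+1 s) j))) = 0.
Proof.
move=> c.
(* [F1] comes from the faces, [F2] and [F3] from the left and right factors of the composites. *)
pose F1 p q := (isign p.+1 * isign q.+1 : R) *: dg_term i (take p s ++ drop p.+1 s) j q.
pose F2 p q := (isign p.+1 * isign q.+1 : R) *: ud_comp (size (drop p.+1 s))
  (dg_term i (take p s) (nth i s p) q) (dmap_at X (nth i s p) (drop p.+1 s) j).
pose F3 p q := (isign p.+1 * isign p * isign q.+1 : R) *:
  ud_comp ((size (drop p.+1 s))%:Z - 1) (dmap_at X i (take p s) (nth i s p))
    (dg_term (nth i s p) (drop p.+1 s) j q).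
transitivity (\sum_(0 <= p < size s) (\sum_(0 <= q < (size s).-1) F1 p q
   - (\sum_(0 <= q < p) F2 p q + \sum_(0 <= q < size s - p.+1) F3 p q))).
  rewrite big_mkord; apply: eq_bigr => p _; have ps := ltn_ord p.
  have [_ c2 _] := chain_face ps c.
  have P_lin := ud_degree_linear (dmap_degree c2).
  rewrite scalerBr scalerDr; congr (_ - (_ + _)).
  - rewrite dg_rhsE scaler_sumr size_cat size_takel ?(ltnW ps) // size_drop.
    have -> : (p + (size s - p.+1) = (size s).-1)%N by rewrite -[in RHS](subnKC ps).
    by apply: eq_bigr => q _; rewrite scalerA.
  - rewrite dg_rhsE (lin_sum (ud_comp_linear_l _ _)) scaler_sumr size_takel ?(ltnW ps) //.
    by apply: eq_bigr => q _; rewrite (linZ (ud_comp_linear_l _ _)) scalerA.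
  rewrite dg_rhsE (lin_sum (ud_comp_linear_r _ P_lin)) !scaler_sumr size_drop.
  by apply: eq_bigr => q _; rewrite (linZ (ud_comp_linear_r _ P_lin)) !scalerA /F3 size_drop.
rewrite sumrB big_split /= sum_triangle sum_triangle_shift -big_split -sumrB /=.
rewrite big_nat big1 // => b /andP[_ bs]; rewrite -big_split -sumrB /=.
rewrite big_nat big1 // => a /andP[_ ab].
(* What remains for a pair consists of the map of u, v, w together, the composites that stop at x,
   at y, and at both; each occurs twice, with opposite signs that reduce to plus or minus
   [isign (size v)]. *)
have [u [x [v [y [w [sE aE bE]]]]]] := cut_nth2 ab bs.
have ca : chain i u x by move: c; rewrite sE chain_cat => /andP[].
have P_lin := ud_degree_linear (dmap_degree ca).
have b1 : b.-1 = size (u ++ v) by rewrite bE addnS size_cat.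
have ba : (b - a.+1 = size v)%N by rewrite aE bE -addSnnS addKn.
have sE' : s = (u ++ x :: v) ++ y :: w by rewrite sE -catA.
have bE' : b = size (u ++ x :: v) by rewrite size_cat.
have tb : take b s = u ++ x :: v by rewrite sE' bE' take_size_cat.
have nb : nth i s b = y by rewrite sE' bE' nth_cat ltnn subnn.
have db : drop b.+1 s = w by rewrite sE' bE' -(cat_rcons y) drop_size_cat ?size_rcons.
have ta : take a s = u by rewrite sE aE take_size_cat.
have na : nth i s a = x by rewrite sE aE nth_cat ltnn subnn.
have da : drop a.+1 s = v ++ y :: w by rewrite sE aE -(cat_rcons x) drop_size_cat ?size_rcons.
rewrite /F1 /F2 /F3 ba b1 tb nb db ta na da !catA aE !dg_term_cat.
rewrite -(catA u (x :: v)) cat_cons dg_term_cat (catA u v w).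
rewrite (linB (ud_comp_linear_l _ _)) (linB (ud_comp_linear_r _ P_lin)) ud_compA //.
have -> : (size (v ++ y :: w))%:Z - 1 = (size v)%:Z + (size w)%:Z.
  by rewrite size_cat /=; lia.
rewrite [(size (v ++ w))%:Z](_ : _ = (size v)%:Z + (size w)%:Z) ?size_cat //.
have sgn : isign (size u) * isign (size u) = 1 :> R := isign_sqr (size u).
have -> : isign b.+1 * isign (size u).+1 = - isign (size v) :> R.
  by rewrite bE !isignS PoszD isignD isignS; ring: sgn.
have -> : isign (size u).+1 * isign (size u + size v).+1 = isign (size v) :> R.
  by rewrite !isignS PoszD isignD; ring: sgn.
have -> : isign (size u).+1 * isign (size u) * isign (size v).+1 = isign (size v) :> R.
  by rewrite !isignS; ring: sgn.
rewrite !scaleNr -!scalerN -!scalerDr -scalerBr !opprB -[RHS](scaler0 _ (isign (size v))).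
congr (_ *: _); rewrite addrA subrK [X in _ - X]addrC.
by rewrite [X in _ - X]addrA subrK subrr.
Qed.

(** Applying the differential to the vanishing [dg_rhs i s j] and subtracting the cocycle identity
    leaves, by the Leibniz rule, the signed sum of the defects of the equations of the faces. All
    but the [k]-th are 0 by hypothesis. *)
Lemma missing_face i s j (k : 'I_(size s)) : chain i s j ->
  (forall p : 'I_(size s), p != k ->
     dmap_diff i (take p s ++ drop p.+1 s) j = dg_rhs i (take p s ++ drop p.+1 s) j) ->
  (forall p : 'I_(size s), dmap_diff i (take p s) (nth i s p) = dg_rhs i (take p s) (nth i s p)) ->
  (forall p : 'I_(size s),
     dmap_diff (nth i s p) (drop p.+1 s) j = dg_rhs (nth i s p) (drop p.+1 s) j) ->
  dg_rhs i s j = 0 ->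
  dmap_diff i (take k s ++ drop k.+1 s) j = dg_rhs i (take k s ++ drop k.+1 s) j.
Proof.
move=> c eq_del eq_take eq_drop rhs0.
have D_lin := ud_diff_linear (ddiff X j) (ud_degree_linear (ddiff_degree i)) ((size s)%:Z - 1).
have diffE (p : 'I_(size s)) :
    ud_diff (ddiff X j) (ddiff X i) ((size s)%:Z - 1) (isign p.+1 *: dg_term i s j p)
    - isign p.+1 *: (dg_rhs i (take p s ++ drop p.+1 s) j
     - (ud_comp (size (drop p.+1 s)) (dg_rhs i (take p s) (nth i s p))
          (dmap_at X (nth i s p) (drop p.+1 s) j)
        + isign p *: ud_comp ((size (drop p.+1 s))%:Z - 1) (dmap_at X i (take p s) (nth i s p))
            (dg_rhs (nth i s p) (drop p.+1 s) j)))
    = isign p.+1 *: (dmap_diff i (take p s ++ drop p.+1 s) j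
        - dg_rhs i (take p s ++ drop p.+1 s) j).
  have ps := ltn_ord p; have [_ c2 _] := chain_face ps c.
  rewrite (linZ D_lin) -scalerBr (linB D_lin) -eq_take -eq_drop; congr (_ *: _).
  have sz1 : (size s)%:Z - 1 = (size (take p s))%:Z + (size (drop p.+1 s))%:Z.
    by rewrite size_takel ?(ltnW ps) // size_drop; lia.
  have sz2 : (size s)%:Z - 1 = (size (take p s ++ drop p.+1 s))%:Z.
    by rewrite sz1 size_cat.
  (* The same degree is needed in two forms: as the size of the face and as the sum of the degrees
     of the two factors. *)
  rewrite {1}sz2 sz1 (@leibniz _ _ _ _ _ (ddiff X (nth i s p))); last 2 first.
  - exact: ud_degree_linear (ddiff_degree i).
  - exact: ud_degree_linear (dmap_degree c2).
  rewrite -!/(dmap_diff _ _ _) size_takel ?(ltnW ps) //.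
  by rewrite opprB addrA subrK.
have E := congr1 (ud_diff (ddiff X j) (ddiff X i) ((size s)%:Z - 1)) rhs0.
rewrite (lin0 D_lin) (lin_sum D_lin) in E.
have {E} := congr2 (fun x y => x - y) E (dg_rhs_cocycle c).
rewrite subr0 -sumrB (bigD1 k) //= big1 ?addr0 => [|p pk]; last first.
  by rewrite diffE eq_del // subrr scaler0.
rewrite diffE => /(congr1 (fun x => isign k.+1 *: x)).
by rewrite scalerA isign_sqr scale1r scaler0 => /eqP; rewrite subr_eq0 => /eqP.
Qed.

End MissingFace.

Arguments dg_term {R n} X i s j p : rename.
Arguments dg_rhs {R n} X i s j : rename.
Arguments dmap_diff {R n} X i s j : rename.

(** * Fillers of inner horns *)

Lemma existT_inj (T : Type) (F : T -> Type) t (a b : F t) :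
  existT F t a = existT F t b -> a = b.
Proof.
move=> E; have := projT2_eq E; rewrite (Prop_irrelevance (projT1_eq E) erefl).
exact.
Qed.

(** Turns an equation of diagrams over the same objects and differentials into one of maps, the form
    in which the naturality of a horn is used. *)
Lemma Diagram_inj (R : comPzRingType) n (A : 'I_n.+1 -> gmod R) alpha
    (phi psi : forall i j (s : seq 'I_n.+1), chain i s j -> ud_hom (A j) (A i)) :
  Diagram alpha phi = Diagram alpha psi -> phi = psi.
Proof.
move=> E.
pose T := {A : 'I_n.+1 -> gmod R & forall i, ud_hom (A i) (A i)}.
pose F (t : T) := forall i j (s : seq 'I_n.+1), chain i s j ->
  ud_hom (projT1 t j) (projT1 t i).
pose pack (X : diagram R n) := existT F (existT _ (dobj X) (ddiff X)) (@dmap R n X).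
exact: existT_inj (congr1 pack E).
Qed.

(** Transports a diagram to objects and differentials to which its own are only provably equal. *)
Lemma diagram_refine (R : comPzRingType) n (X : diagram R n)
    (B : 'I_n.+1 -> {A : gmod R & ud_hom A A}) :
  (forall i, existT (fun A => ud_hom A A) (dobj X i) (ddiff X i) = B i) ->
  exists phi, X = Diagram (fun i => projT2 (B i)) phi.
Proof.
move=> /funext <-; case: X => A alpha phi; by exists phi.
Qed.

(* The inner vertices of the standard (p + 1)-simplex *)
Definition inner (p : nat) : seq 'I_p.+2 := [seq inord q.+1 | q <- iota 0 p].

Lemma size_inner p : size (inner p) = p.
Proof. by rewrite size_map size_iota. Qed.

Lemma vertices_nth p (q : 'I_p.+2) :
  nth ord0 (ord0 :: rcons (inner p) ord_max) q = q.
Proof.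
case: q => -[|q] q_lt; first exact: val_inj.
rewrite /= nth_rcons size_inner; case: ltnP => qp.
  by rewrite (nth_map 0%N) ?size_iota // nth_iota //; apply: val_inj; rewrite /= inordK.
have qE : q = p by apply/eqP; rewrite eqn_leq qp -ltnS -ltnS q_lt.
by case: eqP => // _; apply: val_inj; rewrite /= qE.
Qed.

Lemma map_inner (T : eqType) p (f : 'I_p.+2 -> T) (s : seq T) i j : size s = p ->
  (forall q : 'I_p.+2, f q = nth i (i :: rcons s j) q) ->
  [/\ f ord0 = i, map f (inner p) = s & f ord_max = j].
Proof.
move=> sp fE; split; first by rewrite fE.
  apply: (@eq_from_nth _ i); rewrite size_map size_inner // => q qp.
  rewrite (nth_map ord0) ?size_inner // fE.
  have q2 : (q.+1 < p.+2)%N by rewrite !ltnS ltnW.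
  have := vertices_nth (Ordinal q2); rewrite /= nth_rcons size_inner qp => ->.
  by rewrite /= nth_rcons sp qp.
by rewrite fE /= nth_rcons sp ltnn eqxx.
Qed.

Lemma chain_ltn n (i : 'I_n.+1) s j a b : chain i s j ->
  (a < b)%N -> (b < (size s).+2)%N ->
  (nth i (i :: rcons s j) a < nth i (i :: rcons s j) b)%N.
Proof.
move=> c ab bs; have := @sorted_ltn_nth _ (fun x y : 'I_n.+1 => (x < y)%N)
  (@ord_lt_trans n) i (i :: rcons s j) c a b.
by rewrite !inE /= size_rcons; apply=> //; apply: ltn_trans bs.
Qed.

(** Supplies the standard presentation of a chain, with which all others are compared. *)
Lemma simplex_inclusion n (i : 'I_n.+1) s j p : chain i s j -> size s = p ->
  exists T : mono p.+1 n, [/\ T ord0 = i, map T (inner p) = s, T ord_max = j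
    & forall q, T q = nth i (i :: rcons s j) q].
Proof.
move=> c sp; pose f (q : 'I_p.+2) := nth i (i :: rcons s j) q.
have f_mono : monotone f.
  apply/monotoneP => q r; rewrite leq_eqVlt => /orP[/eqP qr|qr].
    by rewrite (val_inj qr).
  by apply/ltnW/chain_ltn; rewrite // sp ltn_ord.
by exists (Mono f_mono); have [] := @map_inner _ p f s i j sp (fun=> erefl).
Qed.

Lemma inner_chain p : chain ord0 (inner p) ord_max.
Proof.
have sz : size (ord0 :: rcons (inner p) ord_max) = p.+2 by rewrite /= size_rcons size_inner.
apply/(pathP ord0) => q; rewrite size_rcons size_inner => qp.
have q1 : (q < p.+2)%N by apply: ltnW.
have -> : nth ord0 (ord0 :: rcons (inner p) ord_max) q = Ordinal q1 := vertices_nth (Ordinal q1).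
have -> : nth ord0 (rcons (inner p) ord_max) q = Ordinal (qp : q.+1 < p.+2)%N.
  exact: vertices_nth (Ordinal (qp : q.+1 < p.+2)%N).
by [].
Qed.

Lemma no_long_chain p (i : 'I_p.+1) s j : size s = p -> ~~ chain i s j.
Proof.
move=> sp; apply/negP => c.
have : uniq (i :: rcons s j).
  have irr : irreflexive (fun x y : 'I_p.+1 => (x < y)%N) by move=> x; apply: ltnn.
  exact: (sorted_uniq (@ord_lt_trans p) irr (s := i :: rcons s j) c).
move=> /card_uniqP L; have := max_card [in i :: rcons s j].
by rewrite L /= size_rcons sp card_ord ltnn.
Qed.

(** Some neighbours [q] and [q.+1] have the same image; [e] collapses them and [d] skips [q.+1], so
    [d] after [e] moves only a vertex whose image under [z] is unchanged. The point of [e] is that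
    its target is too small for a chain of this length. *)
Lemma mono_factor n p (z : mono p.+1 n) (i : 'I_n.+1) s j : size s = p ->
  (forall q, z q = nth i (i :: rcons s j) q) -> ~~ chain i s j ->
  exists (e : mono p.+1 p) (d : mono p p.+1), z = mono_comp z (mono_comp d e).
Proof.
move=> sp zE nc.
have [q [q_lt _ zq]] : exists q, exists2 q_lt : (q < p.+1)%N,
    True & z (inord q) = z (inord q.+1).
  apply: contrapT => none; case/negP: nc; apply/(pathP i) => q.
  rewrite size_rcons sp => q_lt; rewrite ltnNge; apply/negP => le.
  apply: none; exists q; exists (q_lt) => //; apply/val_inj/eqP; rewrite eqn_leq.
  rewrite (monotoneP _ (monoP z)) ?inordK //=; last by apply: ltnW.
  by rewrite !zE !inordK //; apply: ltnW.
pose e0 (r : 'I_p.+2) : 'I_p.+1 := inord (if (r <= q)%N then r : nat else r.-1).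
pose d0 (r : 'I_p.+1) : 'I_p.+2 := inord (if (r <= q)%N then r : nat else r.+1).
have eE r : e0 r = (if (r <= q)%N then r : nat else r.-1) :> nat.
  by rewrite inordK //; have := ltn_ord r; case: ifP => //; lia.
have dE r : d0 r = (if (r <= q)%N then r : nat else r.+1) :> nat.
  by rewrite inordK //; have := ltn_ord r; case: ifP => //; lia.
have e_mono : monotone e0.
  by apply/monotoneP => r t rt; rewrite !eE; do 2 case: ifP; lia.
have d_mono : monotone d0.
  by apply/monotoneP => r t rt; rewrite !dE; do 2 case: ifP; lia.
exists (Mono e_mono), (Mono d_mono); apply: mono_eq => r /=.
have [rq|rq] := eqVneq (r : nat) q.+1.
  have -> : d0 (e0 r) = inord q.
    by apply: val_inj; rewrite /= dE eE rq ltnn /= leqnn inordK // ltnW.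
  rewrite zq; congr (z _); apply: val_inj.
  by rewrite /= inordK // -rq ltn_ord.
by congr (z _); apply: val_inj; rewrite /= dE eE; do 2 case: ifP; lia.
Qed.

(** * The maps of a horn over fixed objects *)

Section HornData.
Context {R : comPzRingType} (n' : nat).
Local Notation n := n'.+1.
Variable k : 'I_n.+1.
Hypothesis k_inner : (0 < k < n)%N.
Variable h : sset_map (horn k) (sub_sset (@fBialg_pull R)).

Definition horn_diagram m (x : mono m n) (hx : in_horn k x) : diagram R m :=
  sval (h m (exist (@in_horn n k m) x hx : horn k m)).

Lemma horn_diagram_fBialg m (x : mono m n) (hx : in_horn k x) :
  fBialg (horn_diagram hx).
Proof. exact: svalP (h m (exist (@in_horn n k m) x hx : horn k m)). Qed.

Lemma horn_diagram_pull m p (x : mono p n) (f : mono m p) (hx : in_horn k x)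
    (hxf : in_horn k (mono_comp x f)) :
  horn_diagram hxf = diagram_pull f (horn_diagram hx).
Proof.
rewrite /horn_diagram.
have <- : pull f (exist (@in_horn n k p) x hx : horn k p)
    = (exist (@in_horn n k m) (mono_comp x f) hxf : horn k m).
  exact: sub_simplex_eq.
by rewrite sset_natural.
Qed.

Lemma vertex_mono m (i : 'I_m.+1) : monotone (fun _ : 'I_1 => i).
Proof. exact/monotoneP. Qed.

Definition vertex m (i : 'I_m.+1) : mono 0 m := Mono (vertex_mono i).

(** Since [k] is inner, 0 and n both differ from it, and a single vertex misses at least one of
    them. *)
Lemma vertex_in_horn (i : 'I_n.+1) : in_horn k (vertex i : std_simplex n 0).
Proof.
have [i0|i0] := eqVneq i ord0.
  exists ord_max => [|q]; first by rewrite -val_eqE /=; lia.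
  by rewrite /= i0 -val_eqE /=; lia.
by exists ord0 => [|q //]; rewrite -val_eqE /=; lia.
Qed.

Definition horn_obj (i : 'I_n.+1) : {A : gmod R & ud_hom A A} :=
  existT (fun A => ud_hom A A) (dobj (horn_diagram (vertex_in_horn i)) ord0)
    (ddiff (horn_diagram (vertex_in_horn i)) ord0).

Local Notation A i := (projT1 (horn_obj i)).
Local Notation alpha i := (projT2 (horn_obj i)).

Lemma horn_objE m (x : mono m n) (hx : in_horn k x) i :
  existT (fun A => ud_hom A A) (dobj (horn_diagram hx) i) (ddiff (horn_diagram hx) i)
  = horn_obj (x i).
Proof.
have E : mono_comp x (vertex i) = vertex (x i) by apply: mono_eq.
have hxi : in_horn k (mono_comp x (vertex i)) by rewrite E; apply: vertex_in_horn.
rewrite /horn_obj; move: (vertex_in_horn _); rewrite -E => hv.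
by rewrite (horn_diagram_pull (f := vertex i) hx).
Qed.

(** Over the common objects [A], the maps of different simplices of the horn have comparable types.
    Off the horn the value 0 is taken. *)
Lemma horn_phi_ex : exists Phi : forall m (x : mono m n) i j (s : seq 'I_m.+1),
    chain i s j -> ud_hom (A (x j)) (A (x i)),
  forall m (x : mono m n) (hx : in_horn k x),
  horn_diagram hx = Diagram (fun i => alpha (x i)) (@Phi m x).
Proof.
have Phi1 m (x : mono m n) : exists Phi : forall i j (s : seq 'I_m.+1),
    chain i s j -> ud_hom (A (x j)) (A (x i)), forall hx : in_horn k x,
    horn_diagram hx = Diagram (fun i => alpha (x i)) Phi.
  have [hx|nhx] := pselect (in_horn k x); last by exists (fun i j s c => 0) => hx.
  have [Phi E] := diagram_refine (horn_objE hx); exists Phi => hx'.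
  by rewrite (Prop_irrelevance hx' hx).
exists (fun m x => sval (cid (Phi1 m x))) => m x hx.
by case: cid => Phi /= ->.
Qed.

Definition horn_phi := sval (cid horn_phi_ex).

Arguments horn_phi {m} x {i j s} c.

Lemma horn_phiE m (x : mono m n) (hx : in_horn k x) :
  horn_diagram hx = Diagram (fun i => alpha (x i)) (fun i j s c => horn_phi x c).
Proof. exact: (svalP (cid horn_phi_ex)). Qed.

Lemma horn_comp m p (x : mono p n) (f : mono m p) :
  in_horn k x -> in_horn k (mono_comp x f).
Proof. by case=> v vk xv; exists v => // i; apply: xv. Qed.

Lemma horn_phi_pull m p (x : mono p n) (f : mono m p) (hx : in_horn k x) i j s
    (c : chain i s j) :
  horn_phi (mono_comp x f) c =
  dep_if (fun c' : chain (f i) (map f s) (f j) => horn_phi x c')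
    (if s is [::] then dident (fun i => A (x i)) (f i) (f j) else @ud_zero R _ _).
Proof.
have hxf := horn_comp f hx.
have := horn_diagram_pull hx hxf; rewrite !horn_phiE => /Diagram_inj.
by move=> /(congr1 (fun Phi => Phi i j s c)).
Qed.

(* The maps of the horn are collected in this type because the map of a simplex
   sigma is read off from faces in which its end points are only propositionally
   those of sigma. *)
Definition any_hom := {ij : 'I_n.+1 * 'I_n.+1 & ud_hom (A ij.2) (A ij.1)}.

Definition some_hom i j (phi : ud_hom (A j) (A i)) : any_hom :=
  existT (fun ij => ud_hom (A ij.2) (A ij.1)) (i, j) phi.

Definition hom_at (z : any_hom) i j : ud_hom (A j) (A i) :=
  match projT1 z =P (i, j) with
  | ReflectT e => eq_rect _ (fun ij => ud_hom (A ij.2) (A ij.1)) (projT2 z) _ e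
  | ReflectF _ => 0
  end.

Arguments hom_at z i j : clear implicits.

Lemma some_homK i j (phi : ud_hom (A j) (A i)) : hom_at (some_hom phi) i j = phi.
Proof.
rewrite /hom_at; case: eqP => // e.
by rewrite (eq_irrelevance e erefl).
Qed.

Definition horn_val m (x : mono m n) i s j (c : chain i s j) : any_hom :=
  some_hom (horn_phi x c).

Arguments horn_val {m} x {i s j} c.

Lemma horn_val_eq m (x : mono m n) i s j i' s' j' (c : chain i s j) (c' : chain i' s' j') :
  i = i' -> s = s' -> j = j' -> horn_val x c = horn_val x c'.
Proof.
move=> ii ss jj; case: i' / ii c'; case: s' / ss; case: j' / jj => c'.
by rewrite (bool_irrelevance c c').
Qed.

Lemma horn_val_comp m p (x : mono p n) (f : mono m p) i s j (c : chain i s j)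
    (c' : chain (f i) (map f s) (f j)) :
  in_horn k x -> horn_val (mono_comp x f) c = horn_val x c'.
Proof.
move=> hx; rewrite /horn_val (horn_phi_pull f hx c) (dep_if_true _ _ c').
by [].
Qed.

Definition presents m (x : mono m n) i s j a t b :=
  [/\ in_horn k x, x i = a, map x s = t & x j = b].

(** Restricted to the simplex with vertices a, t, b, both presentations become the same simplex of
    the horn, and naturality relates its map to either value. *)
Lemma horn_val_unique m (x : mono m n) i s j (c : chain i s j)
    m' (x' : mono m' n) i' s' j' (c' : chain i' s' j') a t b :
  presents x i s j a t b -> presents x' i' s' j' a t b ->
  horn_val x c = horn_val x' c'.
Proof.
move=> [hx xi xs xj] [hx' xi' xs' xj'].
have st : size s = size t by rewrite -xs size_map.
have st' : size s' = size t by rewrite -xs' size_map.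
have [T [T0 Ts Tm Tq]] := simplex_inclusion c st.
have [T' [T0' Ts' Tm' Tq']] := simplex_inclusion c' st'.
have E : mono_comp x T = mono_comp x' T'.
  apply: mono_eq => q /=; rewrite Tq Tq'.
  rewrite -(nth_map i (x i) x) /= ?size_rcons ?st // -(nth_map i' (x' i') x') /= ?size_rcons ?st' //.
  by rewrite !map_rcons xi xs xj xi' xs' xj'.
have cT : chain (T ord0) (map T (inner (size t))) (T ord_max) by rewrite T0 Ts Tm.
have cT' : chain (T' ord0) (map T' (inner (size t))) (T' ord_max) by rewrite T0' Ts' Tm'.
transitivity (horn_val x cT); first by apply: horn_val_eq.
transitivity (horn_val x' cT'); last by apply: horn_val_eq.
rewrite -(horn_val_comp (inner_chain (size t)) cT hx).
by rewrite -(horn_val_comp (inner_chain (size t)) cT' hx') E.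
Qed.

Definition presented a t b (z : any_hom) :=
  exists m (x : mono m n) i s j (c : chain i s j),
    presents x i s j a t b /\ z = horn_val x c.

(** Chains that no simplex of the horn presents get 0, which is the value wanted on the top
    simplex. *)
Definition horn_hom a (t : seq 'I_n.+1) b : any_hom :=
  if pselect (exists z, presented a t b z) is left e then sval (cid e)
  else some_hom (0 : ud_hom (A b) (A a)).

Arguments horn_hom a t b : clear implicits.

Lemma horn_homE m (x : mono m n) i s j (c : chain i s j) : in_horn k x ->
  horn_hom (x i) (map x s) (x j) = horn_val x c.
Proof.
move=> hx; have P : presents x i s j (x i) (map x s) (x j) by [].
rewrite /horn_hom; case: pselect => [e|[]]; last first.
  by exists (horn_val x c), m, x, i, s, j, c.
case: cid => z /= [m' [x' [i' [s' [j' [c' [P' ->]]]]]]].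
exact: horn_val_unique P' P.
Qed.

(** The simplex factors through a map [e] that collapses two vertices, so naturality of the horn
    along [e] forces the value: an identity on an edge, 0 in higher dimensions. *)
Lemma horn_phi_degenerate m (x : mono m n) i s j (c : chain i s j) :
  in_horn k x -> ~~ chain (x i) (map x s) (x j) ->
  horn_phi x c = (if s is [::] then dident (fun i => A i) (x i) (x j) else @ud_zero R _ _).
Proof.
move=> hx nc; have [T [T0 Ts Tm Tq]] := simplex_inclusion c (erefl (size s)).
have zE q : mono_comp x T q = nth (x i) (x i :: rcons (map x s) (x j)) q.
  by rewrite /= Tq -(nth_map i (x i) x) /= ?size_rcons // map_rcons.
have [e [d E]] := mono_factor (etrans (size_map x s) erefl) zE nc.
have cT : chain (T ord0) (map T (inner (size s))) (T ord_max) by rewrite T0 Ts Tm.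
suff : horn_val x c = some_hom
    (if s is [::] then dident (fun i => A i) (x i) (x j) else @ud_zero R _ _).
  by move=> V; apply: existT_inj V.
have -> : horn_val x c = horn_val x cT by apply: horn_val_eq.
rewrite -(horn_val_comp (inner_chain (size s)) cT hx) E.
have -> : mono_comp (mono_comp x T) (mono_comp d e) = mono_comp (mono_comp (mono_comp x T) d) e.
  exact: mono_eq.
set y := mono_comp (mono_comp x T) d.
have hy : in_horn k y by do 2 apply: horn_comp.
have nce : ~~ chain (e ord0) (map e (inner (size s))) (e ord_max).
  by apply: no_long_chain; rewrite size_map size_inner.
have y0 : y (e ord0) = x i by rewrite -T0 -[RHS]/(mono_comp x T ord0) E.
have ym : y (e ord_max) = x j by rewrite -Tm -[RHS]/(mono_comp x T ord_max) E.
rewrite /horn_val (horn_phi_pull e hy (inner_chain (size s))) dep_if_false //.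
(* The dimension [size s] occurs in the type of [y]; it can be generalised only once the
   construction of [y] is forgotten. *)
clearbody y.
pose F p (a b : 'I_n.+1) := some_hom (if p is 0%N then dident (fun i => A i) a b
  else @ud_zero R (A b) (A a)).
transitivity (F (size s) (x i) (x j)); last by rewrite /F; case: (s).
rewrite -y0 -ym; move: (size s) y e {T T0 Ts Tm Tq zE E d cT hy y0 ym nce} => p y e.
case: p y e => [|p] y e //=; rewrite /F.
rewrite -(@dident_comp R _ _ y (fun i => A i)) //.
(* For an edge, [e] has values in the one-point ordinal, so both end points coincide. *)
by apply: val_inj; move: (e ord0) (e ord_max) => [[|?] ?] [[|?] ?].
Qed.

Definition misses a (t : seq 'I_n.+1) b := exists2 v, v != k & v \notin a :: rcons t b.

Lemma misses_presents a t b : chain a t b -> misses a t b ->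
  exists T : mono (size t).+1 n, presents T ord0 (inner (size t)) ord_max a t b.
Proof.
move=> c [v vk vt]; have [T [T0 Ts Tm Tq]] := simplex_inclusion c (erefl (size t)).
exists T; split=> //; exists v => // q; apply: contra vt => /eqP <-.
by rewrite Tq mem_nth //= size_rcons.
Qed.

Lemma presents_misses m (x : mono m n) i s j a t b :
  presents x i s j a t b -> misses a t b.
Proof.
move=> [[v vk xv] <- <- <-]; exists v => //.
apply/negP; rewrite -map_rcons -map_cons => /mapP[q _ vq].
by have := xv q; rewrite vq eqxx.
Qed.

(** * Construction of the filler *)

Let I := inner n'.
(** The list [I] starts with vertex 1, so [k] is found at position k - 1. *)
Let ki : nat := k.-1.
Let del := take ki I ++ drop ki.+1 I.

Lemma ki_lt : (ki < size I)%N.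
Proof. by rewrite size_inner /ki; case: (k : nat) k_inner => //= q; lia. Qed.

Lemma nth_ki : nth ord0 I ki = k.
Proof.
have := vertices_nth k; rewrite -[in X in X -> _](@prednK k) /=; last by case/andP: k_inner.
by rewrite nth_rcons -/I ki_lt.
Qed.

Lemma inner_cut : I = take ki I ++ k :: drop ki.+1 I.
Proof. by rewrite -[in RHS]nth_ki -cut_nth // ki_lt. Qed.

Lemma mem_vertices (v : 'I_n.+1) : v \in ord0 :: rcons I ord_max.
Proof. by rewrite -[X in X \in _](vertices_nth v) mem_nth //= size_rcons size_inner. Qed.

Lemma misses_top : ~ misses ord0 I ord_max.
Proof. by case=> v _; rewrite mem_vertices. Qed.

Lemma mem_missing (v : 'I_n.+1) : v != k -> v \in ord0 :: rcons del ord_max.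
Proof.
move=> vk; have := mem_vertices v; rewrite {1}inner_cut !rcons_cat !inE !mem_cat inE.
by rewrite (negPf vk).
Qed.

Lemma misses_missing : ~ misses ord0 del ord_max.
Proof. by case=> v /mem_missing ->. Qed.

Lemma chain_top : chain ord0 I ord_max. Proof. exact: inner_chain. Qed.

Lemma chain_missing : chain ord0 del ord_max.
Proof. by have [] := chain_face ki_lt chain_top. Qed.

Lemma sorted_vertices_uniq : uniq (ord0 :: rcons I ord_max).
Proof.
have irr : irreflexive (fun x y : 'I_n.+1 => (x < y)%N) by move=> x; apply: ltnn.
exact: (sorted_uniq (@ord_lt_trans n) irr (s := ord0 :: rcons I ord_max) chain_top).
Qed.

(** A strict chain is determined by its set of vertices, and here this set contains every vertex
    except possibly [k]. *)
Lemma chain_no_miss a t b : chain a t b -> ~ misses a t b ->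
  (a, t, b) = (ord0, I, ord_max) \/ (a, t, b) = (ord0, del, ord_max).
Proof.
move=> c nm; have irr : irreflexive (fun x y : 'I_n.+1 => (x < y)%N) by move=> x; apply: ltnn.
have eq_sorted t' : chain ord0 t' ord_max ->
    a :: rcons t b =i ord0 :: rcons t' ord_max -> (a, t, b) = (ord0, t', ord_max).
  move=> c' /(@irr_sorted_eq _ _ (@ord_lt_trans n) irr (a :: rcons t b)
    (ord0 :: rcons t' ord_max) c c') [-> /rcons_inj[-> ->]].
  by [].
have all_in v : v != k -> v \in a :: rcons t b.
  by move=> vk; apply: contrapT => /negP nv; apply: nm; exists v.
have [kin|knin] := boolP (k \in a :: rcons t b); [left|right]; apply: eq_sorted.
- exact: chain_top.
- move=> v; rewrite mem_vertices; have [->//|] := eqVneq v k; exact: all_in.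
- exact: chain_missing.
move=> v; have [->|vk] := eqVneq v k; last by rewrite all_in ?mem_missing.
rewrite (negPf knin); symmetry; apply/negbTE.
have := sorted_vertices_uniq; rewrite inner_cut rcons_cat rcons_cons -cat_cons.
rewrite cat_uniq /= negb_or => /and3P[_ /andP[k1 _] /andP[k2 _]].
move: k1; rewrite !inE rcons_cat mem_cat (negPf k2) orbF negb_or => /andP[-> k1].
by rewrite (negPf k1).
Qed.

Definition homs_diagram (G : 'I_n.+1 -> seq 'I_n.+1 -> 'I_n.+1 -> any_hom) : diagram R n :=
  Diagram (fun i => alpha i) (fun i j s (_ : chain i s j) => hom_at (G i s j) i j).

Lemma homs_diagramE G a t b : chain a t b ->
  dmap_at (homs_diagram G) a t b = hom_at (G a t b) a b.
Proof. by move=> c; rewrite /dmap_at (dep_if_true _ _ c). Qed.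

(** The data of the horn alone, from which the missing map is defined before the filler is
    available. *)
Let Z := homs_diagram horn_hom.

(* The solution of the equation of the top simplex when its map is 0 *)
Definition missing_map : ud_hom (A ord_max) (A ord0) :=
  ud_comp (size (drop ki.+1 I)) (dmap_at Z ord0 (take ki I) (nth ord0 I ki))
    (dmap_at Z (nth ord0 I ki) (drop ki.+1 I) ord_max)
  - isign ki.+1 *: \sum_(p < size I | p != Ordinal ki_lt)
      isign p.+1 *: dg_term Z ord0 I ord_max p.

Definition filler : diagram R n := homs_diagram (fun a t b =>
  if (a, t, b) == (ord0, del, ord_max) then some_hom missing_map else horn_hom a t b).

Let Y := filler.

Lemma filler_missing : dmap_at Y ord0 del ord_max = missing_map.
Proof.
rewrite /Y /filler homs_diagramE ?eqxx ?some_homK //.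
exact: chain_missing.
Qed.

Lemma horn_hom_top : hom_at (horn_hom ord0 I ord_max) ord0 ord_max = 0.
Proof.
rewrite /horn_hom; case: pselect => [e|ne]; last exact: some_homK.
by exfalso; case: e => z [m [x [i [s [j [c [/presents_misses/misses_top]]]]]]].
Qed.

Lemma filler_top : dmap_at Y ord0 I ord_max = 0.
Proof.
rewrite /Y /filler homs_diagramE ?chain_top //.
case: eqP => [[E]|_]; last exact: horn_hom_top.
by move: (congr1 size E); rewrite {1}inner_cut /del !size_cat /=; lia.
Qed.

Lemma fillerE a t b : chain a t b -> misses a t b -> dmap_at Y a t b = dmap_at Z a t b.
Proof.
move=> c ms; rewrite !homs_diagramE //; case: eqP => // -[a0 td bm].
by case: misses_missing; rewrite -td -a0 -bm.
Qed.

Lemma filler_horn m (x : mono m n) i s j (c : chain i s j) :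
  in_horn k x -> chain (x i) (map x s) (x j) ->
  dmap_at Y (x i) (map x s) (x j) = horn_phi x c.
Proof.
move=> hx c'; rewrite fillerE //; last first.
  by apply: (@presents_misses _ x i s j).
by rewrite homs_diagramE // (horn_homE c hx) some_homK.
Qed.

Lemma filler_pull m (x : mono m n) (hx : in_horn k x) :
  diagram_pull x Y = horn_diagram hx.
Proof.
rewrite horn_phiE; apply: diagram_eq => i j s c.
have [c'|nc'] := orP (orbN (chain (x i) (map x s) (x j))).
  pose F (h0 : chain (x i) (map x s) (x j)) := dmap Y h0.
  apply: etrans (dep_if_true F _ c') (etrans _ (filler_horn c hx c')).
  exact: esym (dep_if_true F _ c').
by apply: etrans (dep_if_false _ _ nc') (esym (horn_phi_degenerate c hx nc')).
Qed.

(** A chain of the horn is the image of a standard simplex on which the pullback of [Y] is a diagram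
    of the horn, hence satisfies all conditions. Stating [P] at the images under [T] avoids
    transport along equations of end points. *)
Lemma misses_ind (P : 'I_n.+1 -> seq 'I_n.+1 -> 'I_n.+1 -> Prop) :
  (forall q (T : mono q.+1 n) (hT : in_horn k T),
     chain (T ord0) (map T (inner q)) (T ord_max) ->
     fBialg (diagram_pull T Y) -> P (T ord0) (map T (inner q)) (T ord_max)) ->
  forall a t b, chain a t b -> misses a t b -> P a t b.
Proof.
move=> PT a t b c /(misses_presents c)[T [hT T0 Ts Tm]].
have := PT _ T hT; rewrite T0 Ts Tm => /(_ c); apply.
by rewrite filler_pull; apply: horn_diagram_fBialg.
Qed.

Lemma filler_horn_degree a t b : chain a t b -> misses a t b ->
  ud_degree (size t) (dmap_at Y a t b).
Proof.
move: a t b; apply: misses_ind => q T hT c [[_ T_deg _ _] _ _].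
have := T_deg _ _ _ (inner_chain q).
by rewrite dmap_at_pull ?inner_chain // dmap_ext_chain // size_map.
Qed.

Lemma filler_horn_equation a t b : chain a t b -> misses a t b ->
  dmap_diff Y a t b = dg_rhs Y a t b.
Proof.
move: a t b; apply: misses_ind => q T hT c [[_ _ _ T_eq] _ _].
have /dg_nerve_equationE/(dg_equation_pull T Y (inner_chain q)) := T_eq _ _ _ (inner_chain q).
apply: dg_equation_eq => // a t b c'; exact: dmap_ext_chain.
Qed.

Lemma filler_horn_morphism a b : chain a [::] b -> misses a [::] b ->
  morphism_relations (dmap_at Y a [::] b).
Proof.
move=> c ms; have [T [hT T0 Ts Tm]] := misses_presents c ms.
have : fBialg (diagram_pull T Y) by rewrite filler_pull; apply: horn_diagram_fBialg.
case=> _ _ /(_ _ _ (inner_chain 0)).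
rewrite dmap_at_pull ?inner_chain // dmap_ext_chain => [mor|]; last by rewrite T0 Tm.
pose P x y := morphism_relations (dmap_at Y x [::] y).
by rewrite -[morphism_relations _]/(P a b) -T0 -Tm.
Qed.

Lemma horn_obj_fBialg i : [/\ ud_degree (-1) (alpha i),
    forall a b x, ud_comp (-1) (alpha i) (alpha i) a b x = 0
  & fbialgebra_relations (alpha i)].
Proof.
have [[X_dd _ X_aa _] X_rel _] := horn_diagram_fBialg (vertex_in_horn i).
by split; [apply: (X_dd ord0)|apply: (X_aa ord0)|apply: (X_rel ord0)].
Qed.

(** A deleted vertex other than [k] is itself missed; front parts miss n and back parts miss 0, both
    different from [k] since the horn is inner. *)
Lemma misses_face (p : 'I_(size I)) :
  [/\ p != Ordinal ki_lt -> misses ord0 (take p I ++ drop p.+1 I) ord_max,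
      misses ord0 (take p I) (nth ord0 I p)
    & misses (nth ord0 I p) (drop p.+1 I) ord_max].
Proof.
have ps := ltn_ord p; have u := sorted_vertices_uniq.
have kin := k_inner; split.
- move=> pk; exists (nth ord0 I p).
    rewrite -nth_ki nth_uniq ?ki_lt //.
    by move: u; rewrite /= rcons_uniq => /and3P[].
  move: u; rewrite {1}(cut_nth ord0 ps) rcons_cat -cat_cons rcons_cons cat_uniq.
  rewrite /= negb_or => /and3P[_ /andP[p1 _] /andP[p2 _]].
  by rewrite rcons_cat -cat_cons mem_cat negb_or p1 p2.
- exists ord_max; first by rewrite -val_eqE /=; lia.
  move: u; rewrite {1}(cut_nth ord0 ps) -cat_rcons rcons_cat -cat_cons cat_uniq.
  move=> /and3P[_ /hasPn/(_ ord_max) + _]; apply.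
  by rewrite mem_rcons mem_head.
exists ord0; first by rewrite -val_eqE /=; lia.
move: u; rewrite {1}(cut_nth ord0 ps) rcons_cat rcons_cons /= => /andP[+ _].
by rewrite mem_cat negb_or => /andP[].
Qed.

Lemma missing_map_degree : ud_degree (size del) missing_map.
Proof.
have sz : (size del)%:Z = (size (take ki I))%:Z + (size (drop ki.+1 I))%:Z.
  by rewrite size_cat.
have deg (p : 'I_(size I)) : ud_degree (size del)
   (ud_comp (size (drop p.+1 I)) (dmap_at Z ord0 (take p I) (nth ord0 I p))
    (dmap_at Z (nth ord0 I p) (drop p.+1 I) ord_max)).
  have [_ m1 m2] := misses_face p; have [_ c1 c2] := chain_face (ltn_ord p) chain_top.
  rewrite -!fillerE // (_ : (size del)%:Z = (size (take p I))%:Z + (size (drop p.+1 I))%:Z).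
    by apply: ud_comp_degree; apply: filler_horn_degree.
  have := ltn_ord p; have := ki_lt.
  rewrite /del size_cat !size_take !size_drop; do 2 case: ifP; lia.
apply: ud_degreeB; first exact: (deg (Ordinal ki_lt)).
apply/ud_degreeZ/ud_degree_sum => p pk; apply: ud_degreeZ; apply: ud_degreeB => //.
have [/(_ pk) m1 _ _] := misses_face p; have [c1 _ _] := chain_face (ltn_ord p) chain_top.
rewrite -fillerE // (_ : size del = size (take p I ++ drop p.+1 I)).
  exact: filler_horn_degree.
have := ltn_ord p; have := ki_lt.
rewrite /del !size_cat !size_take !size_drop; do 2 case: ifP; lia.
Qed.

Lemma filler_degree a t b : chain a t b -> ud_degree (size t) (dmap_at Y a t b).
Proof.
move=> c; have [ms|nm] := pselect (misses a t b); first exact: filler_horn_degree.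
case: (chain_no_miss c nm) => -[-> -> ->].
  by rewrite filler_top; apply: ud_degree0.
by rewrite filler_missing; apply: missing_map_degree.
Qed.

(** The defining property of [missing_map]: in the [k]-th term its composite cancels, and the sign
    in front of its sum squares to 1. *)
Lemma filler_rhs_top : dg_rhs Y ord0 I ord_max = 0.
Proof.
rewrite /dg_rhs (bigD1 (Ordinal ki_lt)) //=.
rewrite {1}/dg_term filler_missing /missing_map /=.
have [_ m1 m2] := misses_face (Ordinal ki_lt).
have [_ c1 c2] := chain_face ki_lt chain_top.
rewrite (fillerE c1 m1) (fillerE c2 m2) addrAC subrr add0r scalerN scalerA isign_sqr scale1r.
apply/eqP; rewrite addrC subr_eq0; apply/eqP; apply: eq_bigr => p pk.
have [/(_ pk) mp1 mp2 mp3] := misses_face p.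
have [cp1 cp2 cp3] := chain_face (ltn_ord p) chain_top.
by rewrite /dg_term !fillerE.
Qed.

Lemma filler_equation a t b : chain a t b -> dmap_diff Y a t b = dg_rhs Y a t b.
Proof.
move=> c; have [ms|nm] := pselect (misses a t b); first exact: filler_horn_equation.
have Y_dd i : ud_degree (-1) (ddiff Y i) by have [] := horn_obj_fBialg i.
case: (chain_no_miss c nm) => -[-> -> ->].
  rewrite filler_rhs_top /dmap_diff filler_top.
  exact: lin0 (ud_diff_linear _ (ud_degree_linear (Y_dd _)) _).
(* For the [k]-th face: the other faces of the top simplex and the factors of all composites belong
   to the horn. *)
apply: (missing_face Y_dd (fun i j s c => filler_degree c) chain_top (k := Ordinal ki_lt)) => [p pk|p|p|].
- apply: filler_horn_equation; first by have [] := chain_face (ltn_ord p) chain_top.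
  by have [/(_ pk)] := misses_face p.
- apply: filler_horn_equation; first by have [] := chain_face (ltn_ord p) chain_top.
  by have [] := misses_face p.
- apply: filler_horn_equation; first by have [] := chain_face (ltn_ord p) chain_top.
  by have [] := misses_face p.
exact: filler_rhs_top.
Qed.

Lemma filler_morphism a b : chain a [::] b -> morphism_relations (dmap_at Y a [::] b).
Proof.
move=> c; have [ms|nm] := pselect (misses a [::] b); first exact: filler_horn_morphism.
have s0 : size I != 0%N by rewrite -lt0n (leq_ltn_trans _ ki_lt).
case: (chain_no_miss c nm) => -[-> tE ->]; first by rewrite -tE in s0.
have s1 : size I = 1%N.
  move: (congr1 size inner_cut); rewrite [RHS]size_cat /= addnS -size_cat.
  by rewrite -/del -tE.
(* With a single inner vertex, the sum over the inner vertices other than [k] is empty. *)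
rewrite tE filler_missing /missing_map big1 => [|p pk]; last first.
  have pE : p = Ordinal ki_lt; last by rewrite pE eqxx in pk.
  apply: val_inj => /=; have := ltn_ord p; have := ki_lt.
  by rewrite [in X in X -> _]s1 [X in _ -> (_ < X)%N -> _]s1; lia.
rewrite scaler0 subr0.
have k0 : ki = 0%N by have := ki_lt; rewrite s1; lia.
have tk : take ki I = [::] by rewrite k0 take0.
have dk : drop ki.+1 I = [::] by rewrite drop_oversize // k0 s1.
have [_ m1 m2] := misses_face (Ordinal ki_lt).
have [_ c1 c2] := chain_face ki_lt chain_top.
rewrite /= tk dk in m1 m2 c1 c2 *.
rewrite -!fillerE //; apply: morphism_relations_comp.
- exact: (filler_horn_degree c1 m1).
- exact: (filler_horn_degree c2 m2).
- exact: filler_horn_morphism.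
- exact: filler_horn_morphism.
Qed.

Lemma filler_fBialg : @fBialg R n Y.
Proof.
split; last by move=> i j c; apply: filler_morphism.
  split.
  - by move=> i; have [] := horn_obj_fBialg i.
  - by move=> i j s c; apply: filler_degree.
  - by move=> i; have [] := horn_obj_fBialg i.
  by move=> i j s c; apply/dg_nerve_equationE/filler_equation.
by move=> i; have [] := horn_obj_fBialg i.
Qed.

End HornData.

(** * From a simplex to a map out of the standard simplex *)

Section Yoneda.
Variables (X : sset) (n : nat) (y : X n).

Definition yoneda_fun m (f : std_simplex n m) : X m := pull f y.

Lemma yoneda_natural m p (f : mono m p) (x : std_simplex n p) :
  yoneda_fun (pull f x) = pull f (yoneda_fun x).
Proof. exact: pull_comp. Qed.

Definition yoneda : sset_map (std_simplex n) X := SSetMap yoneda_natural.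

End Yoneda.

Theorem mainTheorem5 (R : comPzRingType) :
  simplicial_subset (@PreBialg R) /\
  exists fBialg_subset : simplicial_subset (@fBialg R),
    weak_kan (sub_sset fBialg_subset).
Proof.
split; first exact: PreBialg_pull.
(* In dimension 0 there is no inner vertex. *)
exists (@fBialg_pull R) => -[|n] k k_inner h; first by case/andP: k_inner; case: (k : nat).
pose y : sub_sset (@fBialg_pull R) n.+1 := exist _ _ (filler_fBialg k_inner h).
exists (yoneda y) => m [x hx]; apply: sub_simplex_eq.
exact: (filler_pull k_inner h hx).
Qed.
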